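(* Let $R$ be a commutative Gaussian ring. Every $R$-module of finite flat dimension has flat dimension at most two; equivalently, $\operatorname{Fwd}(R)\leq 2$. Moreover, the bound can be attained by a local Gaussian total ring of quotients: there exists a local Gaussian ring $A$ that is a total ring of quotients and satisfies $\operatorname{Fwd}(A)=2$.
   Context: All rings are commutative with identity and all modules are unital. For $f\in R[t]$, the content $c(f)$ is the ideal of $R$ generated by the coefficients of $f$. A ring $R$ is Gaussian if $c(fg)=c(f)c(g)$ for all $f,g\in R[t]$. The flat dimension $\operatorname{fd}_R M$ is the smallest $n\ge 0$ such that there is an exact sequence $0\to F_n\to\cdots\to F_0\to M\to 0$ with all $F_i$ flat $R$-modules, and is $\infty$ if no such $n$ exists; the zero module has flat dimension $0$. The finitistic weak dimension is $\operatorname{Fwd}(R)=\sup\{\operatorname{fd}_R M: M \text{ an } R\text{-module with } \operatorname{fd}_R M<\infty\}$ (no finite generation condition on $M$). An element of a ring is regular if multiplication by it on the ring is injective; a total ring of quotients is a ring in which every regular element is a unit. A local ring is a ring with a unique maximal ideal (not necessarily Noetherian). *)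

(* Defs.v *)
From HB Require Import structures.
From mathcomp Require Import all_boot all_order all_algebra.
From mathcomp Require Import boolp classical_sets.

Set Implicit Arguments.
Unset Strict Implicit.
Unset Printing Implicit Defensive.

Import GRing.Theory.

Local Open Scope ring_scope.
Local Open Scope classical_set_scope.

(* Rings are [comPzRingType]s, so that the zero ring is included. *)

Section Ideals.
Variable R : comPzRingType.
Implicit Types (I J : set R).

Definition is_ideal I : Prop :=
  [/\ I 0, forall x y, I x -> I y -> I (x + y) & forall a x, I x -> I (a * x)].

Definition ideal_gen (S : set R) : set R :=
  [set x | forall I, is_ideal I -> S `<=` I -> I x].

Definition ideal_mul I J : set R :=
  ideal_gen [set z | exists x y, [/\ I x, J y & z = x * y]].

Definition maximal_ideal I : Prop :=
  [/\ is_ideal I, I <> setT &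
      forall J, is_ideal J -> I `<=` J -> J = I \/ J = setT].

Definition local_ring : Prop := exists! I, maximal_ideal I.

(* In a commutative ring [GRing.lreg a] says that multiplication by [a] is
   injective. *)
Definition total_ring_of_quotients : Prop :=
  forall a : R, GRing.lreg a -> exists b : R, a * b = 1.

(* The argument is meant to be the coefficient sequence of a polynomial. *)
Definition content (f : seq R) : set R := ideal_gen [set a | a \in f].

(* [{poly _}] needs a nonzero ring; this is [R] itself, repackaged. *)
Definition nz_ring (nzR : 1 != 0 :> R) : comNzRingType :=
  HB.pack (GRing.ComPzRing.sort R) (GRing.PzSemiRing_isNonZero.Build R nzR).

(* The condition is trivially true over the zero ring, whose only ideal is 0. *)
Definition gaussian : Prop :=
  forall (nzR : 1 != 0 :> R) (f g : {poly nz_ring nzR}),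
    content (f * g) = ideal_mul (content f) (content g).

End Ideals.

Lemma gaussian_nzE (A : comNzRingType) :
  gaussian A <->
  forall f g : {poly A}, content (f * g) = ideal_mul (content f) (content g).
Proof.
case: A => T [a b c d e f g h i j [k] l].
split=> [H|H nz]; first exact: (H k).
by rewrite (bool_irrelevance nz k).
Qed.

(* The tensor product M (x) N: formal sums of pairs, given as lists, modulo the
   congruence generated by commutativity of the sum and bilinearity. Negation
   sends (m, n) to (- m, n); [tens_zero] is what makes it an inverse. *)
Section Tensor.
Variables (R : comPzRingType) (M N : lmodType R).

Inductive tens_eq : seq (M * N) -> seq (M * N) -> Prop :=
| tens_refl s : tens_eq s s
| tens_sym s t : tens_eq s t -> tens_eq t s
| tens_trans s t u : tens_eq s t -> tens_eq t u -> tens_eq s u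
| tens_cat s s' t t' :
    tens_eq s s' -> tens_eq t t' -> tens_eq (s ++ t) (s' ++ t')
| tens_comm s t : tens_eq (s ++ t) (t ++ s)
| tens_zero n : tens_eq [:: (0, n)] [::]
| tens_addl m m' n : tens_eq [:: (m + m', n)] [:: (m, n); (m', n)]
| tens_addr m n n' : tens_eq [:: (m, n + n')] [:: (m, n); (m, n')]
| tens_scale a m n : tens_eq [:: (a *: m, n)] [:: (m, a *: n)].

Definition tens_rel : rel (seq (M * N)) := fun s t => `[< tens_eq s t >].

Fact tens_rel_refl : reflexive tens_rel.
Proof. by move=> s; apply/asboolP; exact: tens_refl. Qed.

Fact tens_rel_sym : symmetric tens_rel.
Proof. by move=> s t; apply/asboolP/asboolP => /tens_sym. Qed.

Fact tens_rel_trans : transitive tens_rel.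
Proof.
move=> t s u /asboolP st /asboolP tu; apply/asboolP; exact: tens_trans st tu.
Qed.

Canonical tens_equiv := EquivRel tens_rel
  tens_rel_refl tens_rel_sym tens_rel_trans.

Definition tensor := {eq_quot tens_equiv}%qT.
HB.instance Definition _ := Choice.on tensor.
HB.instance Definition _ := EqQuotient.on tensor.

Definition tens_class (s : seq (M * N)) : tensor := (\pi_tensor s)%qT.
Definition tens_mk (m : M) (n : N) : tensor := tens_class [:: (m, n)].

Lemma tens_classP s t : tens_class s = tens_class t <-> tens_eq s t.
Proof.
split; first by move=> /eqmodP /= /asboolP.
by move=> st; apply/eqmodP; apply/asboolP.
Qed.

Lemma tens_reprP s : tens_eq (repr (tens_class s)) s.
Proof. by apply/tens_classP; rewrite /tens_class reprK. Qed.

Lemma tens_classK (x : tensor) : tens_class (repr x) = x.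
Proof. by rewrite /tens_class reprK. Qed.

Definition tens_opp_seq (s : seq (M * N)) := [seq (- p.1, p.2) | p <- s].
Definition tens_scale_seq (a : R) (s : seq (M * N)) :=
  [seq (a *: p.1, p.2) | p <- s].

Lemma tens_scale_seq_eq a s t :
  tens_eq s t -> tens_eq (tens_scale_seq a s) (tens_scale_seq a t).
Proof.
elim=> //=.
- by move=> *; exact: tens_refl.
- by move=> *; exact: tens_sym.
- by move=> ? ? ? _ h1 _ h2; exact: tens_trans h1 h2.
- by move=> ? ? ? ? _ h1 _ h2; rewrite /tens_scale_seq !map_cat;
    exact: tens_cat.
- by move=> *; rewrite /tens_scale_seq !map_cat; exact: tens_comm.
- by move=> n; rewrite scaler0; exact: tens_zero.
- by move=> m m' n; rewrite scalerDr; exact: tens_addl.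
- by move=> m n n'; exact: tens_addr.
- by move=> b m n; rewrite scalerA mulrC -scalerA; exact: tens_scale.
Qed.

Lemma tens_opp_seqE s : tens_opp_seq s = tens_scale_seq (-1) s.
Proof. by apply: eq_map => p; rewrite scaleN1r. Qed.

Definition tens_add (x y : tensor) := tens_class (repr x ++ repr y).
Definition tens_opp (x : tensor) := tens_class (tens_opp_seq (repr x)).
Definition tens_scaler (a : R) (x : tensor) :=
  tens_class (tens_scale_seq a (repr x)).

Lemma tens_addE s t :
  tens_add (tens_class s) (tens_class t) = tens_class (s ++ t).
Proof. by apply/tens_classP/tens_cat; exact: tens_reprP. Qed.

Lemma tens_scalerE a s :
  tens_scaler a (tens_class s) = tens_class (tens_scale_seq a s).
Proof. by apply/tens_classP/tens_scale_seq_eq; exact: tens_reprP. Qed.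

Lemma tens_oppE s : tens_opp (tens_class s) = tens_class (tens_opp_seq s).
Proof.
apply/tens_classP; rewrite !tens_opp_seqE.
by apply: tens_scale_seq_eq; exact: tens_reprP.
Qed.

Fact tens_addA : associative tens_add.
Proof.
move=> x y z; rewrite -(tens_classK x) -(tens_classK y) -(tens_classK z).
by rewrite !tens_addE catA.
Qed.

Fact tens_addC : commutative tens_add.
Proof.
move=> x y; rewrite -(tens_classK x) -(tens_classK y) !tens_addE.
by apply/tens_classP; exact: tens_comm.
Qed.

Fact tens_add0 : left_id (tens_class [::]) tens_add.
Proof. by move=> x; rewrite -(tens_classK x) tens_addE. Qed.

Fact tens_addN : left_inverse (tens_class [::]) tens_opp tens_add.
Proof.
move=> x; rewrite -(tens_classK x) tens_oppE tens_addE; apply/tens_classP.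
elim: (repr x) => [|[m n] s IH] /=; first exact: tens_refl.
apply: (@tens_trans _ ([:: (- m, n); (m, n)] ++ (tens_opp_seq s ++ s))).
  rewrite -[_ :: _]/([:: (- m, n)] ++ (tens_opp_seq s ++ ([:: (m, n)] ++ s))).
  rewrite -[[:: _; _] ++ _]/([:: (- m, n)] ++
    ([:: (m, n)] ++ (tens_opp_seq s ++ s))).
  apply: tens_cat; first exact: tens_refl.
  rewrite !catA; apply: tens_cat; last exact: tens_refl.
  exact: tens_comm.
rewrite -[[::]]/([::] ++ [::]); apply: tens_cat => //.
apply: tens_trans (tens_zero n); apply: tens_sym.
by rewrite -{1}(addNr m); exact: tens_addl.
Qed.

HB.instance Definition _ :=
  GRing.isZmodule.Build tensor tens_addA tens_addC tens_add0 tens_addN.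

Lemma tens_classD s t :
  tens_class (s ++ t) = tens_class s + tens_class t :> tensor.
Proof. by rewrite -tens_addE. Qed.

Fact tens_scalerA a b x :
  tens_scaler a (tens_scaler b x) = tens_scaler (a * b) x.
Proof.
rewrite -(tens_classK x) !tens_scalerE; congr tens_class.
by rewrite /tens_scale_seq -map_comp; apply: eq_map => p /=; rewrite scalerA.
Qed.

Fact tens_scaler1 : left_id 1 tens_scaler.
Proof.
move=> x; rewrite -(tens_classK x) tens_scalerE; congr tens_class.
by rewrite -[RHS]map_id; apply: eq_map => -[m n] /=; rewrite scale1r.
Qed.

Fact tens_scalerDr : right_distributive tens_scaler +%R.
Proof.
move=> a x y; rewrite -(tens_classK x) -(tens_classK y) -tens_classD.
by rewrite !tens_scalerE /tens_scale_seq map_cat tens_classD.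
Qed.

Fact tens_scalerDl x : {morph tens_scaler^~ x : a b / a + b}.
Proof.
move=> a b; rewrite -(tens_classK x) /= !tens_scalerE -tens_classD.
apply/tens_classP; elim: (repr x) => [|[m n] s IH] /=; first exact: tens_refl.
apply: (@tens_trans _ ([:: (a *: m, n); (b *: m, n)] ++
                       (tens_scale_seq a s ++ tens_scale_seq b s))).
  rewrite -[_ :: _]/([:: ((a + b) *: m, n)] ++ tens_scale_seq (a + b) s).
  by apply: tens_cat => //; rewrite scalerDl; exact: tens_addl.
set p := (a *: m, n); set q := (b *: m, n).
rewrite -[[:: _; _] ++ _]/([:: p] ++
  ([:: q] ++ (tens_scale_seq a s ++ tens_scale_seq b s))).
rewrite -[X in tens_eq _ X]/([:: p] ++
  (tens_scale_seq a s ++ ([:: q] ++ tens_scale_seq b s))).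
apply: tens_cat; first exact: tens_refl.
rewrite !catA; apply: tens_cat; last exact: tens_refl.
exact: tens_comm.
Qed.

HB.instance Definition _ := GRing.Zmodule_isLmodule.Build R tensor
  tens_scalerA tens_scaler1 tens_scalerDr tens_scalerDl.

Lemma tens_classE s : tens_class s = \sum_(p <- s) tens_mk p.1 p.2.
Proof.
elim: s => [|[m n] s IH]; first by rewrite big_nil.
by rewrite big_cons -IH -tens_classD.
Qed.

Lemma tens_mkDl m m' n : tens_mk (m + m') n = tens_mk m n + tens_mk m' n.
Proof. by rewrite -tens_classD; apply/tens_classP; exact: tens_addl. Qed.

Lemma tens_mkDr m n n' : tens_mk m (n + n') = tens_mk m n + tens_mk m n'.
Proof. by rewrite -tens_classD; apply/tens_classP; exact: tens_addr. Qed.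

Lemma tens_mkZl a m n : tens_mk (a *: m) n = a *: tens_mk m n.
Proof. by rewrite [RHS]tens_scalerE. Qed.

Lemma tens_mkZr a m n : tens_mk m (a *: n) = a *: tens_mk m n.
Proof.
by rewrite -tens_mkZl; apply/tens_classP/tens_sym; exact: tens_scale.
Qed.

Section Universal.
Variables (P : lmodType R) (b : M -> N -> P).
Hypothesis bDl : forall m m' n, b (m + m') n = b m n + b m' n.
Hypothesis bDr : forall m n n', b m (n + n') = b m n + b m n'.
Hypothesis bZl : forall a m n, b (a *: m) n = a *: b m n.
Hypothesis bZr : forall a m n, b m (a *: n) = a *: b m n.

Lemma tensor_universal :
  exists2 g : {linear tensor -> P}, (forall m n, g (tens_mk m n) = b m n) &
  forall g' : {linear tensor -> P},
    (forall m n, g' (tens_mk m n) = b m n) -> g' =1 g.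
Proof.
pose e (s : seq (M * N)) := \sum_(p <- s) b p.1 p.2.
have eP s t : tens_eq s t -> e s = e t.
  elim=> //; rewrite /e.
  - by move=> ? ? ? _ -> _ ->.
  - by move=> ? ? ? ? _ h1 _ h2; rewrite !big_cat /= h1 h2.
  - by move=> ? ?; rewrite !big_cat /= addrC.
  - by move=> n; rewrite big_nil big_seq1 /= -[0 in LHS](scale0r 0) bZl scale0r.
  - by move=> *; rewrite !big_cons !big_nil /= bDl !addr0.
  - by move=> *; rewrite !big_cons !big_nil /= bDr !addr0.
  - by move=> *; rewrite !big_seq1 /= bZl bZr.
pose g (x : tensor) := e (repr x).
have gE s : g (tens_class s) = e s by apply/eP/tens_reprP.
have g_lin : linear g.
  move=> a x y; rewrite -(tens_classK x) -(tens_classK y).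
  rewrite -[a *: _]/(tens_scaler _ _) tens_scalerE -tens_classD !gE /e.
  rewrite big_cat /= big_map scaler_sumr; congr (_ + _).
  by apply: eq_bigr => p _; rewrite bZl.
pose gL := GRing.isLinear.Build R tensor P *:%R g g_lin.
pose G : {linear tensor -> P} := HB.pack g gL.
exists G; first by move=> m n; rewrite -[LHS]/(g _) gE /e big_seq1.
move=> g' g'E x; rewrite -(tens_classK x) -[RHS]/(g _) gE tens_classE.
by rewrite linear_sum; apply: eq_bigr => p _; rewrite g'E.
Qed.

End Universal.

End Tensor.

Section Flat.
Variable R : comPzRingType.

(* The map M (x) N -> M (x) N' induced by f : N -> N'. *)
Definition tensor_map (M N N' : lmodType R) (f : N -> N')
    (x : tensor M N) : tensor M N' :=
  \sum_(p <- repr x) tens_mk p.1 (f p.2).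

Lemma tensor_map_mk (M N N' : lmodType R) (f : {linear N -> N'}) m n :
  tensor_map f (tens_mk m n) = tens_mk m (f n) :> tensor M N'.
Proof.
have := @tensor_universal R M N (tensor M N') (fun m n => tens_mk m (f n)).
case.
- by move=> *; rewrite tens_mkDl.
- by move=> *; rewrite linearD tens_mkDr.
- by move=> *; rewrite tens_mkZl.
- by move=> *; rewrite linearZ tens_mkZr.
move=> g gE _; rewrite -gE -[in RHS](tens_classK (tens_mk m n)) tens_classE.
by rewrite linear_sum; apply: eq_bigr => p _; rewrite gE.
Qed.

Fact tensor_map_is_linear (M N N' : lmodType R) (f : {linear N -> N'}) :
  linear (tensor_map f : tensor M N -> tensor M N').
Proof.
have := @tensor_universal R M N (tensor M N') (fun m n => tens_mk m (f n)).
case.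
- by move=> *; rewrite tens_mkDl.
- by move=> *; rewrite linearD tens_mkDr.
- by move=> *; rewrite tens_mkZl.
- by move=> *; rewrite linearZ tens_mkZr.
move=> g gE _.
have E x : tensor_map f x = g x.
  rewrite -[in RHS](tens_classK x) tens_classE linear_sum.
  by apply: eq_bigr => p _; rewrite gE.
by move=> a x y; rewrite !E linearP.
Qed.

HB.instance Definition _ (M N N' : lmodType R) (f : {linear N -> N'}) :=
  GRing.isLinear.Build R (tensor M N) (tensor M N') *:%R (tensor_map f)
    (@tensor_map_is_linear M N N' f).

Definition flat (M : lmodType R) : Prop :=
  forall (N N' : lmodType R) (f : {linear N -> N'}),
    injective f -> injective (tensor_map f : tensor M N -> tensor M N').

(* An exact sequence 0 -> F_n -> ... -> F_0 -> M -> 0 with all F_i flat is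
   indexed by all of [nat], with F_i = 0 for i > n. *)
Definition has_flat_resolution (M : lmodType R) (n : nat) : Prop :=
  exists (F : nat -> lmodType R) (d : forall i, {linear F i.+1 -> F i})
    (e : {linear F 0%N -> M}),
    [/\ forall i, flat (F i),
        forall i, (n < i)%N -> forall x : F i, x = 0,
        forall y, exists x, e x = y,
        forall x, e x = 0 <-> exists y, d 0%N y = x &
        forall i x, d i x = 0 <-> exists y, d i.+1 y = x].

End Flat.

(* Extended natural numbers: [Some n] is n and [None] is infinity. *)
Definition enat_le (x y : option nat) : Prop :=
  match x, y with
  | _, None => True
  | None, Some _ => False
  | Some m, Some n => (m <= n)%N
  end.

(* The least element of [S], or infinity if [S] is empty. *)
Definition enat_inf (S : set nat) : option nat :=
  match pselect (exists n, `[< S n >]) with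
  | left exS => Some (ex_minn exS)
  | right _ => None
  end.

Definition enat_sup (S : set nat) : option nat :=
  enat_inf [set b | forall n, S n -> (n <= b)%N].

Definition fd (R : comPzRingType) (M : lmodType R) : option nat :=
  enat_inf [set n | has_flat_resolution M n].

Definition Fwd (R : comPzRingType) : option nat :=
  enat_sup [set n | exists M : lmodType R, fd M = Some n].

(* Main.v *)
Require Import Defs.
From HB Require Import structures.
From mathcomp Require Import all_boot all_algebra.
From mathcomp Require Import boolp classical_sets functions.
From mathcomp Require Import ring.

Set Implicit Arguments.
Unset Strict Implicit.
Unset Printing Implicit Defensive.

Import GRing.Theory.


(** Only one thing has to be shown for the bound: if F2 -> F1 -> F0 is exact at
    F1, the three modules and the kernel K2 of f2 : F2 -> F1 are flat, and the
    ring is Gaussian, then the kernel of f1 : F1 -> F0 is flat ([eqflat_ker]).  A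
    flat resolution of length n > 2 can then be shortened from its end until its
    length is 2.  Flatness is used throughout in its equational form, every
    linear relation is a consequence of relations in the ring, whose equivalence
    with exactness of the tensor product is [flat_eqflat] and [eqflat_flat].

    Flatness of ker f1 can be tested at the maximal ideals, so let R be local
    with maximal ideal P.  The Gaussian condition on linear polynomials gives
    that (a, b)^2 is generated by a^2 or by b^2 ([gaussian_square]).  Hence the
    square-zero elements form an ideal D with D^2 = 0, elements outside D have
    their annihilator inside D, and R / D is a chain ring.  A relation in ker f1
    is trivialised first modulo D, where one coefficient divides the others, and
    then for coefficients in D.  What stands in the way is, for each a, the
    obstruction group (K2 cap J F2) / J K2 with J = a R + D, together with the
    same quotient for J = D.  The latter vanishes directly, since an element of D
    or outside D with annihilator inside D kills any given element of K2 cap D F2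
    ([span_sqzero_ker]).

    For the former, let h represent a nonzero class.  Because R / D is a chain
    ring, the elements with a power killing the class form a prime ideal, and
    after localising there every element of P has such a power ([good_local]).
    It remains to refute this situation ([good_of_radical]).  The exactness of
    the complex enters through [kernel_in_max]: if f2 g is in D F1 then g is in
    P F2 + K2, by solving linear systems with unknowns in D.  It allows h to be
    replaced by a representative in (a p R + D) F2 for some p in P dividing a
    ([deepen]), while divisibility in R / D allows an obstruction modulo a that
    is killed by p to be divided by a / p, giving one modulo p ([descend]).  Both
    together produce an obstruction h so divisible that some element y kills it,
    possibly modulo D, while (0 : y), or (D : y), is inside J; flatness of K2 then
    makes its class zero.  The one exception is an h in (p^2 R + D) F2 modulo p,
    which splits into p times an element of K2 and an element of K2 killed by p
    ([good_of_square]).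

    The bound is attained by the ring A generated over a field by the powers
    t^(1/2^n), with all powers of t of exponent greater than 1 put equal to 0.
    Its elements are powers of t times units, so it is a chain ring, hence local
    and Gaussian; every non-unit is killed by t, hence it is its own total ring
    of quotients.  The annihilator P of t is its maximal ideal, which is flat
    because t^e is the product of two copies of t^(e/2), and the annihilator of P
    is t A.  So 0 -> P -> A -> A -> A / t A -> 0, with multiplication by t in the
    middle, is a flat resolution of length 2, and no shorter one exists
    ([quotient_not_resolved]). *)

(** * Ideal multiples of a submodule and the equational form of flatness *)

Definition sum_fun (A B C : Type) (f : A -> C) (g : B -> C) (s : A + B) : C :=
  match s with inl a => f a | inr b => g b end.

Lemma sum_unit (V : nmodType) (F : unit -> V) : (\sum_t F t = F tt)%R.
Proof. by rewrite (bigD1 tt) //= big1 ?addr0 // => -[]. Qed.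

Lemma total_minimum (T : finType) (X : Type) (le : X -> X -> Prop) (r : T -> X) (t : T) :
  (forall x y, le x y \/ le y x) -> (forall x y z, le x y -> le y z -> le x z) ->
  exists t0, forall t, le (r t0) (r t).
Proof.
move=> tot trans; have [s sP] : exists s : seq T, s =i T.
  by exists (enum T) => x; rewrite mem_enum.
suff [t0 H] : exists t0 : T, forall x : T, x \in s -> le (r t0) (r x).
  by exists t0 => x; apply: H; rewrite sP.
elim: s {sP} => [|x s [t0 H]]; first by exists t.
case: (tot (r t0) (r x)) => E.
  by exists t0 => y; rewrite inE => /predU1P [->//|]; exact: H.
exists x => y; rewrite inE => /predU1P [->|ys]; first by case: (tot (r x) (r x)).
by apply: trans E _; exact: H.
Qed.

Section Span.
Local Open Scope ring_scope.
Variables (R : comPzRingType) (M : lmodType R).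
Implicit Types (I J : R -> Prop) (K L : M -> Prop).

(** Kernels are handled as predicates on an ambient module, because the argument
    keeps comparing their elements with elements outside them. *)
Definition is_submod K : Prop :=
  [/\ K 0, forall x y, K x -> K y -> K (x + y) & forall a x, K x -> K (a *: x)].

(** The product of an ideal and a submodule, generated term by term so that facts
    about it are proved for one product r w at a time. *)
Inductive span I K : M -> Prop :=
| span0 : span I K 0
| spanS r w x : I r -> K w -> span I K x -> span I K (r *: w + x).

Lemma span_gen I K r w : I r -> K w -> span I K (r *: w).
Proof. by move=> Ir Kw; rewrite -[_ *: _]addr0; apply: spanS Ir Kw _; exact: span0. Qed.

Lemma spanD I K x y : span I K x -> span I K y -> span I K (x + y).
Proof.
move=> + Sy; elim=> [|r w z Ir Kw _ IH]; first by rewrite add0r.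
by rewrite -addrA; apply: spanS.
Qed.

Lemma spanZ I K a x : is_ideal I -> span I K x -> span I K (a *: x).
Proof.
move=> [_ _ IM]; elim=> [|r w z Ir Kw _ IH]; first by rewrite scaler0; exact: span0.
by rewrite scalerDr scalerA; apply: spanS => //; exact: IM.
Qed.

Lemma spanN I K x : is_ideal I -> span I K x -> span I K (- x).
Proof. by move=> iI Sx; rewrite -scaleN1r; exact: spanZ. Qed.

Lemma spanB I K x y : is_ideal I -> span I K x -> span I K y -> span I K (x - y).
Proof. by move=> iI Sx Sy; apply: spanD => //; exact: spanN. Qed.

Lemma span_sum I K (T : finType) (x : T -> M) :
  (forall t, span I K (x t)) -> span I K (\sum_t x t).
Proof. by move=> Sx; elim/big_ind: _ => //; [exact: span0|exact: spanD]. Qed.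

Lemma span_mono I J K L x : (forall r, I r -> J r) -> (forall w, K w -> L w) ->
  span I K x -> span J L x.
Proof.
by move=> IJ KL; elim=> [|r w z Ir Kw _ IH]; [exact: span0|apply: spanS; auto].
Qed.

Lemma span_annih I K a x : (forall r, I r -> a * r = 0) -> span I K x -> a *: x = 0.
Proof.
move=> aI; elim=> [|r w z Ir Kw _ IH]; first exact: scaler0.
by rewrite scalerDr scalerA aI // scale0r add0r.
Qed.

Lemma span_zero K x : span (fun r => r = 0) K x -> x = 0.
Proof. by elim=> // r w z -> _ _ ->; rewrite scale0r addr0. Qed.

Lemma span_scale I J K a x : (forall r, I r -> J (a * r)) -> span I K x -> span J K (a *: x).
Proof.
move=> aI; elim=> [|r w z Ir Kw _ IH]; first by rewrite scaler0; exact: span0.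
by rewrite scalerDr scalerA; apply: spanS => //; exact: aI.
Qed.

Lemma spanP I K x : span I K x -> exists (T : finType) (r : T -> R) (w : T -> M),
  [/\ forall t, I (r t), forall t, K (w t) & x = \sum_t r t *: w t].
Proof.
elim=> [|r w z Ir Kw _ [T [r' [w' [Ir' Kw' ->]]]]].
  exists void, (fun _ => 0), (fun _ => 0); split; [by case|by case|].
  by rewrite big_pred0 //; case.
exists (option T), (oapp r' r), (oapp w' w); split; [by case|by case|].
rewrite (bigD1 None) //=; congr (_ + _).
rewrite (reindex_omap Some id) /=; last by case.
by apply: eq_bigl => t; rewrite eqxx.
Qed.

Lemma submod_sum K (T : finType) (P : pred T) (r : T -> R) (w : T -> M) :
  is_submod K -> (forall t, K (w t)) -> K (\sum_(t | P t) r t *: w t).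
Proof.
move=> [K0 KD KZ] Kw; elim/big_ind: _ => // t _; exact: KZ.
Qed.

Lemma submodB K x y : is_submod K -> K x -> K y -> K (x - y).
Proof. by move=> [_ KD KZ] Kx Ky; apply: KD => //; rewrite -scaleN1r; exact: KZ. Qed.

Lemma sum_delta (T : finType) (x : T -> M) i : \sum_j (i == j)%:R *: x j = x i.
Proof.
rewrite (bigD1 i) //= eqxx scale1r big1 ?addr0 // => j.
by rewrite eq_sym => /negPf->; rewrite scale0r.
Qed.

Lemma submodT : is_submod (fun _ : M => True). Proof. by []. Qed.

End Span.

Lemma span_map (R : comPzRingType) (M N : lmodType R) (f : M -> N)
    (I : R -> Prop) (K : M -> Prop) (L : N -> Prop) x :
  linear f -> (forall w, K w -> L (f w)) -> span I K x -> span I L (f x).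
Proof.
move=> fP KL; elim=> [|r w z Ir Kw _ IH].
  have /eqP := fP 1%R 0%R 0%R; rewrite !scale1r !addr0 -subr_eq subrr => /eqP<-.
  exact: span0.
by rewrite fP; apply: spanS => //; exact: KL.
Qed.

Lemma submod_ker (R : comPzRingType) (M N : lmodType R) (f : {linear M -> N}) :
  is_submod (fun x => f x = 0)%R.
Proof.
split=> [|x y fx fy|a x fx]; first exact: linear0.
  by rewrite linearD fx fy addr0.
by rewrite linearZ /= fx scaler0.
Qed.

Lemma ideal_zero (R : comPzRingType) : is_ideal (fun r : R => r = 0)%R.
Proof. by split=> [//|b c -> ->|b c ->]; rewrite ?addr0 ?mulr0. Qed.

Section EquationalFlatness.
Local Open Scope ring_scope.
Variables (R : comPzRingType) (M : lmodType R).
Implicit Types (D : R -> Prop) (K : M -> Prop).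

(** For D = 0 this is the equational criterion: K is flat when every linear
    relation in K is a consequence of relations in the ring.  For general D it
    is the same criterion for K / D K over R / D. *)
Definition eqflat_mod D K : Prop :=
  forall (I : finType) (a : I -> R) (x : I -> M),
    (forall i, K (x i)) -> span D K (\sum_i a i *: x i) ->
    exists (J : finType) (v : I -> J -> R) (w : J -> M),
      [/\ forall j, K (w j), forall i, x i = \sum_j v i j *: w j &
          forall j, D (\sum_i a i * v i j)].

Definition eqflat K : Prop := eqflat_mod (fun r => r = 0) K.

Lemma eqflat_trivialise K (I : finType) (a : I -> R) (x : I -> M) :
  eqflat K -> (forall i, K (x i)) -> \sum_i a i *: x i = 0 ->
  exists (J : finType) (v : I -> J -> R) (w : J -> M),
    [/\ forall j, K (w j), forall i, x i = \sum_j v i j *: w j &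
        forall j, \sum_i a i * v i j = 0].
Proof. by move=> fK Kx ax0; apply: fK => //; rewrite ax0; exact: span0. Qed.

Lemma eqflatI K :
  (forall (I : finType) (a : I -> R) (x : I -> M),
    (forall i, K (x i)) -> \sum_i a i *: x i = 0 ->
    exists (J : finType) (v : I -> J -> R) (w : J -> M),
      [/\ forall j, K (w j), forall i, x i = \sum_j v i j *: w j &
        forall j, \sum_i a i * v i j = 0]) -> eqflat K.
Proof. by move=> H I a x Kx /span_zero; exact: H. Qed.

Lemma sum_scale_exchange (I J : finType) (a : I -> R) (v : I -> J -> R) (w : J -> M) :
  \sum_i a i *: (\sum_j v i j *: w j) = \sum_j (\sum_i a i * v i j) *: w j.
Proof.
under eq_bigr do rewrite scaler_sumr; rewrite exchange_big /=.
by apply: eq_bigr => j _; rewrite scaler_suml; apply: eq_bigr => i _; rewrite scalerA.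
Qed.

Lemma sum_mul_exchange (I J L : finType) (a : I -> R) (v : I -> J -> R) (u : J -> L -> R) l :
  \sum_i a i * (\sum_j v i j * u j l) = \sum_j (\sum_i a i * v i j) * u j l.
Proof.
under eq_bigr do rewrite mulr_sumr; rewrite exchange_big /=.
by apply: eq_bigr => j _; rewrite mulr_suml; apply: eq_bigr => i _; rewrite mulrA.
Qed.

Lemma ideal_sum D (T : finType) (r u : T -> R) : is_ideal D ->
  (forall t, D (r t)) -> D (\sum_t r t * u t).
Proof.
move=> [D0 DD DM] Dr; elim/big_ind: _ => // t _; by rewrite mulrC; apply: DM.
Qed.

(** Relations can be trivialised one after the other: expressing the x i by the
    w j turns the next relation into one among the w j, and the coefficient
    relations already obtained persist because D is an ideal. *)
Lemma eqflat_mod_system D K (n : nat) (I : finType) (a : nat -> I -> R) (x : I -> M) :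
  is_ideal D -> eqflat_mod D K -> (forall i, K (x i)) ->
  (forall k, (k < n)%N -> span D K (\sum_i a k i *: x i)) ->
  exists (J : finType) (v : I -> J -> R) (w : J -> M),
    [/\ forall j, K (w j), forall i, x i = \sum_j v i j *: w j &
      forall k, (k < n)%N -> forall j, D (\sum_i a k i * v i j)].
Proof.
move=> iD fK; elim: n I a x => [|n IH] I a x Kx Hs.
  exists I, (fun i j => (i == j)%:R), x; split=> // i.
  by rewrite sum_delta.
have [J [v [w [Kw xE av]]]] := IH _ _ _ Kx (fun k kn => Hs k (ltnW kn)).
have := Hs n (ltnSn n); under eq_bigr do rewrite xE.
rewrite sum_scale_exchange => /(fK _ _ _ Kw) [L [u [z [Kz wE au]]]].
exists L, (fun i l => \sum_j v i j * u j l), z; split=> // [i|k].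
  by rewrite xE; under eq_bigr do rewrite wE; rewrite sum_scale_exchange.
rewrite ltnS leq_eqVlt => /predU1P [->|kn] l; rewrite sum_mul_exchange //.
by apply: ideal_sum => // j; exact: av.
Qed.

Lemma eqflat_mod_finite_system D K (T I : finType) (a : T -> I -> R) (x : I -> M) :
  is_ideal D -> eqflat_mod D K -> (forall i, K (x i)) ->
  (forall t, span D K (\sum_i a t i *: x i)) ->
  exists (J : finType) (v : I -> J -> R) (w : J -> M),
    [/\ forall j, K (w j), forall i, x i = \sum_j v i j *: w j &
      forall t j, D (\sum_i a t i * v i j)].
Proof.
move=> iD fK Kx Hs; pose s := [seq a t | t <- enum T].
pose b k := nth (fun _ => 0) s k.
have [k|J [v [w [Kw xE bv]]]] := @eqflat_mod_system D K (size s) I b x iD fK Kx.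
  rewrite /b size_map => ks; have [t _] : exists t : T, true.
    by case: (enum T) ks => // t; exists t.
  by rewrite (nth_map t) //; exact: Hs.
exists J, v, w; split=> // t j.
have tE : (index t (enum T) < size (enum T))%N by rewrite index_mem mem_enum.
have := bv (index t (enum T)); rewrite /b size_map (nth_map t) // nth_index ?mem_enum //.
by apply.
Qed.

(** In a flat module a relation modulo D becomes an honest one once the terms
    witnessing membership in D M are added to it. *)
Lemma eqflat_modW D K : is_ideal D -> eqflat K -> eqflat_mod D K.
Proof.
move=> iD fK I a x Kx /spanP [T [d [y [Dd Ky axE]]]].
have [||J [v [w [Kw xE av]]]] := @eqflat_trivialise K (I + T)%type
  (fun k => match k with inl i => a i | inr t => - d t end)
  (fun k => match k with inl i => x i | inr t => y t end) fK.
- by case.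
- rewrite big_sumType /= axE -big_split /= big1 // => t _.
  by rewrite scaleNr subrr.
exists J, (fun i j => v (inl i) j), w; split=> // [i|j]; first exact: (xE (inl i)).
have := av j; rewrite big_sumType /= => /eqP; rewrite addr_eq0 => /eqP->.
rewrite -sumrN; have : D (\sum_t d t * v (inr t) j) by exact: ideal_sum.
by congr D; apply: eq_bigr => t _; rewrite mulNr opprK.
Qed.

(** This is how flatness is used most often: the coefficients of an element of K
    can be chosen to satisfy whatever relation the element itself satisfies. *)
Lemma eqflat_colon D K a x : is_ideal D -> eqflat_mod D K -> K x ->
  span D K (a *: x) -> span (fun r => D (a * r)) K x.
Proof.
move=> iD fK Kx ax.
have [||J [v [w [Kw xE av]]]] := fK unit (fun _ => a) (fun _ => x) => //.
  by rewrite sum_unit.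
rewrite (xE tt); apply: span_sum => j; apply: span_gen => //.
by have := av j; rewrite sum_unit.
Qed.

Lemma eqflat_annih K a x : eqflat K -> K x ->
  a *: x = 0 -> span (fun r => a * r = 0) K x.
Proof.
move=> fK Kx ax; by apply: eqflat_colon fK Kx _; [exact: ideal_zero|rewrite ax; exact: span0].
Qed.

End EquationalFlatness.

(** * Local Gaussian rings *)

Section LocalGaussian.
Local Open Scope ring_scope.

(** The part of the Gaussian condition used below: for linear polynomials,
    c(f) c(g) is contained in c(fg).  Unlike the condition on all polynomials it
    is visibly inherited by localisations. *)
Definition degree_one_gaussian (R : comPzRingType) : Prop := forall x y z w : R,
  exists a b c, x * w = a * (x * z) + b * (x * w + y * z) + c * (y * w).

Definition invertible (R : comPzRingType) (a : R) : Prop := exists b, a * b = 1.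

Definition is_local (R : comPzRingType) : Prop := 1 <> 0 :> R /\
  forall a b : R, invertible (a + b) -> invertible a \/ invertible b.

Variable R : comPzRingType.
Hypothesis gR : degree_one_gaussian R.
Hypothesis lR : is_local R.
Implicit Types a b c d p q r s u x y : R.

Definition sqzero x : Prop := x * x = 0.

(** With b^2 = s a^2 and a b = 0, the product of b + a X and - s a + b X is
    zero, whereas b^2 lies in the product of their contents. *)
Lemma gaussian_orthogonal a b s : a * b = 0 -> b * b = s * (a * a) -> b * b = 0.
Proof.
move=> ab bb; have [k [l [m ->]]] := gR b a (- (s * a)) b.
have -> : b * - (s * a) = - s * (a * b) by ring.
have -> : b * b + a * - (s * a) = b * b - s * (a * a) by ring.
by rewrite ab bb subrr !mulr0 !addr0.
Qed.

Lemma invertibleMl a b : invertible (a * b) -> invertible a.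
Proof. by case=> c abc; exists (b * c); rewrite mulrA. Qed.

Lemma noninvD a b : ~ invertible a -> ~ invertible b -> ~ invertible (a + b).
Proof. by move=> na nb /(proj2 lR) []. Qed.

Lemma noninvM a b : ~ invertible b -> ~ invertible (a * b).
Proof. by move=> nb; rewrite mulrC => /invertibleMl. Qed.

Lemma invertible1 : invertible (1 : R). Proof. by exists 1; rewrite mulr1. Qed.

Lemma noninv_compl a : ~ invertible a -> invertible (1 - a).
Proof.
move=> na; have [] // := proj2 lR (1 - a) a.
by rewrite subrK; exact: invertible1.
Qed.

(** When u is a unit, a + b X and (b - u a) + u b X have a product all of whose
    coefficients are multiples of b^2. *)
Let square_dvd_unit a b u v : a * b = u * (a * a) + v * (b * b) -> invertible u ->
  exists r s, a * b = r * (b * b) /\ a * a = s * (b * b).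
Proof.
move=> ab [t ut]; have [k [l [m]]] := gR a b (b - u * a) (u * b).
have -> : a * (b - u * a) = v * (b * b) by rewrite mulrBr ab; ring.
have -> : a * (u * b) + b * (b - u * a) = b * b by ring.
move=> E; set w := t * (k * v + l + m * u).
have abE : a * b = w * (b * b).
  by rewrite -[LHS]mul1r -ut; transitivity (t * (a * (u * b))); [ring|rewrite E /w; ring].
exists w, (t * (w - v)); split=> //.
have -> : t * (w - v) * (b * b) = t * (a * b - v * (b * b)) by rewrite abE; ring.
by rewrite ab; transitivity (u * t * (a * a)); [rewrite ut mul1r|ring].
Qed.

(** The ideal (a, b)^2 is generated by a^2 or by b^2.  The condition on contents
    yields a b = u a^2 + v b^2, and then another pair of generators of (a, b) is
    chosen so that all the coefficients of the product of two linear polynomials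
    are multiples of one element. *)
Lemma gaussian_square a b :
  (exists r s, a * b = r * (a * a) /\ b * b = s * (a * a)) \/
  (exists r s, a * b = r * (b * b) /\ a * a = s * (b * b)).
Proof.
(* The product of a + b X and a - b X has no linear term. *)
have [k [l [m E]]] := gR a b a (- b).
set u := - k; set v := m.
have ab : a * b = u * (a * a) + v * (b * b).
  transitivity (- (a * - b)); first by ring.
  by rewrite E /u /v; ring.
have [iu|nu] := EM (invertible u); first by right; exact: square_dvd_unit ab iu.
have [iv|nv] := EM (invertible v).
  have ba : b * a = v * (b * b) + u * (a * a) by rewrite mulrC ab addrC.
  have [r [s [E1 E2]]] := square_dvd_unit ba iv.
  by left; exists r, s; rewrite mulrC.
(* With this w the coefficients of (a + b X) ((w a + b) - (a + w b) X) are
   v e, e and u e, so a (a + w b) is a multiple of e.  As a b = v e - w a^2 and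
   1 - w^2 is a unit, a^2 = g e = g b^2 - g a^2. *)
pose w := - (u + v); pose e := b * b - a * a.
have [k' [l' [m']]] := gR a b (w * a + b) (- a - w * b).
have -> : a * (w * a + b) = v * e.
  by transitivity (w * (a * a) + a * b); [ring|rewrite ab /w /e; ring].
have -> : a * (- a - w * b) + b * (w * a + b) = e by rewrite /e; ring.
have -> : b * (- a - w * b) = u * e.
  by transitivity (- (a * b) - w * (b * b)); [ring|rewrite ab /w /e; ring].
move=> F; set f := k' * v + l' + m' * u.
have {}F : a * a + w * (a * b) = - f * e.
  by transitivity (- (a * (- a - w * b))); [ring|rewrite F /f; ring].
have ab' : a * b = v * e - w * (a * a) by rewrite ab /w /e; ring.
have nw : ~ invertible w.
  by rewrite /w -mulN1r; apply: noninvM; exact: noninvD.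
have [t wt] := noninv_compl (noninvM (a := w) nw).
pose g := t * (- f - w * v).
have aa : a * a = g * e.
  transitivity ((1 - w * w) * t * (a * a)); first by rewrite wt mul1r.
  transitivity (t * (a * a + w * (a * b) - w * v * e)); first by rewrite ab'; ring.
  by rewrite F /g; ring.
have ig : invertible (1 + g) \/ invertible g.
  have [||] := proj2 lR (1 + g) (- g); [|by left|by case=> h gh; right; exists (- h); rewrite mulrN -mulNr].
  by rewrite addrK; exact: invertible1.
have aab : (1 + g) * (a * a) = g * (b * b) by rewrite mulrDl mul1r {1}aa /e; ring.
case: ig => -[h hg].
  have E2 : a * a = h * g * (b * b).
    by rewrite -mulrA -aab mulrA [h * _]mulrC hg mul1r.
  right; exists (v * (1 - h * g) - w * (h * g)), (h * g); split=> //.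
  by rewrite ab' /e E2; ring.
have E2 : b * b = h * (1 + g) * (a * a).
  by rewrite -mulrA aab mulrA [h * _]mulrC hg mul1r.
left; exists (v * (h * (1 + g) - 1) - w), (h * (1 + g)); split=> //.
by rewrite ab' /e E2; ring.
Qed.

(** One of x^2, y^2 generates (x, y)^2, and both vanish. *)
Lemma sqzero_mul x y : sqzero x -> sqzero y -> x * y = 0.
Proof.
rewrite /sqzero => xx yy; case: (gaussian_square x y) => -[r [s [-> _]]].
  by rewrite xx mulr0.
by rewrite yy mulr0.
Qed.

Lemma ideal_sqzero : is_ideal sqzero.
Proof.
rewrite /sqzero; split=> [|x y xx yy|a x xx]; first by rewrite mulr0.
  have -> : (x + y) * (x + y) = x * x + y * y + 2%:R * (x * y) by ring.
  by rewrite xx yy (sqzero_mul xx yy) mulr0 !addr0.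
by rewrite mulrACA xx mulr0.
Qed.

(** When (a, b)^2 is generated by a^2, the multiple r a with a b = r a^2 plays
    the part of the orthogonal projection of b on a; the remainder is square-zero
    by [gaussian_orthogonal]. *)
Lemma gaussian_split a b :
  (exists r b', [/\ b = r * a + b', a * b' = 0 & sqzero b']) \/
  (exists r a', [/\ a = r * b + a', b * a' = 0 & sqzero a']).
Proof.
have split1 x y : (exists r s, x * y = r * (x * x) /\ y * y = s * (x * x)) ->
    exists r y', [/\ y = r * x + y', x * y' = 0 & sqzero y'].
  move=> [r [s [xy yy]]]; exists r, (y - r * x).
  have o : x * (y - r * x) = 0 by rewrite mulrBr xy; ring.
  split=> //; first by rewrite addrC subrK.
  apply: (gaussian_orthogonal (s := s - r * r) o).
  transitivity (y * y - 2%:R * r * (x * y) + r * r * (x * x)); first by ring.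
  by rewrite xy yy; ring.
case: (gaussian_square a b) => H; first by left; exact: split1.
by right; apply: split1; case: H => r [s [E1 E2]]; exists r, s; rewrite mulrC.
Qed.

(** One of a^2 and y^2 divides the other, and [gaussian_orthogonal] makes the
    multiple vanish; it cannot be a^2.  So elements outside D have annihilator
    inside D, while those of D are annihilated by D: most case distinctions below
    are between these two kinds. *)
Lemma annih_sqzero a y : ~ sqzero a -> a * y = 0 -> sqzero y.
Proof.
move=> na ay; case: (gaussian_square a y) => -[r [s [_ E]]].
  exact: gaussian_orthogonal ay E.
by case: na; apply: gaussian_orthogonal E; rewrite mulrC.
Qed.

Lemma sqzero_split a d : ~ sqzero a -> sqzero d ->
  exists r d', [/\ d = r * a + d', a * d' = 0 & sqzero d'].
Proof.
move=> na Dd; case: (gaussian_split a d) => // -[r [a' [E _ Da']]].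
case: na; have [_ DD DM] := ideal_sqzero; rewrite E; apply: DD => //; exact: DM.
Qed.

(** R / D is a chain ring, so this preorder is total, which divisibility in R is
    not in general. *)
Definition dvdD a r : Prop := exists u, sqzero (r - a * u).

Lemma sqzeroD x y : sqzero x -> sqzero y -> sqzero (x + y).
Proof. by have [_ DD _] := ideal_sqzero; exact: DD. Qed.
Lemma sqzeroM a x : sqzero x -> sqzero (a * x).
Proof. by have [_ _ DM] := ideal_sqzero; exact: DM. Qed.
Lemma sqzeroMr a x : sqzero x -> sqzero (x * a).
Proof. by rewrite mulrC; exact: sqzeroM. Qed.
Lemma sqzeroN x : sqzero x -> sqzero (- x).
Proof. by rewrite -mulN1r; exact: sqzeroM. Qed.
Lemma sqzeroB x y : sqzero x -> sqzero y -> sqzero (x - y).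
Proof. by move=> Dx Dy; apply: sqzeroD => //; exact: sqzeroN. Qed.
Lemma sqzero0 : sqzero 0. Proof. by rewrite /sqzero mulr0. Qed.

Lemma dvdD_refl a : dvdD a a.
Proof. by exists 1; rewrite mulr1 subrr; exact: sqzero0. Qed.
Lemma dvdDl a u : dvdD a (a * u).
Proof. by exists u; rewrite subrr; exact: sqzero0. Qed.
Lemma dvdDr a u : dvdD a (u * a). Proof. by rewrite mulrC; exact: dvdDl. Qed.
Lemma dvdDD a d : sqzero d -> dvdD a d.
Proof. by move=> Dd; exists 0; rewrite mulr0 subr0. Qed.

Lemma ideal_dvdD a : is_ideal (dvdD a).
Proof.
split=> [|x y [u Du] [v Dv]|b x [u Du]]; first exact: dvdDD sqzero0.
  exists (u + v); have -> : x + y - a * (u + v) = (x - a * u) + (y - a * v) by ring.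
  exact: sqzeroD.
exists (b * u); have -> : b * x - a * (b * u) = b * (x - a * u) by ring.
exact: sqzeroM.
Qed.

Lemma dvdD_total a b : dvdD a b \/ dvdD b a.
Proof.
case: (gaussian_split a b) => -[r [x [-> _ Dx]]]; [left|right];
  by exists r; rewrite mulrC addrC addKr.
Qed.

Lemma dvdD_trans a b c : dvdD a b -> dvdD b c -> dvdD a c.
Proof.
move=> [u Du] [v Dv]; exists (u * v).
have -> : c - a * (u * v) = (c - b * v) + v * (b - a * u) by ring.
by apply: sqzeroD => //; exact: sqzeroM.
Qed.

Lemma dvdD_mulsq a r d : dvdD a r -> sqzero d -> a * d = 0 -> r * d = 0.
Proof.
move=> [u Du] Dd ad; have -> : r = (r - a * u) + a * u by rewrite subrK.
by rewrite mulrDl (sqzero_mul Du Dd) mulrAC ad mul0r addr0.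
Qed.

Lemma dvdD_invertible a r : invertible a -> dvdD a r.
Proof. by case=> b ab; exists (b * r); rewrite mulrA ab mul1r subrr; exact: sqzero0. Qed.

(** This and [colon_dvdD] turn an element y which fails to kill a into the
    statement that everything killed by y lies in a R + D; the y that occur
    annihilate an obstruction, whose coefficients they thereby control. *)
Lemma annih_dvdD a y r : sqzero y -> a * y <> 0 -> y * r = 0 -> dvdD a r.
Proof.
move=> Dy ay yr; case: (dvdD_total a r) => // ra; case: ay.
by apply: dvdD_mulsq ra Dy _; rewrite mulrC.
Qed.

Lemma colon_dvdD a y r : ~ sqzero (a * y) -> sqzero (y * r) -> dvdD a r.
Proof.
move=> ay yr; case: (dvdD_total a r) => // -[u Du]; case: ay.
have -> : a * y = y * (a - r * u) + u * (y * r) by ring.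
by apply: sqzeroD; exact: sqzeroM.
Qed.

Lemma dvdD_max (T : finType) (r : T -> R) (t : T) :
  exists t0, forall t, dvdD (r t0) (r t).
Proof. by apply: total_minimum t _ _; [exact: dvdD_total|exact: dvdD_trans]. Qed.

End LocalGaussian.

(** * The syzygy obstruction over a local ring *)

Section ComplexOverLocal.
Local Open Scope ring_scope.
Variables (R : comPzRingType) (gR : degree_one_gaussian R) (lR : is_local R).
Variables (F2 F1 F0 : lmodType R) (f2 : {linear F2 -> F1}) (f1 : {linear F1 -> F0}).
Local Notation D := (@sqzero R).
Local Notation P := (fun a : R => ~ invertible a).
Local Notation T2 := (fun _ : F2 => True).
Local Notation T1 := (fun _ : F1 => True).
Local Notation K2 := (fun x : F2 => f2 x = 0).
Hypotheses (flat2 : eqflat T2) (flat1 : eqflat T1)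
  (flat0 : eqflat (fun _ : F0 => True)) (flatK : eqflat K2).
Hypothesis exact1 : forall y, f1 y = 0 <-> exists x, f2 x = y.

Let subK : is_submod K2 := submod_ker f2.
Let idD : is_ideal D := ideal_sqzero gR lR.
Let not_sqzero1 : ~ D 1.
Proof. by rewrite /sqzero mulr1; exact: (proj1 lR). Qed.

(** If some x in D has annihilator inside D, then x h = 0 and flatness of K2
    conclude.  Otherwise every element of D is killed by some element outside D,
    the finitely many coefficients of h have a common such annihilator a because
    R / D is a chain ring, and the annihilator of a is inside D. *)
Lemma span_sqzero_ker h : K2 h -> span D T2 h -> span D K2 h.
Proof.
move=> Kh Sh.
have [[x [Dx xP]]|H] := EM (exists x, D x /\ forall y, x * y = 0 -> D y).
  have xh : x *: h = 0 by apply: span_annih Sh => r Dr; exact: sqzero_mul.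
  by apply: span_mono (eqflat_annih flatK Kh xh).
have [a [Da ah]] : exists a, ~ D a /\ a *: h = 0.
  elim: h / Sh {Kh} => [|r w z Dr _ Sz [a [Da az]]]; first by exists 1; rewrite scaler0.
  have [b [Db rb]] : exists b, ~ D b /\ b * r = 0.
    apply: contrapT => N; apply: H; exists r; split=> // y ry.
    by apply: contrapT => Dy; apply: N; exists y; rewrite mulrC.
  case: (dvdD_total gR lR a b) => [[u Du]|ba].
    exists b; split=> //; rewrite scalerDr scalerA rb scale0r add0r.
    have -> : b = (b - a * u) + u * a by ring.
    rewrite scalerDl -scalerA az scaler0 addr0.
    by apply: span_annih Sz => s Ds; exact: sqzero_mul.
  exists a; split=> //.
  by rewrite scalerDr scalerA az addr0 (dvdD_mulsq gR lR ba Dr rb) scale0r.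
by apply: span_mono (eqflat_annih flatK Kh ah) => // r; exact: annih_sqzero.
Qed.

Lemma span_annih_ker y h : K2 h ->
  span (fun r => y * r = 0) T2 h -> span (fun r => y * r = 0) K2 h.
Proof. by move=> Kh Sh; apply: eqflat_annih => //; exact: span_annih Sh. Qed.

Lemma eqflat_sqcolon (M : lmodType R) (K : M -> Prop) a x : eqflat K -> K x ->
  span D K (a *: x) -> span (fun r => D (a * r)) K x.
Proof. by move=> fK; apply: eqflat_colon => //; exact: eqflat_modW. Qed.

Lemma span_sqcolon_ker y h : K2 h ->
  span (fun r => D (y * r)) T2 h -> span (fun r => D (y * r)) K2 h.
Proof.
move=> Kh Sh; apply: eqflat_sqcolon => //.
apply: span_sqzero_ker; first by rewrite linearZ /= Kh scaler0.
by apply: span_scale Sh.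
Qed.

Lemma span_dvdD_decomp (M : lmodType R) (K : M -> Prop) a x : is_submod K ->
  span (dvdD a) K x -> exists g d, [/\ K g, span D K d & x = a *: g + d].
Proof.
move=> [K0 KD KZ]; elim=> [|r w z [u Du] Kw _ [g [d [Kg Sd ->]]]].
  by exists 0, 0; split; [|exact: span0|rewrite scaler0 addr0].
exists (u *: w + g), ((r - a * u) *: w + d); split.
- by apply: KD => //; exact: KZ.
- exact: spanS.
- by rewrite scalerDr scalerA scalerBl [RHS]addrACA [X in _ = X + _]addrC subrK.
Qed.

Lemma span_dvdD_comp (M : lmodType R) (K : M -> Prop) a g d : K g -> span D K d ->
  span (dvdD a) K (a *: g + d).
Proof.
move=> Kg Sd; apply: spanS => //; first by exact: dvdD_refl.
by apply: span_mono Sd => // r; exact: dvdDD.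
Qed.

(** Elimination in the style of Nakayama.  Trivialising y g = sum y_t h_t in F2
    expresses g through coefficients that, if one of them is a unit, make y a
    combination of the y_t; since y is not in P X some coefficient of that
    combination is a unit, and replacing g by g - b h_t with h_t in K2 removes
    the term t. *)
Lemma unspanned_coefficient (X : R -> Prop) (y : R) (g : F2) : X y ->
  ~ span P (X : R^o -> Prop) (y : R^o) ->
  span X K2 (y *: g) -> exists g' k, [/\ span P T2 g', K2 k & g = g' + k].
Proof.
move=> Xy nSy /spanP [T [yy [hh [Xyy Khh E]]]].
have {E} : y *: g = \sum_(t in [set: T]%SET) yy t *: hh t.
  by rewrite E; apply: eq_bigl => t; rewrite finset.in_setT.
(* The induction is on the number of terms that remain in the relation. *)
have [n] := ubnP #|[set: T]%SET|; move: [set: T]%SET => A.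
elim: n A g hh Khh => // n IH A g hh Khh /ltnSE cA E.
pose a o := if o is Some t then if t \in A then - yy t else 0 else y.
have [//||J [v [w [_ wE vE]]]] :=
    eqflat_trivialise (a := a) (x := oapp hh g) flat2.
  rewrite (bigD1 None) //= E (reindex_omap Some id) /=; last by case.
  rewrite [X in _ + X](eq_bigl (fun _ => true)) => [|t]; last by rewrite eqxx.
  rewrite [X in X + _]big_mkcond -big_split big1 //= => t _.
  by case: ifP; rewrite ?scaleNr ?subrr ?scale0r ?addr0.
have vNE j : y * v None j = \sum_(t in A) yy t * v (Some t) j.
  have := vE j; rewrite (bigD1 None) //= (reindex_omap Some id) /=; last by case.
  rewrite [X in _ + X](eq_bigl (fun _ => true)) => [|t]; last by rewrite eqxx.
  move/eqP; rewrite addr_eq0 => /eqP->; rewrite -sumrN [RHS]big_mkcond /=.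
  by apply: eq_bigr => t _; case: ifP; rewrite ?mulNr ?opprK ?mul0r ?oppr0.
have [Pv|/existsNP [j /contrapT [c vc]]] := EM (forall j, P (v None j)).
  exists g, 0; split; [|exact: linear0|by rewrite addr0].
  by have /= -> := wE None; apply: span_sum => j; exact: span_gen.
(* v None j is the unit with inverse c, so y is a combination of the y_t. *)
pose al t := v (Some t) j * c.
have yE : y = \sum_(t in A) yy t * al t.
  rewrite -[LHS]mulr1 -vc mulrA vNE mulr_suml.
  by apply: eq_bigr => t _; rewrite mulrA.
have [Pal|/existsNP [t /not_implyP [tA /contrapT [b alb]]]] :=
    EM (forall t, t \in A -> P (al t)).
  case: nSy; rewrite yE; elim/big_ind: _; [exact: span0|exact: (@spanD R R^o)|].
  by move=> t tA; rewrite mulrC; apply: (@span_gen R R^o); [exact: Pal|].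
have [|||g' [k [Sg' Kk gE]]] := IH (A :\ t)%SET (g - b *: hh t)
    (fun s => hh s - (b * al s) *: hh t).
- by move=> s; apply: (submodB subK) => //=; rewrite linearZ /= Khh scaler0.
- by apply: leq_trans cA; rewrite [in leqRHS](cardsD1 t) tA.
- rewrite scalerBr E (bigD1 t) //= scalerA.
  have -> : y * b = yy t + \sum_(s in (A :\ t)%SET) yy s * (b * al s).
    rewrite yE (bigD1 t) //= mulrDl -mulrA alb mulr1; congr (_ + _).
    rewrite mulr_suml; apply: eq_big => [s|s _]; first by rewrite !inE andbC.
    by rewrite -mulrA [al s * b]mulrC.
  rewrite scalerDl opprD addrACA subrr add0r scaler_suml -sumrN.
  rewrite [X in X + _](eq_bigl (mem (A :\ t)%SET)) => [|s]; last by rewrite !inE andbC.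
  rewrite -big_split /=; apply: eq_bigr => s _.
  by rewrite scalerBr scalerA.
exists g', (k + b *: hh t); split=> //.
  by have [_ KD KZ] := subK; apply: KD => //; exact: KZ.
by rewrite addrA -gE subrK.
Qed.

(** The set A bounds the unknowns still present in the elimination below. *)
Definition solution (I J : finType) (A : {set I}) (r : I -> J -> R) (y : I -> R) : Prop :=
  [/\ forall i, D (y i), forall i, i \notin A -> y i = 0 &
      forall j, \sum_i y i * r i j = 0].

Definition spike (I : finType) (i0 : I) (z : R) : I -> R :=
  fun i => if i == i0 then z else 0.

Lemma sum_spike (I : finType) i0 z (r : I -> R) : \sum_i spike i0 z i * r i = z * r i0.
Proof.
rewrite (bigD1 i0) //= /spike eqxx big1 ?addr0 // => i /negPf->.
by rewrite mul0r.
Qed.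

(** One step of Gaussian elimination on a system r whose equations determine the
    unknown i0 up to the annihilator of the pivot rho: z y = sum y_i q_i records
    the pivot equation, which reads rho (z y) = 0, and r' is the remaining system
    in the other unknowns.  A solution is a spike at i0 plus the canonical lift of
    a solution of r', and both summands are handled separately. *)
Lemma span_solution_step (I J : finType) (A : {set I}) (r r' : I -> J -> R)
    (i0 : I) (rho : R) (q : I -> R) (x : I -> R) :
  let z y := \sum_i y i * q i in
  let S B s y := solution B s y in
  (forall d, D d -> rho * d = 0 ->
     span P ((fun y => D y /\ rho * y = 0) : R^o -> Prop) (d : R^o)) ->
  q i0 = 1 -> i0 \in A ->
  (forall y, S A r y -> rho * z y = 0) ->
  (forall y, S A r y -> S (A :\ i0)%SET r' (fun i => if i == i0 then 0 else y i)) ->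
  (forall d, D d -> rho * d = 0 -> S A r (spike i0 d)) ->
  (forall y, S (A :\ i0)%SET r' y -> S A r (fun i => y i - spike i0 (z y) i)) ->
  (S (A :\ i0)%SET r' (fun i => if i == i0 then 0 else x i) ->
     span P (S (A :\ i0)%SET r' : (I -> R^o) -> Prop)
       ((fun i => if i == i0 then 0 else x i) : I -> R^o)) ->
  S A r x -> span P (S A r : (I -> R^o) -> Prop) (x : I -> R^o).
Proof.
move=> z S Hrho q1 i0A rz Sr' Sspike Sback IH Sx.
pose x' i := if i == i0 then 0 else x i.
have Dz : D (z x).
  by apply: ideal_sum => //; have [] := Sx.
have -> : (x : I -> R^o) = (spike i0 (z x) : I -> R^o) + (fun i => x' i - spike i0 (z x') i).
  apply/funext => i; rewrite fctE /x' /spike; case: eqP => [->|_]; last by rewrite add0r subr0.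
  rewrite sub0r /z (bigD1 i0) //= q1 mulr1 [X in _ - X](bigD1 i0) //= eqxx mul0r add0r.
  rewrite [X in _ = _ - X](eq_bigr (fun i => x i * q i)) => [|k /negPf-> //].
  by rewrite addrK.
apply: spanD.
  have := Hrho _ Dz (rz _ Sx); apply: (@span_map R R^o (I -> R^o) (spike i0)).
    move=> a u v; apply/funext => k; rewrite !fctE /spike; case: eqP => // _.
    by rewrite scaler0 addr0.
  by move=> w [Dw rw]; exact: Sspike.
have := IH (Sr' _ Sx); apply: (@span_map R (I -> R^o) (I -> R^o)
  (fun y i => y i - spike i0 (z y) i)); last exact: Sback.
move=> a u v; apply/funext => k; rewrite !fctE /spike.
have -> : z (a *: u + v) = a * z u + z v.
  rewrite /z mulr_sumr -big_split; apply: eq_bigr => i _ /=.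
  by rewrite !fctE mulrDl mulrA.
rewrite /GRing.scale /=; case: eqP => _; last by rewrite !subr0.
by ring.
Qed.


(** The unknowns lie in D and D^2 = 0, so only the classes of the coefficients
    modulo D matter; there the ring is a chain ring, and a coefficient dividing
    all the others serves as pivot. *)
Lemma span_solution (I J : finType) (A : {set I}) (r : I -> J -> R) (x : I -> R) :
  (forall rho d, D d -> rho * d = 0 ->
     span P ((fun y => D y /\ rho * y = 0) : R^o -> Prop) (d : R^o)) ->
  solution A r x -> span P (solution A r : (I -> R^o) -> Prop) (x : I -> R^o).
Proof.
move=> H; have [n] := ubnP #|A|; elim: n A r x => // n IH A r x /ltnSE cA Sx.
have [A0|[i0 i0A]] := set_0Vmem A.
  have -> : x = 0 :> (I -> R^o).
    by apply/funext => i; case: Sx => _ + _; apply; rewrite A0 finset.in_set0.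
  exact: span0.
have cA' i : i \in A -> (#|(A :\ i)%SET| < n)%N.
  by move=> iA; apply: leq_trans cA; rewrite [in leqRHS](cardsD1 i) iA.
pose hit i (y : I -> R) k := if k == i then 0 else y k : R.
have hitD i (y : I -> R) : (forall k, D (y k)) -> forall k, D (hit i y k).
  by move=> Dy k; rewrite /hit; case: ifP => // _; exact: sqzero0.
have hitA i (y : I -> R) : (forall k, k \notin A -> y k = 0) ->
    forall k, k \notin (A :\ i)%SET -> hit i y k = 0.
  move=> y0 k; rewrite /hit !inE negb_and negbK.
  by case: eqP => //= _; exact: y0.
have spikeD i d : D d -> forall k, D (spike i d k).
  by move=> Dd k; rewrite /spike; case: ifP => // _; exact: sqzero0.
have spikeA i d k : i \in A -> k \notin A -> spike i d k = 0.
  by move=> iA; rewrite /spike; case: eqP => [->|//]; rewrite iA.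
(* When all the coefficients are in D every equation holds automatically, and
   any unknown can be eliminated with pivot 0. *)
have [allD|nallD] := EM (forall i j, i \in A -> D (r i j)).
  have sum0 (y : I -> R) j : (forall k, D (y k)) -> (forall k, k \notin A -> y k = 0) ->
      \sum_k y k * r k j = 0.
    move=> Dy y0; apply: big1 => k _.
    have [kA|kA] := boolP (k \in A); last by rewrite y0 // mul0r.
    by apply: sqzero_mul => //; exact: allD.
  have hitS y k : (forall k, k \notin A -> y k = 0) -> k \notin A -> hit i0 y k = 0.
    by move=> y0 kA; rewrite /hit; case: eqP => // _; exact: y0.
  apply: (@span_solution_step I J A r r i0 0 (fun i => (i == i0)%:R)) => //.
  - exact: H.
  - by rewrite eqxx.
  - by move=> y _; rewrite mul0r.
  - move=> y [Dy y0 _]; split; [exact: hitD|exact: hitA|move=> j].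
    by apply: sum0; [exact: hitD|move=> k kA; exact: hitS].
  - move=> d Dd _; split; [exact: spikeD|by move=> k; exact: spikeA|move=> j].
    by rewrite sum_spike; apply: sqzero_mul => //; exact: allD.
  - move=> y [Dy y0 Ey]; have y1 k : k \notin A -> y k = 0.
      by move=> kA; apply: y0; rewrite !inE (negPf kA) andbF.
    have z0 : \sum_i y i * (i == i0)%:R = 0.
      apply: big1 => i _; case: eqP => [->|_]; last by rewrite mulr0.
      by rewrite y0 ?mul0r // !inE eqxx.
    rewrite z0; have yE : (fun i => y i - spike i0 0 i) = y.
      by apply/funext => i; rewrite /spike if_same subr0.
    by rewrite yE; split.
  - by move=> S'; apply: IH => //; exact: cA'.
have [[i1 j1] [i1A pivot]] : exists p, p.1 \in A /\
    forall i j, i \in A -> dvdD (r p.1 p.2) (r i j).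
  have /existsNP [i /existsNP [j /not_implyP [iA nD]]] := nallD.
  have [[i1 j1] H1] := dvdD_max gR lR
    (fun p : I * J => if p.1 \in A then r p.1 p.2 else 0) (i, j).
  have i1A : i1 \in A.
    apply: contrapT => /negP/negPf i1A; apply: nD; have := H1 (i, j).
    by rewrite /= iA i1A => -[u]; rewrite mul0r subr0.
  exists (i1, j1); split=> // i' j' i'A; have := H1 (i', j').
  by rewrite /= i1A i'A.
have /choice [q qP] : forall p, exists u, p.1 \in A -> D (r p.1 p.2 - r i1 j1 * u).
  move=> [i j]; have [iA|niA] := EM (i \in A); last by exists 0 => /niA.
  by have [u Du] := pivot i j iA; exists u.
move=> {pivot i0 i0A nallD}.
(* Up to elements of D, r i j = rho q (i, j): the pivot equation is j1, and it is
   subtracted q (i1, j) times from the equation j. *)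
pose rho := r i1 j1; pose q' i := if i == i1 then 1 else q (i, j1).
have q'P i : i \in A -> D (r i j1 - rho * q' i).
  rewrite /q' => iA; case: eqP => [->|_]; last exact: (qP (i, j1)).
  by rewrite mulr1 subrr; exact: sqzero0.
have DE d a b : D d -> D (a - b) -> d * a = d * b.
  by move=> Dd Dab; apply/eqP; rewrite -subr_eq0 -mulrBr sqzero_mul.
pose r' i j := r i j - r i j1 * q (i1, j).
have sumq y : (forall k, D (y k)) -> (forall k, k \notin A -> y k = 0) ->
    \sum_k y k * r k j1 = rho * \sum_k y k * q' k.
  move=> Dy y0; rewrite mulr_sumr; apply: eq_bigr => k _.
  have [kA|kA] := boolP (k \in A); last by rewrite y0 // !mul0r mulr0.
  by rewrite (DE _ _ _ (Dy k) (q'P k kA)); ring.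
have sumr' (y : I -> R) j : \sum_k y k * r' k j =
    \sum_k y k * r k j - (\sum_k y k * r k j1) * q (i1, j).
  by rewrite mulr_suml -sumrB; apply: eq_bigr => k _; rewrite /r'; ring.
apply: (@span_solution_step I J A r r' i1 rho q') => //.
- exact: H.
- by rewrite /q' eqxx.
- by move=> y [Dy y0 Ey]; rewrite -sumq.
- move=> y [Dy y0 Ey]; split; [exact: hitD|exact: hitA|move=> j].
  have : \sum_k y k * r' k j = 0 by rewrite sumr' !Ey mul0r subr0.
  rewrite (bigD1 i1) //= (DE _ _ 0 (Dy i1)) ?mulr0 ?add0r; last first.
    by rewrite subr0; exact: (qP (i1, j) i1A).
  move=> E; rewrite -[RHS]E (bigD1 i1) //= eqxx mul0r add0r.
  by apply: eq_bigr => k /negPf ->.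
- move=> d Dd rd; split; [exact: spikeD|by move=> k; exact: spikeA|move=> j].
  by rewrite sum_spike (DE _ _ _ Dd (qP (i1, j) i1A)) mulrA [d * _]mulrC rd mul0r.
- move=> y [Dy y0 Ey]; have y1 k : k \notin A -> y k = 0.
    by move=> kA; apply: y0; rewrite !inE (negPf kA) andbF.
  have Dz : D (\sum_i y i * q' i) by exact: ideal_sum.
  split=> [k|k kA|j].
  + by apply: sqzeroB => //; exact: spikeD.
  + by rewrite y1 // spikeA // subr0.
  + under eq_bigr do rewrite mulrBl; rewrite sumrB sum_spike.
    rewrite (DE _ _ _ Dz (qP (i1, j) i1A)) mulrA [_ * r i1 j1]mulrC -sumq //.
    by rewrite -sumr'; exact: Ey.
- by move=> S'; apply: IH => //; exact: cA'.
Qed.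

(** Write f2 g = sum x_i w_i with x_i in D.  Trivialising the relation
    sum x_i f1(w_i) = 0 in F0 gives a linear system solved by x, any solution of
    which gives an element of ker f1 = im f2.  If all the ideals
    X = D cap (0 : rho) satisfy X = P X, then x is a P-combination of solutions,
    so f2 g is the image of an element of P F2.  If X differs from P X for some
    rho, pick y in X outside P X: then y g is in X K2 by flatness of K2, and
    [unspanned_coefficient] applies. *)
Lemma kernel_in_max g : span D T1 (f2 g) ->
  exists g' k, [/\ span P T2 g', K2 k & g = g' + k].
Proof.
move=> Sg.
have [H|/existsNP [rho /existsNP [y /not_implyP [Dy /not_implyP [ry nS]]]]] :=
  EM (forall rho d, D d -> rho * d = 0 ->
     span P ((fun y => D y /\ rho * y = 0) : R^o -> Prop) (d : R^o)).
  have /spanP [I [x [w [Dx _ E]]]] := Sg.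
  have [||J [v [u [_ wE vE]]]] := eqflat_trivialise (a := x) (x := fun i => f1 (w i)) flat0.
  - by [].
  - have /exact1 := ex_intro (fun x => f2 x = f2 g) g erefl.
    by rewrite E linear_sum /= => {2}<-; apply: eq_bigr => i _; rewrite linearZ.
  have Sx : solution [set: I]%SET v x by split=> // i; rewrite finset.in_setT.
  have : span P (fun y => exists g, f2 g = y) (f2 g).
    rewrite E.
    have := span_solution H Sx.
    apply: (@span_map R (I -> R^o) F1 (fun y => \sum_i (y i : R) *: w i)).
      move=> a y1 y2; rewrite scaler_sumr -big_split; apply: eq_bigr => i _ /=.
      by rewrite !fctE scalerDl scalerA.
    move=> y [_ _ yv]; apply/exact1; rewrite linear_sum.
    under eq_bigr do rewrite linearZ /= wE.
    by rewrite sum_scale_exchange big1 // => j _; rewrite yv scale0r.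
  have SP z : span P (fun y => exists g, f2 g = y) z -> exists g', span P T2 g' /\ f2 g' = z.
    elim=> [|r _ y Pr [g1 <-] _ [g' [Sg' <-]]].
      by exists 0; split; [exact: span0|exact: linear0].
    by exists (r *: g1 + g'); split; [exact: spanS|exact: linearP].
  move=> /SP [g' [Sg' g'E]]; exists g', (g - g'); split=> //.
    by rewrite linearB g'E subrr.
  by rewrite addrC subrK.
apply: unspanned_coefficient nS _ => //.
have Kyg : K2 (y *: g).
  by rewrite linearZ /=; apply: span_annih Sg => r Dr; exact: sqzero_mul.
have Syg : span (fun y => D y /\ rho * y = 0) T2 (y *: g) by exact: span_gen.
have [Drho|nDrho] := EM (D rho).
  apply: (@span_mono _ _ D _ K2) => //; first by move=> r Dr; split=> //; exact: sqzero_mul.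
  by apply: span_sqzero_ker => //; apply: span_mono Syg => // r [].
have : span (fun r => rho * r = 0) K2 (y *: g).
  by apply: span_annih_ker => //; apply: span_mono Syg => // r [].
by apply: span_mono => // r rr; split=> //; exact: annih_sqzero rr.
Qed.


(** As R / D is a chain ring, finitely many coefficients in P have, modulo D, a
    common divisor p in P, which can moreover be made to divide a. *)
Lemma span_max_decomp a x : P a -> span P T2 x ->
  exists p g d, [/\ P p, dvdD p a, span D T2 d & x = p *: g + d].
Proof.
move=> Pa; elim=> [|r w z Pr _ _ [p [g [d [Pp pa Sd ->]]]]].
  exists a, 0, 0; split=> //; [|exact: span0|by rewrite scaler0 addr0].
  by exact: dvdD_refl.
have [[u Du]|rp] := dvdD_total gR lR p r.
  exists p, (u *: w + g), ((r - p * u) *: w + d); split=> //; first exact: spanS.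
  by rewrite scalerDr scalerA scalerBl [RHS]addrACA [X in _ = X + _]addrC subrK.
have pa' := dvdD_trans gR lR rp pa; have [u Du] := rp.
exists r, (w + u *: g), ((p - r * u) *: g + d); split=> //; first exact: spanS.
by rewrite scalerDr scalerA scalerBl -addrA; congr (_ + _); rewrite addrA [X in _ = X + _]addrC subrK.
Qed.

Lemma span_sqzero_split a d : ~ D a -> span D T2 d ->
  exists e d', span (fun r => D r /\ a * r = 0) T2 d' /\ d = a *: e + d'.
Proof.
move=> nDa; elim=> [|r w z Dr _ _ [e [d' [Sd' ->]]]].
  by exists 0, 0; split; [exact: span0|rewrite scaler0 addr0].
have [u [r' [-> ar' Dr']]] := sqzero_split gR lR nDa Dr.
exists (u *: w + e), (r' *: w + d'); split; first exact: spanS.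
by rewrite scalerDl scalerDr scalerA [u * a]mulrC addrACA.
Qed.

(** For h in K2 cap (a R + D) F2, [good a h] means that the obstruction
    represented by h, its class modulo (a R + D) K2, is zero. *)
Local Notation good a h := (span (dvdD a) K2 h).

Let ideal_dvd a : is_ideal (dvdD a) := ideal_dvdD gR lR a.

Lemma good_scale a r h : good a h -> good a (r *: h).
Proof. exact: spanZ. Qed.

(** An obstruction modulo a is represented deeper, by an element of
    (a p R + D) F2: writing h = a g + d', one has a^2 f2(g) = 0, so f2 g is in
    D F1 because a^2 is outside D, [kernel_in_max] moves g into P F2 modulo K2,
    and changing g by k in K2 changes h by a k, which is not an obstruction. *)
Lemma deepen a h : P a -> ~ D (a * a) -> K2 h -> span (dvdD a) T2 h ->
  exists p h', [/\ P p, dvdD p a, K2 h', exists2 k, K2 k & h = h' + a *: k &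
                   span (dvdD (a * p)) T2 h'].
Proof.
move=> Pa nDaa Kh /span_dvdD_decomp [//|g [d [_ Sd hE]]].
have nDa : ~ D a by move=> Da; apply: nDaa; exact: sqzeroM.
have [e [d' [Sd' dE]]] := span_sqzero_split nDa Sd.
have {}hE : h = a *: (g + e) + d' by rewrite hE dE scalerDr addrA.
have ad' : a *: d' = 0 by apply: span_annih Sd' => r [].
have {}Sd' : span D T2 d' by apply: span_mono Sd' => // r [].
have /kernel_in_max [g' [k [/(span_max_decomp Pa) [p [g'' [d'' [Pp pa Sd'' g'E]]]] Kk geE]]] :
    span D T1 (f2 (g + e)).
  have aaf : (a * a) *: f2 (g + e) = 0.
    have /eqP : f2 h = 0 := Kh.
    rewrite {1}hE linearD linearZ /= addr_eq0 -scalerA => /eqP->.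
    by rewrite -linearN -linearZ scalerN ad' oppr0 linear0.
  by apply: span_mono (eqflat_annih flat1 _ aaf) => // r; exact: annih_sqzero.
exists p, (h - a *: k); split=> //.
- by rewrite linearB linearZ /= Kh Kk scaler0 subr0.
- by exists k; rewrite ?subrK.
- have -> : h - a *: k = (a * p) *: g'' + (a *: d'' + d').
    by rewrite hE geE g'E !scalerDr scalerA addrAC addrK addrA.
  by apply: span_dvdD_comp => //; apply: spanD => //; exact: spanZ.
Qed.

(** Cancellation: h and a h' agree modulo D K, so a divisor a q of h gives the
    divisor q of h'. *)
Lemma span_dvdD_divide (M : lmodType R) (K : M -> Prop) a q (h h' : M) :
  eqflat K -> is_submod K -> K h' -> span D K (h - a *: h') ->
  ~ D (a * q) -> span (dvdD (a * q)) K h -> span (dvdD q) K h'.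
Proof.
move=> fK sK Kh' Shh nD /span_dvdD_decomp [//|g [d [Kg Sd hE]]].
have KB : K (h' - q *: g) by apply: (submodB sK) => //; have [_ _ KZ] := sK; exact: KZ.
have -> : h' = q *: g + (h' - q *: g) by rewrite addrC subrK.
apply: spanD; first by apply: span_gen => //; exact: dvdD_refl.
have : span (fun r => D (a * r)) K (h' - q *: g).
  apply: eqflat_sqcolon => //.
  have -> : a *: (h' - q *: g) = d - (h - a *: h').
    by rewrite hE scalerBr scalerA opprB addrCA opprD [d + _]addrCA subrr addr0.
  exact: spanB.
by apply: span_mono => // r; apply: colon_dvdD => //; rewrite mulrC.
Qed.

(** If p divides a and p h is not an obstruction modulo a, then the obstruction
    h modulo a comes, through multiplication by a / p, from an obstruction h'
    modulo p.  The last two properties say that h' inherits depth and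
    annihilators from h. *)
Lemma descend a p h : dvdD p a -> ~ D a -> K2 h -> good a (p *: h) ->
  exists h', [/\ K2 h', good p h' -> good a h,
    forall q, ~ D (a * q) -> span (dvdD (a * q)) T2 h -> span (dvdD (p * q)) T2 h' &
    forall r, good a (r *: h) -> good p (r *: h')].
Proof.
move=> [c Dc] nDa Kh.
have nDc : ~ D (c * p).
  move=> Dcp; apply: nDa; have -> : a = (a - p * c) + c * p by ring.
  exact: sqzeroD.
move=> /span_dvdD_decomp [//|k [d [Kk Sd phE]]].
have KB : K2 (h - c *: k) by rewrite linearB linearZ /= Kh Kk scaler0 subrr.
have : span (fun r => D (p * r)) K2 (h - c *: k).
  apply: eqflat_sqcolon => //.
  have -> : p *: (h - c *: k) = (a - p * c) *: k + d.
    by rewrite scalerBr phE scalerA scalerBl addrAC.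
  by apply: spanD => //; exact: span_gen.
have dP r : D (p * r) -> dvdD c r by exact: colon_dvdD.
move=> /(span_mono dP (fun w Kw => Kw)) /span_dvdD_decomp [//|k' [d' [Kk' Sd' hE]]].
pose h' := k + k'.
have Kh' : K2 h' by rewrite linearD Kk Kk' addr0.
have hh' : h - c *: h' = d' by rewrite scalerDr opprD addrA hE addrAC subrr add0r.
have dvdE q r : dvdD (a * q) r -> dvdD (c * (p * q)) r.
  apply: dvdD_trans => //; exists 1.
  have -> : a * q - c * (p * q) * 1 = q * (a - p * c) by ring.
  exact: sqzeroM.
have nDE q : ~ D (a * q) -> ~ D (c * (p * q)).
  move=> nD Dq; apply: nD; have -> : a * q = q * (a - p * c) + c * (p * q) by ring.
  by apply: sqzeroD => //; exact: sqzeroM.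
exists h'; split=> //.
- move=> /span_dvdD_decomp [//|y [e [Ky Se h'E]]].
  have -> : h = a *: y + ((- (a - p * c)) *: y + (c *: e + d')).
    rewrite -hh' h'E scalerDr scalerA [c *: e + _]addrCA
      [- (_ + c *: e)]opprD [c *: e + _]addrCA.
    rewrite subrr addr0 scaleNr scalerBl opprB [p * c]mulrC addrA.
    by rewrite [a *: y + _]addrC subrK addrC subrK.
  apply: span_dvdD_comp => //; apply: spanD; last by apply: spanD => //; exact: spanZ.
  by apply: span_gen => //; exact: sqzeroN.
- move=> q nD Sh; apply: (@span_dvdD_divide _ _ c (p * q) h) => //.
  + by rewrite hh'; apply: span_mono Sd'.
  + exact: nDE.
  + by apply: span_mono Sh => // r; exact: dvdE.
- move=> r Sh; apply: (@span_dvdD_divide _ _ c p (r *: h)) => //.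
  + by rewrite linearZ /= Kh' scaler0.
  + by rewrite scalerA mulrC -scalerA -scalerBr hh'; exact: spanZ.
  + by apply: span_mono Sh => // s; have := @dvdE 1 s; rewrite !mulr1.
Qed.

(** If p^2 y = 0 and p y <> 0 for some y in D, then y kills h and the annihilator
    of y is inside p R + D.  Otherwise p and p^2 have the same annihilator in D:
    writing h = p^2 g' + s with p s = 0, both p g' and s lie in K2, and h is
    p (p g') plus an element of D K2. *)
Lemma good_of_square p h : ~ D (p * (p * p)) -> K2 h -> span (dvdD (p * p)) T2 h -> good p h.
Proof.
move=> nDp3 Kh Sh; apply: contrapT => bad.
have nDpp : ~ D (p * p) by move=> Dpp; apply: nDp3; exact: sqzeroM.
have tors2 y : D y -> p * (p * y) = 0 -> p * y = 0.
  move=> Dy ppy; apply: contrapT => py; apply: bad.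
  have : span (fun r => y * r = 0) K2 h.
    apply: span_annih_ker => //; apply: span_mono Sh => // r [u Du].
    have -> : y * r = y * (r - p * p * u) + u * (p * (p * y)) by ring.
    by rewrite ppy mulr0 addr0 sqzero_mul.
  by apply: span_mono => // r; exact: annih_dvdD.
have [//|g [d [_ Sd hE]]] := span_dvdD_decomp _ Sh.
have [e [s [Ss dE]]] := span_sqzero_split nDpp Sd.
have {}Ss : span (fun r => p * r = 0) T2 s.
  by apply: span_mono Ss => // r [Dr pr]; apply: tors2 => //; rewrite mulrA.
have ps : p *: s = 0 by apply: span_annih Ss.
pose g' := g + e.
have {}hE : h = p *: (p *: g') + s by rewrite hE dE scalerA scalerDr addrA.
have pg : K2 (p *: g').
  have : (p * (p * p)) *: f2 g' = 0.
    have /eqP : f2 h = 0 := Kh.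
    rewrite {1}hE linearD !linearZ /= addr_eq0 -!scalerA => /eqP->.
    by rewrite -linearN -linearZ scalerN ps oppr0 linear0.
  move=> /(eqflat_annih flat1 I) S1; rewrite linearZ /=.
  apply: span_annih S1 => r; rewrite -!mulrA => pppr.
  have Dr : D r by apply: annih_sqzero nDp3 _ => //; rewrite -!mulrA.
  by apply: (tors2) => //; apply: (tors2) => //; exact: sqzeroM.
have Ks : K2 s.
  by have := Kh; rewrite {1}hE linearD linearZ /= pg scaler0 add0r.
apply: bad; rewrite hE; apply: span_dvdD_comp => //.
have nDp : ~ D p by move=> Dp; apply: nDpp; exact: sqzeroM.
by apply: span_mono (eqflat_annih flatK Ks ps) => // r; exact: annih_sqzero.
Qed.


(** Passing to the last multiple p^m h that is still an obstruction gives one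
    killed by p, as [descend] requires. *)
Lemma good_zero_power a p h : (exists n, good a (p ^+ n *: h)) -> ~ good a h ->
  exists m, ~ good a (p ^+ m *: h) /\ good a (p *: (p ^+ m *: h)).
Proof.
move=> [n]; elim: n => [|n IH]; first by rewrite expr0 scale1r.
have [g _ /(IH g)|ng g nh] := EM (good a (p ^+ n *: h)); first by [].
by exists n; rewrite scalerA -exprS.
Qed.

Local Notation nonnil x := (forall n, x ^+ n <> 0).

Lemma sqzeroX (a b : R) n : D (a - b) -> D (a ^+ n - b ^+ n).
Proof. by move=> Dab; rewrite subrXX; exact: sqzeroMr. Qed.

Lemma nonnil_sqzero (a : R) n : nonnil a -> ~ D (a ^+ n).
Proof. by move=> na; rewrite /sqzero -exprD; exact: na. Qed.

Lemma nonnil_dvdD (a p : R) : nonnil a -> dvdD p a -> nonnil p.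
Proof.
move=> na [u Du] n pn; apply: (nonnil_sqzero (n := n) na).
by have := sqzeroX n Du; rewrite exprMn pn mul0r subr0.
Qed.

(** Deepen h to a representative divisible by a p, make it killed by p, and
    descend from a to p: the result is an obstruction modulo p divisible by p^2,
    which [good_of_square] excludes. *)
Lemma good_nonnil (a : R) h : nonnil a -> P a -> K2 h -> span (dvdD a) T2 h ->
  (forall p, P p -> exists n, good a (p ^+ n *: h)) -> good a h.
Proof.
move=> na Pa Kh Sh rad; apply: contrapT => bad.
have nDaa : ~ D (a * a) by have := nonnil_sqzero (n := 2) na; rewrite expr2.
have nDa : ~ D a by have := nonnil_sqzero (n := 1) na; rewrite expr1.
have [p [h' [Pp pa Kh' [k Kk hE] Sh']]] := deepen Pa nDaa Kh Sh.
have gk : good a (a *: k) by apply: span_gen => //; exact: dvdD_refl.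
have badh' : ~ good a h' by move=> gh'; apply: bad; rewrite hE; exact: spanD.
have np := nonnil_dvdD na pa.
have [|m [badm goodm]] := good_zero_power (p := p) _ badh'.
  have [n gn] := rad p Pp; exists n.
  have -> : h' = h - a *: k by rewrite hE addrK.
  by rewrite scalerBr; apply: spanB => //; exact: good_scale.
have Khm : K2 (p ^+ m *: h') by rewrite linearZ /= Kh' scaler0.
have [h'' [Kh'' back fwd _]] := descend pa nDa Khm goodm.
apply: badm; apply: back; apply: good_of_square => //.
  by have := nonnil_sqzero (n := 3) np; rewrite !exprS expr0 mulr1.
apply: fwd; last by exact: spanZ.
move=> Dap; apply: nDaa; have [u Du] := pa.
have -> : a * a = a * (a - p * u) + u * (a * p) by ring.
by apply: sqzeroD => //; exact: sqzeroM.
Qed.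

(** The deepened representative is divisible by a p with p nilpotent.  For the
    last m with a p^m outside D, p^m maps it into D F2, so its coefficients can
    be taken in (D : p^m), and this ideal is inside a R + D. *)
Lemma good_nil (a : R) h : (forall p, P p -> exists n, p ^+ n = 0) -> P a -> ~ D (a * a) ->
  K2 h -> span (dvdD a) T2 h -> good a h.
Proof.
move=> nilP Pa nDaa Kh Sh.
have nDa : ~ D a by move=> Da; apply: nDaa; exact: sqzeroM.
have [p [h' [Pp pa Kh' [k Kk ->] Sh']]] := deepen Pa nDaa Kh Sh.
apply: spanD; last first.
  by apply: span_gen => //; exact: dvdD_refl.
have [n pn] := nilP p Pp.
have [m [nDm Dm]] : exists m, ~ D (a * p ^+ m) /\ D (a * p ^+ m.+1).
  have : D (a * p ^+ n) by rewrite pn mulr0; exact: sqzero0.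
  elim: n {pn} => [|n IH] Dn; first by case: nDa; move: Dn; rewrite expr0 mulr1.
  by have [/IH|nD] := EM (D (a * p ^+ n)); last by exists n.
have : span (fun r => D (p ^+ m * r)) K2 h'.
  apply: span_sqcolon_ker => //; apply: span_mono Sh' => // r [u Du].
  have -> : p ^+ m * r = p ^+ m * (r - a * p * u) + u * (a * p ^+ m.+1).
    by rewrite exprS; ring.
  by apply: sqzeroD => //; exact: sqzeroM.
by apply: span_mono => // r; exact: colon_dvdD.
Qed.

(** For a in D this is [span_sqzero_ker], and for a unit a it is trivial.  If P has
    an element that is not nilpotent, descend from a to it when a is nilpotent, and
    apply [good_nonnil].  If all of P is
    nilpotent and a is, modulo D, a multiple of a product of two elements of P,
    then a has a divisor b in P with b^2 outside D; descend to b and apply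
    [good_nil].  In the remaining case a generates P modulo D, and the last
    nonzero power of a kills h and has its annihilator inside P. *)
Lemma good_of_radical a h : K2 h -> span (dvdD a) T2 h ->
  (forall p, P p -> exists n, good a (p ^+ n *: h)) -> good a h.
Proof.
move=> Kh Sh rad.
have [Da|nDa] := EM (D a).
  apply: (@span_mono _ _ D _ K2) => // [r|]; first exact: dvdDD.
  apply: span_sqzero_ker => //; apply: span_mono Sh => // r [u Du].
  by rewrite -(subrK (a * u) r); apply: sqzeroD => //; exact: sqzeroMr.
have [Ua|Pa] := EM (invertible a).
  rewrite -[h]scale1r; apply: span_gen => //; exact: dvdD_invertible.
apply: contrapT => bad.
have [[p0 [Pp0 np0]]|nilP] := EM (exists p, P p /\ nonnil p).
  have [na|nna] := EM (nonnil a); first by apply: bad; exact: good_nonnil.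
  have p0a : dvdD p0 a.
    by case: (dvdD_total gR lR p0 a) => // ap; case: nna; exact: nonnil_dvdD ap.
  have [m [badm goodm]] := good_zero_power (rad p0 Pp0) bad.
  have Khm : K2 (p0 ^+ m *: h) by rewrite linearZ /= Kh scaler0.
  have [h' [Kh' back fwd rad']] := descend p0a nDa Khm goodm.
  apply: badm; apply: back; apply: good_nonnil => //.
    by have := fwd 1; rewrite !mulr1; apply => //; exact: spanZ.
  move=> p /rad [n gn]; exists n; apply: rad'.
  by rewrite scalerA mulrC -scalerA; exact: good_scale.
have {}nilP p : P p -> exists n, p ^+ n = 0.
  by move=> Pp; apply: contrapT => /forallNP np; apply: nilP; exists p.
have [[p [q [Pp Pq pqa]]]|max] := EM (exists p q, [/\ P p, P q & dvdD (p * q) a]).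
  have [b [Pb nDbb ba]] : exists b, [/\ P b, ~ D (b * b) & dvdD b a].
    have sq x y : dvdD x y -> dvdD (x * y) a -> ~ D (x * x).
      move=> [u Du] [v Dv] Dxx; apply: nDa.
      have -> : a = (a - x * y * v) + (x * v * (y - x * u) + u * v * (x * x)) by ring.
      by apply: sqzeroD => //; apply: sqzeroD => //; exact: sqzeroM.
    case: (dvdD_total gR lR p q) => d.
      by exists p; split=> //; [exact: sq pqa|apply: dvdD_trans pqa => //; exact: dvdDl].
    by exists q; split=> //; [apply: (sq _ p) => //; rewrite mulrC|
      apply: dvdD_trans pqa => //; exact: dvdDr].
  have [m [badm goodm]] := good_zero_power (rad b Pb) bad.
  have Khm : K2 (b ^+ m *: h) by rewrite linearZ /= Kh scaler0.
  have [h' [Kh' back fwd _]] := descend ba nDa Khm goodm.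
  apply: badm; apply: back; apply: good_nil => //.
  by have := fwd 1; rewrite !mulr1; apply => //; exact: spanZ.
have aP b : P b -> dvdD a b.
  move=> Pb; case: (dvdD_total gR lR a b) => // -[u Du].
  have [[v uv]|Pu] := EM (invertible u).
    exists v; have -> : b - a * v = - (v * (a - b * u)) + b * (1 - u * v) by ring.
    by rewrite uv subrr mulr0 addr0; apply: sqzeroN => //; exact: sqzeroM.
  by case: max; exists b, u; split=> //; exists 1; rewrite mulr1.
have [n an] := nilP a Pa.
have [m [am0 am]] : exists m, a ^+ m <> 0 /\ a ^+ m.+1 = 0.
  elim: n an => [|n IH] an; first by case: (proj1 lR); rewrite -an expr0.
  by have [/IH|?] := EM (a ^+ n = 0); last by exists n.
(* m > 0 as a is nonzero; this makes a^m square to zero. *)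
have m0 : (0 < m)%N.
  case: m am am0 => // a0; case: nDa; move: a0; rewrite expr1 => ->; exact: sqzero0.
have Dx : D (a ^+ m).
  rewrite /sqzero -exprD; have [k ->] : exists k, (m + m = m.+1 + k)%N.
    by exists m.-1; rewrite addSnnS prednK.
  by rewrite exprD am mul0r.
apply: bad; have : span (fun r => a ^+ m * r = 0) K2 h.
  apply: span_annih_ker => //; apply: span_mono Sh => // r [u Du].
  have -> : a ^+ m * r = a ^+ m * (r - a * u) + u * a ^+ m.+1 by rewrite exprS; ring.
  by rewrite am mulr0 addr0 sqzero_mul.
apply: span_mono => // r ar; apply: aP => -[s rs]; apply: am0.
by rewrite -[LHS]mulr1 -rs mulrA ar mul0r.
Qed.

End ComplexOverLocal.

(** * Localisation *)

Record mulset (R : comPzRingType) := MulSet {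
  mulset_pred :> R -> Prop;
  mulset1 : mulset_pred 1%R;
  mulsetM : forall a b, mulset_pred a -> mulset_pred b -> mulset_pred (a * b)%R }.

Section Fractions.
Local Open Scope ring_scope.
Variables (R : comPzRingType) (S : mulset R).

Definition denominator := {s : R | `[< S s >]}.
Fact den1_subproof : `[< S 1 >]. Proof. by apply/asboolP; exact: mulset1. Qed.
Definition den1 : denominator := Sub 1 den1_subproof.
Lemma denP (s : denominator) : S (val s). Proof. exact/asboolP/(valP s). Qed.

Section Module.
Variable M : lmodType R.

Definition loc_rel : rel (M * denominator) := fun p q =>
  `[< exists2 u, S u & (u * val q.2) *: p.1 = (u * val p.2) *: q.1 >].

Fact loc_rel_refl : reflexive loc_rel.
Proof. by move=> p; apply/asboolP; exists 1 => //; exact: mulset1. Qed.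

Fact loc_rel_sym : symmetric loc_rel.
Proof. by move=> p q; apply/asboolP/asboolP => -[u Su E]; exists u. Qed.

Fact loc_rel_trans : transitive loc_rel.
Proof.
move=> [y t] [x s] [z r] /asboolP [u Su /= E1] /asboolP [v Sv /= E2].
apply/asboolP; exists (u * v * val t) => /=.
  by apply: mulsetM; [exact: mulsetM|exact: denP].
rewrite /=; move: (val t) (val r) (val s) E1 E2 => t1 r1 s1 E1 E2.
transitivity ((v * r1) *: ((u * t1) *: x)); first by rewrite scalerA; congr (_ *: _); ring.
rewrite E1; transitivity ((u * s1) *: ((v * r1) *: y)).
  by rewrite !scalerA; congr (_ *: _); ring.
by rewrite E2 scalerA; congr (_ *: _); ring.
Qed.

Canonical loc_equiv := EquivRel loc_rel loc_rel_refl loc_rel_sym loc_rel_trans.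

Definition loc := {eq_quot loc_equiv}%qT.
HB.instance Definition _ := Choice.on loc.
HB.instance Definition _ := EqQuotient.on loc.

Definition frac (x : M) (s : R) : loc := (\pi_loc (x, insubd den1 s))%qT.

Lemma frac_eq x y s t : S s -> S t ->
  frac x s = frac y t <-> exists2 u, S u & (u * t) *: x = (u * s) *: y.
Proof.
move=> Ss St; have Es : val (insubd den1 s) = s by rewrite insubdK //; exact/asboolP.
have Et : val (insubd den1 t) = t by rewrite insubdK //; exact/asboolP.
split=> [/eqmodP/asboolP|[u Su E]]; first by rewrite /= Es Et.
by apply/eqmodP/asboolP; exists u; rewrite //= Es Et.
Qed.

Lemma fracP (z : loc) : exists x s, S s /\ z = frac x s.
Proof.
exists (repr z).1, (val (repr z).2); split; first exact: denP.
by rewrite /frac valKd -surjective_pairing reprK.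
Qed.

Lemma frac_repr z : S (val (repr z).2) /\ z = frac (repr z).1 (val (repr z).2).
Proof.
split; first exact: denP.
by rewrite /frac valKd -surjective_pairing reprK.
Qed.

(** Addition and scaling are computed on representatives and locked, so that
    only their values on fractions are ever unfolded. *)
Definition loc_add_def (z w : loc) : loc :=
  frac (val (repr w).2 *: (repr z).1 + val (repr z).2 *: (repr w).1)
       (val (repr z).2 * val (repr w).2).
Fact loc_add_key : unit. Proof. exact: tt. Qed.
Definition loc_add := locked_with loc_add_key loc_add_def.
Definition loc_opp (z : loc) : loc := frac (- (repr z).1) (val (repr z).2).

Lemma loc_addE x y s t : S s -> S t ->
  loc_add (frac x s) (frac y t) = frac (t *: x + s *: y) (s * t).
Proof.
move=> Ss St; rewrite /loc_add unlock /loc_add_def.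
have [] := frac_repr (frac x s); have [] := frac_repr (frac y t).
set p := repr _; set q := repr _; move: (val p.2) (p.1) (val q.2) (q.1) => t' y' s' x'.
move=> St' /frac_eq -/(_ St St') [u Su E1] Ss' /frac_eq -/(_ Ss Ss') [v Sv E2].
apply/frac_eq; [exact: mulsetM|exact: mulsetM|].
exists (u * v); first exact: mulsetM.
rewrite !scalerDr !scalerA; congr (_ + _).
  transitivity ((u * t * t') *: ((v * s) *: x')); first by rewrite scalerA; congr (_ *: _); ring.
  by rewrite -E2 scalerA; congr (_ *: _); ring.
transitivity ((v * s * s') *: ((u * t) *: y')); first by rewrite scalerA; congr (_ *: _); ring.
by rewrite -E1 scalerA; congr (_ *: _); ring.
Qed.

Lemma loc_oppE x s : S s -> loc_opp (frac x s) = frac (- x) s.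
Proof.
move=> Ss; rewrite /loc_opp; have [] := frac_repr (frac x s).
move: (repr _) => [x' s'] /= Ss' /frac_eq -/(_ Ss Ss') [v Sv E].
by apply/frac_eq => //; exists v => //; rewrite !scalerN E.
Qed.

Fact loc_addA : associative loc_add.
Proof.
move=> z1 z2 z3; have [x [s [Ss ->]]] := fracP z1.
have [y [t [St ->]]] := fracP z2; have [w [r [Sr ->]]] := fracP z3.
rewrite !loc_addE ?scalerDr ?scalerA; try by do ?apply: mulsetM.
by rewrite addrA [r * t]mulrC [r * s]mulrC mulrA.
Qed.

Fact loc_addC : commutative loc_add.
Proof.
move=> z1 z2; have [x [s [Ss ->]]] := fracP z1.
by have [y [t [St ->]]] := fracP z2; rewrite !loc_addE // addrC mulrC.
Qed.

Fact loc_add0 : left_id (frac 0 1) loc_add.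
Proof.
move=> z; have [x [s [Ss ->]]] := fracP z; rewrite loc_addE //; last exact: mulset1.
by rewrite scaler0 add0r scale1r mul1r.
Qed.

Fact loc_addN : left_inverse (frac 0 1) loc_opp loc_add.
Proof.
move=> z; have [x [s [Ss ->]]] := fracP z; rewrite loc_oppE // loc_addE //.
rewrite scalerN addNr; apply/frac_eq; [exact: mulsetM|exact: mulset1|].
by exists 1; [exact: mulset1|rewrite !scaler0].
Qed.

HB.instance Definition _ :=
  GRing.isZmodule.Build loc loc_addA loc_addC loc_add0 loc_addN.

Lemma fracD x y s t : S s -> S t ->
  frac x s + frac y t = frac (t *: x + s *: y) (s * t).
Proof. exact: loc_addE. Qed.

Lemma frac0 s : S s -> frac 0 s = 0.
Proof.
move=> Ss; apply/frac_eq => //; first exact: mulset1.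
by exists 1; [exact: mulset1|rewrite !scaler0].
Qed.

Lemma frac_eq0 x s : S s -> frac x s = 0 <-> exists2 u, S u & u *: x = 0.
Proof.
move=> Ss; split=> [/frac_eq -/(_ Ss (mulset1 S)) [u Su]|[u Su E]].
  by rewrite scaler0 mulr1; exists u.
by apply/frac_eq => //; [exact: mulset1|exists u => //; rewrite mulr1 scaler0].
Qed.

Lemma frac_same x s t : S s -> S t -> frac x s = frac (t *: x) (t * s).
Proof.
move=> Ss St; apply/frac_eq => //; first exact: mulsetM.
by exists 1; [exact: mulset1|rewrite scalerA; congr (_ *: _); ring].
Qed.

Lemma fracDl x y s : S s -> frac x s + frac y s = frac (x + y) s.
Proof. by move=> Ss; rewrite fracD // -scalerDr -frac_same. Qed.

Lemma frac_sum (T : finType) (x : T -> M) s : S s ->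
  \sum_t frac (x t) s = frac (\sum_t x t) s.
Proof.
move=> Ss; apply: (big_ind2 (fun z x => z = frac x s)) => //.
  by rewrite frac0.
by move=> z1 x1 z2 x2 -> ->; rewrite fracDl.
Qed.

End Module.

(** The localised ring is the localisation of R as a module over itself; a
    separate name is needed since it acts on all the modules [loc M]. *)
Definition locR := loc R^o.
HB.instance Definition _ := Choice.on locR.
HB.instance Definition _ := GRing.isZmodule.Build locR
  (@loc_addA R^o) (@loc_addC R^o) (@loc_add0 R^o) (@loc_addN R^o).

Definition loc_scale_def (M : lmodType R) (z : locR) (w : loc M) : loc M :=
  frac ((repr z).1 *: (repr w).1) (val (repr z).2 * val (repr w).2).

Fact loc_scale_key : unit. Proof. exact: tt. Qed.
Definition loc_scale := locked_with loc_scale_key loc_scale_def.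

Lemma loc_scaleE (M : lmodType R) (a : R^o) s (x : M) t : S s -> S t ->
  loc_scale (frac a s) (frac x t) = frac (a *: x) (s * t).
Proof.
move=> Ss St; rewrite /loc_scale unlock /loc_scale_def.
have [] := frac_repr (frac a s); have [] := frac_repr (frac x t).
set p := repr _; set q := repr _; move: (val p.2) (p.1) (val q.2) (q.1) => t' x' s' a'.
move=> St' /frac_eq -/(_ St St') [u Su E1] Ss' /frac_eq -/(_ Ss Ss') [v Sv E2].
apply/frac_eq; [exact: mulsetM|exact: mulsetM|].
exists (u * v); first exact: mulsetM.
transitivity ((v * s * a') *: ((u * t) *: x')); first by rewrite !scalerA; congr (_ *: _); ring.
have {}E2 : v * s' * a = v * s * a' := E2.
by rewrite -E1 -E2 !scalerA; congr (_ *: _); ring.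
Qed.

Definition loc1 : locR := frac (1 : R^o) 1.
Definition loc_mul : locR -> locR -> locR := loc_scale (M := R^o).

Lemma loc_scaleA (M : lmodType R) a b (z : loc M) :
  loc_scale a (loc_scale b z) = loc_scale (loc_mul a b) z.
Proof.
have [x [s [Ss ->]]] := fracP a; have [y [t [St ->]]] := fracP b.
have [w [r [Sr ->]]] := fracP z.
rewrite /loc_mul !loc_scaleE //; try exact: mulsetM.
by rewrite scalerA mulrA.
Qed.

Lemma loc_scale1 (M : lmodType R) (z : loc M) : loc_scale loc1 z = z.
Proof.
have [x [s [Ss ->]]] := fracP z; rewrite loc_scaleE ?scale1r ?mul1r //; exact: mulset1.
Qed.

Lemma loc_scaleDr (M : lmodType R) a (z w : loc M) :
  loc_scale a (z + w) = loc_scale a z + loc_scale a w.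
Proof.
have [x [s [Ss ->]]] := fracP a; have [y [t [St ->]]] := fracP z.
have [v [r [Sr ->]]] := fracP w.
rewrite fracD // !loc_scaleE //; try exact: mulsetM.
rewrite fracD; try exact: mulsetM.
rewrite (@frac_same _ _ (s * (t * r)) s) //; try by do ?apply: mulsetM.
congr frac; last by ring.
by rewrite !scalerDr !scalerA; congr (_ *: _ + _ *: _); ring.
Qed.

Lemma loc_scaleDl (M : lmodType R) a b (z : loc M) :
  loc_scale (a + b) z = loc_scale a z + loc_scale b z.
Proof.
have [x [s [Ss ->]]] := fracP a; have [y [t [St ->]]] := fracP b.
have [v [r [Sr ->]]] := fracP z.
rewrite fracD // !loc_scaleE //; try exact: mulsetM.
rewrite fracD; try exact: mulsetM.
rewrite (@frac_same _ _ (s * t * r) r) //; try by do ?apply: mulsetM.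
congr frac; last by ring.
rewrite !scalerA -scalerDl; congr (_ *: _).
by rewrite mulrDr; congr (_ + _); rewrite mulrA [LHS]mulrAC mulrC mulrA.
Qed.

Fact loc_mulA : associative loc_mul. Proof. by move=> a b c; exact: loc_scaleA. Qed.
Fact loc_mulC : commutative loc_mul.
Proof.
move=> a b; have [x [s [Ss ->]]] := fracP a; have [y [t [St ->]]] := fracP b.
by rewrite /loc_mul !loc_scaleE // mulrC; congr frac; exact: mulrC.
Qed.
Fact loc_mul1 : left_id loc1 loc_mul. Proof. exact: loc_scale1. Qed.
Fact loc_mulDl : left_distributive loc_mul +%R.
Proof. by move=> a b c; exact: loc_scaleDl. Qed.

HB.instance Definition _ := GRing.Zmodule_isComPzRing.Build locR
  loc_mulA loc_mulC loc_mul1 loc_mulDl.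

HB.instance Definition _ (M : lmodType R) :=
  GRing.Zmodule_isLmodule.Build locR (loc M) (@loc_scaleA M) (@loc_scale1 M)
    (@loc_scaleDr M) (fun z a b => @loc_scaleDl M a b z).

Definition rfrac (a s : R) : locR := frac (a : R^o) s.

Lemma fracZ (M : lmodType R) a s (x : M) t : S s -> S t ->
  rfrac a s *: frac x t = frac (a *: x) (s * t).
Proof. exact: loc_scaleE. Qed.

Lemma rfracM a s b t : S s -> S t -> rfrac a s * rfrac b t = rfrac (a * b) (s * t).
Proof. exact: loc_scaleE. Qed.

Lemma rfracD a s b t : S s -> S t -> rfrac a s + rfrac b t = rfrac (t * a + s * b) (s * t).
Proof. exact: fracD. Qed.

Lemma rfracDl a b s : S s -> rfrac a s + rfrac b s = rfrac (a + b) s.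
Proof. exact: fracDl. Qed.

Lemma rfrac_eq a s b t : S s -> S t ->
  rfrac a s = rfrac b t <-> exists2 u, S u & u * t * a = u * s * b.
Proof. exact: frac_eq. Qed.

Lemma rfrac_eq0 a s : S s -> rfrac a s = 0 <-> exists2 u, S u & u * a = 0.
Proof. exact: frac_eq0. Qed.

Lemma rfracP (z : locR) : exists a s, S s /\ z = rfrac a s.
Proof. by have [a [s [Ss ->]]] := fracP z; exists a, s. Qed.

Lemma rfrac_sum (T : finType) (a : T -> R) s : S s ->
  \sum_t rfrac (a t) s = rfrac (\sum_t a t) s.
Proof. exact: frac_sum. Qed.

Lemma rfrac1 : rfrac 1 1 = 1. Proof. by []. Qed.

Lemma mulset_prod (T : finType) (P : pred T) (s : T -> R) :
  (forall t, S (s t)) -> S (\prod_(t | P t) s t).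
Proof. by move=> Ss; elim/big_ind: _ => //; [exact: mulset1|exact: mulsetM]. Qed.

Lemma mulsetX s n : S s -> S (s ^+ n).
Proof.
by move=> Ss; elim: n => [|n IH]; rewrite ?expr0 ?exprS; [exact: mulset1|exact: mulsetM].
Qed.

Lemma rfracX a s n : S s -> rfrac a s ^+ n = rfrac (a ^+ n) (s ^+ n).
Proof.
move=> Ss; elim: n => [|n IH]; first by rewrite !expr0 rfrac1.
by rewrite !exprS IH rfracM //; exact: mulsetX.
Qed.

Definition loc_pred (M : lmodType R) (K : M -> Prop) (z : loc M) : Prop :=
  exists x s, [/\ S s, K x & z = frac x s].

Lemma loc_pred_common (M : lmodType R) (K : M -> Prop) (T : finType) (z : T -> loc M) :
  is_submod K -> (forall t, loc_pred K (z t)) ->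
  exists s x, [/\ S s, forall t, K (x t) & forall t, z t = frac (x t) s].
Proof.
move=> [_ _ KZ] Kz.
have /choice [x Kx] := Kz; have /choice [s xs] := Kx.
have Ss t : S (s t) by case: (xs t).
exists (\prod_t s t), (fun t => (\prod_(t' | t' != t) s t') *: x t); split.
- exact: mulset_prod.
- by move=> t; apply: KZ; case: (xs t).
- move=> t; have [_ _ ->] := xs t.
  rewrite [X in _ = frac _ X](bigD1 t) //= [s t * _]mulrC -frac_same //; exact: mulset_prod.
Qed.

Lemma loc_predT (M : lmodType R) (z : loc M) : loc_pred (fun _ => True) z.
Proof. by have [x [s [Ss ->]]] := fracP z; exists x, s. Qed.

Lemma rfrac_common (T : finType) (z : T -> locR) :
  exists s a, S s /\ forall t, z t = rfrac (a t) s.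
Proof.
have [|t|s [a [Ss _ zE]]] := @loc_pred_common R^o (fun _ => True) T z.
- exact: submodT.
- exact: loc_predT.
- by exists s, a.
Qed.

Lemma frac_den1 (M : lmodType R) a (x : M) t : S t -> rfrac a 1 *: frac x t = frac (a *: x) t.
Proof. by move=> St; rewrite fracZ ?mul1r //; exact: mulset1. Qed.

(** Clear denominators in the relation, multiply by the element of S that makes
    it hold over R, and trivialise it there. *)
Lemma eqflat_loc (M : lmodType R) (K : M -> Prop) :
  is_submod K -> eqflat K -> eqflat (loc_pred K).
Proof.
move=> sK fK; apply: eqflatI => I alpha z Kz.
have [s [a [Ss alphaE]]] := rfrac_common alpha.
have [t [x [St Kx zE]]] := loc_pred_common sK Kz.
under eq_bigr do rewrite alphaE zE fracZ //.
rewrite frac_sum; last exact: mulsetM.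
move=> /(frac_eq0 _ (mulsetM Ss St)) [u Su uE].
have [//||J [v [w [Kw xE vE]]]] := eqflat_trivialise (a := fun i => u * a i) (x := x) fK.
  by rewrite -[RHS]uE scaler_sumr; apply: eq_bigr => i _; rewrite scalerA.
exists J, (fun i j => rfrac (v i j) 1), (fun j => frac (w j) t); split.
- by move=> j; exists (w j), t.
- move=> i; under eq_bigr do rewrite frac_den1 //.
  by rewrite frac_sum // zE xE.
- have S1 := mulset1 S; move=> j; under eq_bigr do rewrite alphaE rfracM // mulr1.
  rewrite rfrac_sum //; apply/(rfrac_eq0 _ Ss); exists u => //.
  by rewrite mulr_sumr -[RHS](vE j); apply: eq_bigr => i _; rewrite mulrA.
Qed.

Lemma eqflatT_loc (M : lmodType R) :
  eqflat (fun _ : M => True) -> eqflat (fun _ : loc M => True).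
Proof.
move=> fM; have := eqflat_loc (@submodT _ M) fM.
rewrite (_ : loc_pred _ = fun _ => True) //.
by apply/funext => z; apply/propext; split=> // _; exact: loc_predT.
Qed.

Section Maps.
Variables (M N : lmodType R) (f : {linear M -> N}).

Definition loc_map (z : loc M) : loc N := frac (f (repr z).1) (val (repr z).2).

Lemma loc_mapE x s : S s -> loc_map (frac x s) = frac (f x) s.
Proof.
move=> Ss; rewrite /loc_map; have [] := frac_repr (frac x s).
move: (repr _) => [x' s'] /= Ss' /frac_eq -/(_ Ss Ss') [v Sv E].
by apply/frac_eq => //; exists v => //; rewrite -!linearZ E.
Qed.

Fact loc_map_linear : linear loc_map.
Proof.
move=> a z w; have [b [r [Sr ->]]] := rfracP a.
have [x [s [Ss ->]]] := fracP z; have [y [t [St ->]]] := fracP w.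
rewrite fracZ // fracD // ?loc_mapE //; try by do ?apply: mulsetM.
rewrite fracZ // fracD //; try by do ?apply: mulsetM.
by rewrite linearD !linearZ /= !scalerA [b * t]mulrC.
Qed.

HB.instance Definition _ :=
  GRing.isLinear.Build locR (loc M) (loc N) *:%R loc_map loc_map_linear.

Lemma loc_map_ker z : loc_map z = 0 <-> loc_pred (fun x => f x = 0) z.
Proof.
have [x [s [Ss ->]]] := fracP z; rewrite loc_mapE //; split.
  move=> /(frac_eq0 _ Ss) [u Su ufx]; exists (u *: x), (u * s); split.
  - exact: mulsetM.
  - by rewrite linearZ.
  - exact: frac_same.
move=> [y [t [St fy /frac_eq -/(_ Ss St) [u Su E]]]]; apply/frac_eq0 => //.
exists (u * t); first exact: mulsetM.
by have := congr1 f E; rewrite !linearZ /= fy scaler0.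
Qed.

End Maps.

(** The hypotheses say that the complement of S is a prime ideal. *)
Section Prime.
Hypothesis S0 : ~ S 0.
Hypothesis SM : forall a b, S (a * b) -> S a.
Hypothesis SD : forall a b, S (a + b) -> S a \/ S b.

Lemma rfrac_invertible a s : S s -> invertible (rfrac a s) <-> S a.
Proof.
move=> Ss; split=> [[z]|Sa].
  have [b [t [St ->]]] := rfracP z; rewrite rfracM // -rfrac1.
  move=> /rfrac_eq -/(_ (mulsetM Ss St) (mulset1 S)) [u Su E].
  apply: (SM (b := u * 1 * b)); have -> : a * (u * 1 * b) = u * 1 * (a * b) by ring.
  by rewrite E mulr1; apply: mulsetM => //; exact: mulsetM.
exists (rfrac s a); rewrite rfracM // -rfrac1; apply/rfrac_eq; try exact: mulsetM.
  exact: mulset1.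
by exists 1; [exact: mulset1|ring].
Qed.

Lemma loc_is_local : is_local locR.
Proof.
split=> [|z w].
  by rewrite -rfrac1 => /rfrac_eq0 -/(_ (mulset1 S)) [u Su]; rewrite mulr1 => u0; apply: S0; rewrite -u0.
have [a [s [Ss ->]]] := rfracP z; have [b [t [St ->]]] := rfracP w.
rewrite rfracD // => /rfrac_invertible -/(_ (mulsetM Ss St)) /SD.
by case; rewrite mulrC => /SM ?; [left|right]; apply/rfrac_invertible.
Qed.

End Prime.

Lemma loc_gaussian : degree_one_gaussian R -> degree_one_gaussian locR.
Proof.
move=> gR; suff H (x y z w : locR) : exists a b c : locR,
  x * w = a * (x * z) + b * (x * w + y * z) + c * (y * w) by exact: H.
have pair (x1 x2 : locR) : exists a b s, [/\ S s, x1 = rfrac a s & x2 = rfrac b s].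
  have [s [a [Ss E]]] := rfrac_common (fun b : bool => if b then x1 else x2).
  by exists (a true), (a false), s; split; [|exact: (E true)|exact: (E false)].
have [a [b [s [Ss -> ->]]]] := pair x y; have [c [d [t [St -> ->]]]] := pair z w.
have [k [l [m E]]] := gR a b c d.
have Sst : S (s * t) by exact: mulsetM.
exists (rfrac k 1), (rfrac l 1), (rfrac m 1).
have S1 := mulset1 S.
by rewrite !rfracM // rfracDl // rfracM // !mul1r !rfracDl // [in LHS]E.
Qed.

End Fractions.

Arguments loc_map [R] S [M N] f z.

(** * Flatness of the second syzygy over a local Gaussian ring *)

Section LocalObstruction.
Local Open Scope ring_scope.
Variables (R : comPzRingType) (gR : degree_one_gaussian R) (lR : is_local R).
Variables (F2 F1 F0 : lmodType R) (f2 : {linear F2 -> F1}) (f1 : {linear F1 -> F0}).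
Local Notation D := (@sqzero R).
Local Notation T2 := (fun _ : F2 => True).
Local Notation T1 := (fun _ : F1 => True).
Local Notation K2 := (fun x : F2 => f2 x = 0).
Local Notation K1 := (fun x : F1 => f1 x = 0).
Hypotheses (flat2 : eqflat T2) (flat1 : eqflat T1)
  (flat0 : eqflat (fun _ : F0 => True)) (flatK : eqflat K2).
Hypothesis exact1 : forall y, f1 y = 0 <-> exists x, f2 x = y.
Local Notation good a h := (span (dvdD a) K2 h).

Let subK : is_submod K2 := submod_ker f2.
Let idD : is_ideal D := ideal_sqzero gR lR.
Let ideal_dvd a : is_ideal (dvdD a) := ideal_dvdD gR lR a.

Section Localised.
Variable S : mulset R.

Lemma loc_exact y : loc_map S f1 y = 0 <-> exists x, loc_map S f2 x = y.
Proof.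
split=> [/loc_map_ker [y0 [s [Ss /exact1 [x <-] ->]]]|[x <-]].
  by exists (frac S x s); rewrite loc_mapE.
have [x0 [s [Ss ->]]] := fracP x; rewrite !loc_mapE //.
by rewrite (_ : f1 (f2 x0) = 0) ?frac0 //; apply/exact1; exists x0.
Qed.

Lemma eqflat_loc_ker : eqflat (fun z => loc_map S f2 z = 0).
Proof.
rewrite (_ : (fun z => _) = @loc_pred _ S _ K2); first exact: eqflat_loc.
by apply/funext => z; apply/propext; exact: loc_map_ker.
Qed.

Lemma span_frac1 (M : lmodType R) (I : R -> Prop) (J : locR S -> Prop) (K : M -> Prop)
    (L : loc S M -> Prop) x :
  (forall r, I r -> J (rfrac S r 1)) -> (forall w, K w -> L (frac S w 1)) ->
  span I K x -> span J L (frac S x 1).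
Proof.
have S1 := mulset1 S; move=> IJ KL; elim=> [|r w z Ir Kw _ IH].
  by rewrite frac0 //; exact: span0.
by rewrite -fracDl // -frac_den1 //; apply: spanS => //; [exact: IJ|exact: KL].
Qed.

Lemma dvdD_frac1 a r : dvdD a r -> dvdD (rfrac S a 1) (rfrac S r 1).
Proof.
have S1 := mulset1 S; move=> [u Du]; exists (rfrac S u 1).
have -> : rfrac S r 1 - rfrac S a 1 * rfrac S u 1 = rfrac S (r - a * u) 1.
  rewrite rfracM // mulr1; apply/eqP; rewrite subr_eq rfracDl //.
  by rewrite subrK.
by rewrite /sqzero rfracM // mulr1 Du; exact: frac0.
Qed.

(** A vanishing obstruction over the localisation vanishes over R up to a
    denominator: a square-zero fraction becomes a square-zero element once it is
    multiplied by a suitable element of S. *)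
Lemma good_frac1 a z : span (dvdD (rfrac S a 1)) (fun z => loc_map S f2 z = 0) z ->
  exists x s, [/\ S s, good a x & z = frac S x s].
Proof.
have S1 := mulset1 S.
elim=> [|rho kappa z' [u Du] Kk _ [x [s [Ss gx ->]]]].
  by exists 0, 1; split=> //; exact: span0.
have [r [q [Sq rhoE]]] := rfracP rho; have [c [t [St uE]]] := rfracP u.
have [k [q' [Sq' Kk0 ->]]] : @loc_pred _ S _ K2 kappa by exact/loc_map_ker.
pose e := r * t - a * c * q.
have Sqt : S (q * t) by exact: mulsetM.
have eE : rho - rfrac S a 1 * u = rfrac S e (q * t).
  apply/eqP; rewrite subr_eq rhoE uE rfracM // mul1r rfracD //; apply/eqP.
  apply/rfrac_eq => //; first exact: mulsetM.
  by exists 1 => //; rewrite /e; ring.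
have [v Sv ve] : exists2 v, S v & v * (e * e) = 0.
  apply/(rfrac_eq0 _ (mulsetM Sqt Sqt)).
  by rewrite -rfracM // -eE.
have Dve : D (v * e).
  have -> : D (v * e) = (v * (v * (e * e)) = 0) by rewrite /sqzero; congr (_ = _); ring.
  by rewrite ve mulr0.
exists (s *: ((v * t * r) *: k) + (v * t * (q * q')) *: x), (v * t * (q * q') * s).
have Sden : S (v * t * (q * q')) by do ?apply: mulsetM.
split; first exact: mulsetM.
  apply: spanD; last exact: spanZ.
  apply: spanZ => //; apply: span_gen => //; exists (c * q * v).
  by have -> : v * t * r - a * (c * q * v) = v * e by rewrite /e; ring.
rewrite -fracD //; congr (_ + _); rewrite rhoE fracZ //.
by rewrite [LHS](@frac_same _ _ _ _ _ (v * t)) ?scalerA //; exact: mulsetM.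
Qed.

End Localised.

(** The set of elements having a power that kills the obstruction is a prime
    ideal, because divisibility modulo D is total; after localising there every
    non-unit has this property, the obstruction vanishes by [good_of_radical], and
    so some element outside the prime ideal kills it over R. *)
Lemma good_local a h : K2 h -> span (dvdD a) T2 h -> good a h.
Proof.
move=> Kh Sh; apply: contrapT => bad.
pose Q r := exists n, good a (r ^+ n *: h).
have goodZ r x : good a x -> good a (r *: x) by exact: spanZ.
have goodD d : D d -> good a (d *: h).
  by move=> Dd; apply: span_gen => //; exact: dvdDD.
have Qdvd p q : dvdD p q -> Q p -> Q q.
  move=> [u Du] [n gn]; exists n.
  have -> : q ^+ n = (q ^+ n - (p * u) ^+ n) + u ^+ n * p ^+ n by rewrite exprMn; ring.
  by rewrite scalerDl -scalerA; apply: spanD; [apply: goodD; exact: sqzeroX|exact: goodZ].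
have Q1 : ~ Q 1 by move=> [n]; rewrite expr1n scale1r.
have Q0 : Q 0 by exists 1%N; rewrite expr1 scale0r; exact: span0.
have Qsq y : Q (y * y) -> Q y by move=> [n gn]; exists (2 * n)%N; rewrite exprM expr2.
have QM x y : ~ Q x -> ~ Q y -> ~ Q (x * y).
  have aux p q : dvdD p q -> Q (p * q) -> Q q.
    move=> [u Du] Qpq; apply: Qsq; apply: Qdvd Qpq; exists u.
    have -> : q * q - p * q * u = q * (q - p * u) by ring.
    exact: sqzeroM.
  move=> nx ny Qxy; case: (dvdD_total gR lR x y) => d; first by apply: ny; exact: aux Qxy.
  by apply: nx; apply: aux d _; rewrite mulrC.
pose S := MulSet (mulset_pred := fun r => ~ Q r) Q1 QM.
have S0 : ~ S 0 by apply.
have SM x y : S (x * y) -> S x.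
  by move=> nQ Qx; apply: nQ; apply: Qdvd Qx; exact: dvdDl.
have SD x y : S (x + y) -> S x \/ S y.
  move=> nQ; apply: contrapT => /not_orP [/contrapT Qx /contrapT Qy]; apply: nQ.
  have [d|d] := dvdD_total gR lR x y.
    by apply: Qdvd Qx; case: (ideal_dvd x) => _ + _; apply=> //; exact: dvdD_refl.
  by apply: Qdvd Qy; case: (ideal_dvd y) => _ + _; apply=> //; exact: dvdD_refl.
have gS := loc_gaussian (S := S) gR; have lS := loc_is_local S0 SM SD.
have S1 := mulset1 S.
have : span (dvdD (rfrac S a 1)) (fun z => loc_map S f2 z = 0) (frac S h 1).
  apply: (@good_of_radical _ gS lS _ _ _ (loc_map S f2) (loc_map S f1)
    (eqflatT_loc flat2) (eqflatT_loc flat1) (eqflatT_loc flat0)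
    (eqflat_loc_ker (S := S)) (loc_exact (S := S))).
  - by rewrite /= loc_mapE // Kh frac0.
  - by apply: span_frac1 Sh => // r; exact: dvdD_frac1.
  - move=> p np; have [r [s [Ss pE]]] := rfracP p.
    have [n gn] : Q r.
      by apply: contrapT => nQ; apply: np; rewrite pE; apply/rfrac_invertible.
    exists n.
    have Ssn : S (s ^+ n) by exact: mulsetX.
    have -> : p ^+ n *: frac S h 1 = rfrac S 1 (s ^+ n) *: frac S (r ^+ n *: h) 1.
      by rewrite pE rfracX // !fracZ // scale1r.
    apply: spanZ; first exact: ideal_dvdD.
    apply: span_frac1 gn => [r'|w Kw]; first exact: dvdD_frac1.
    by rewrite /= loc_mapE // Kw frac0.
move=> /good_frac1 [x [s [Ss gx /frac_eq -/(_ S1 Ss) [u Su E]]]].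
apply: (mulsetM Su Ss); exists 1%N; rewrite expr1 E.
exact: goodZ.
Qed.


Lemma span_image_lift z : span D K1 z -> exists2 d, span D T2 d & f2 d = z.
Proof.
elim=> [|r w x Dr /exact1 [g <-] _ [d Sd <-]].
  by exists 0; [exact: span0|exact: linear0].
by exists (r *: g + d); [exact: spanS|exact: linearP].
Qed.

Lemma image_in_ker g : K1 (f2 g). Proof. by apply/exact1; exists g. Qed.

(** Lift c to g and a c to d in D F2.  Then a g - d is in K2, and because this is
    not an obstruction g can be corrected by an element of K2 so that a g falls
    into D F2, where flatness of F2 applies. *)
Lemma colon_ker a c : K1 c -> span D K1 (a *: c) -> span (fun r => D (a * r)) K1 c.
Proof.
move=> /exact1 [g <-] /span_image_lift [d Sd dE].
have Kh : K2 (a *: g - d) by rewrite linearB linearZ /= dE subrr.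
have Sh : span (dvdD a) T2 (a *: g - d).
  by apply: span_dvdD_comp => //; exact: spanN.
have [//|k [e [Kk Se E]]] := span_dvdD_decomp _ (good_local Kh Sh).
have : span (fun r => D (a * r)) T2 (g - k).
  apply: eqflat_sqcolon => //; have -> : a *: (g - k) = e + d.
    by rewrite scalerBr; apply/eqP; rewrite subr_eq -addrA [d + _]addrC addrA
      [e + _]addrC -E subrK.
  by apply: spanD => //; apply: span_mono Se.
have -> : f2 g = f2 (g - k) by rewrite linearB Kk subr0.
apply: span_map; first exact: linearP.
by move=> w _; exact: image_in_ker.
Qed.

(** Over the chain ring R / D one coefficient of a relation divides the others, so
    a relation amounts to v b in D K1 for a single b, which is [colon_ker]. *)
Lemma ker_eqflat_mod : eqflat_mod D K1.
Proof.
move=> I v c Kc Sc.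
have [i|I0] := pickP (fun _ : I => true); last first.
  exists void, (fun _ _ => 0), (fun _ => 0).
  by split; [case|move=> i; have := I0 i|case].
have [i0 i0P] := dvdD_max gR lR v i.
have /choice [q0 q0P] := i0P.
pose q i := if i == i0 then 1 else q0 i.
have qP i' : D (v i' - v i0 * q i').
  rewrite /q; case: eqP => [->|_]; last exact: q0P.
  by rewrite mulr1 subrr; exact: sqzero0.
pose b := \sum_i q i *: c i.
have Kb : K1 b by exact: (@submod_sum _ _ K1 _ _ _ _ (submod_ker f1) Kc).
have : span D K1 (v i0 *: b).
  have -> : v i0 *: b = \sum_i v i *: c i - \sum_i (v i - v i0 * q i) *: c i.
    rewrite -sumrB scaler_sumr; apply: eq_bigr => j _.
    by rewrite -scalerBl subKr scalerA.
  by apply: spanB => //; apply: span_sum => j; exact: span_gen.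
move=> /(colon_ker Kb) /spanP [L [r [z [Dr Kz bE]]]].
have cE : c i0 = b - \sum_(j | j != i0) q j *: c j.
  by rewrite /b (bigD1 i0) //= /q eqxx scale1r addrK.
(* c i0 is replaced by b, which is then expressed through the z l. *)
exists (I + L)%type, (fun i j => match j with
    | inl i' => if i == i0 then (if i' == i0 then 0 else - q i') else (i == i')%:R
    | inr l => if i == i0 then r l else 0 end),
  (fun j => match j with inl i' => c i' | inr l => z l end); split.
- by case.
- move=> j; rewrite big_sumType /=; case: (eqVneq j i0) => [->|ji0].
    rewrite {1}cE bE addrC; congr (_ + _).
    rewrite -sumrN big_mkcond /=; apply: eq_bigr => k _.
    by case: eqP => _; rewrite ?scale0r ?scaleNr.
  rewrite [X in _ + X]big1 ?addr0 => [|l _]; last by rewrite scale0r.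
  by rewrite sum_delta.
- case=> [k|l].
    rewrite (bigD1 i0) //= eqxx; case: (eqVneq k i0) => [->|ki0].
      rewrite mulr0 add0r big1; first exact: sqzero0.
      by move=> j /negPf->; rewrite mulr0.
    rewrite (bigD1 k) //= (negPf ki0) eqxx mulr1 big1 ?addr0.
      by rewrite mulrN addrC; exact: qP.
    by move=> j /andP [/negPf-> /negPf->]; rewrite mulr0.
  rewrite (bigD1 i0) //= eqxx big1 ?addr0; first exact: Dr.
  by move=> j /negPf->; rewrite mulr0.
Qed.

(** Lift the relation to F2.  The error is in K2 cap D F2 = D K2, so after adding
    terms e_t k_t with k_t in K2 it is a relation in F2, which is trivialised
    there.  Applying f2 leaves the relations f2(k_t) = 0, trivialised modulo D by
    [ker_eqflat_mod]; multiplied by the e_t in D, these become exact. *)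
Lemma ker_trivialise_sqzero (I : finType) (d : I -> R) (c : I -> F1) :
  (forall i, D (d i)) -> (forall i, K1 (c i)) -> \sum_i d i *: c i = 0 ->
  exists (J : finType) (v : I -> J -> R) (w : J -> F1),
    [/\ forall j, K1 (w j), forall i, c i = \sum_j v i j *: w j &
        forall j, \sum_i d i * v i j = 0].
Proof.
move=> Dd Kc dc.
have /choice [g gE] : forall i, exists g, f2 g = c i by move=> i; exact/exact1.
have Kh : K2 (\sum_i d i *: g i).
  by rewrite linear_sum -[RHS]dc; apply: eq_bigr => i _; rewrite linearZ gE.
have Sh : span D T2 (\sum_i d i *: g i) by apply: span_sum => i; exact: span_gen.
have /spanP [T [e [k [De Kk hE]]]] := span_sqzero_ker gR lR flatK Kh Sh.
have [||J [v [w [_ xE vE]]]] := @eqflat_trivialise _ _ T2 (I + T)%type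
  (fun s => match s with inl i => d i | inr t => - e t end)
  (fun s => match s with inl i => g i | inr t => k t end) flat2.
- by [].
- rewrite big_sumType /= hE -big_split /= big1 // => t _.
  by rewrite scaleNr subrr.
have [|t|L [u [z [Kz wE Du]]]] := eqflat_mod_finite_system
    (a := fun t j => v (inr t) j) (x := fun j => f2 (w j)) idD ker_eqflat_mod.
- by move=> j; exact: image_in_ker.
- rewrite (_ : \sum_j _ = 0); first exact: span0.
  rewrite -[RHS](Kk t) (xE (inr t)) linear_sum.
  by apply: eq_bigr => j _; rewrite linearZ.
exists L, (fun i l => \sum_j v (inl i) j * u j l), z; split=> // [i|l].
  rewrite -gE (xE (inl i)) linear_sum.
  under eq_bigr do rewrite linearZ /= wE.
  by rewrite sum_scale_exchange.
rewrite sum_mul_exchange.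
have vjE j : \sum_i d i * v (inl i) j = \sum_t e t * v (inr t) j.
  have := vE j; rewrite big_sumType /= => /eqP; rewrite addr_eq0 => /eqP->.
  by rewrite -sumrN; apply: eq_bigr => t _; rewrite mulNr opprK.
under eq_bigr do rewrite vjE.
rewrite -sum_mul_exchange big1 // => t _.
exact: sqzero_mul.
Qed.

(** A relation is trivialised modulo D first, and the relations with
    coefficients in D that remain are trivialised by [ker_trivialise_sqzero]. *)
Lemma eqflat_ker_local : eqflat K1.
Proof.
apply: eqflatI => I a c Kc ac.
have [|J [v [w [Kw cE Dav]]]] := ker_eqflat_mod Kc (a := a).
  by rewrite ac; exact: span0.
have [|L [u [z [Kz wE uE]]]] := ker_trivialise_sqzero Dav Kw.
  by rewrite -sum_scale_exchange -[RHS]ac; apply: eq_bigr => i _; rewrite cE.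
exists L, (fun i l => \sum_j v i j * u j l), z; split=> // [i|l].
  by rewrite cE; under eq_bigr do rewrite wE; rewrite sum_scale_exchange.
by rewrite sum_mul_exchange.
Qed.

End LocalObstruction.

(** * From local to global *)

Section MaximalIdeals.
Local Open Scope ring_scope.
Local Open Scope classical_set_scope.
Variable R : comPzRingType.

(** Zorn's lemma is applied to sets X for which X together with I is a proper
    ideal, so that the union of the empty chain is admissible. *)
Lemma exists_maximal_ideal (I : set R) : is_ideal I -> ~ I 1 ->
  exists2 M, maximal_ideal M & I `<=` M.
Proof.
move=> iI nI1; pose P (X : set R) := is_ideal (X `|` I) /\ ~ (X `|` I) 1.
have [F FP Ftot|A [[iA nA1] Amax]] := @Zorn_bigcup R P.
  have [[X0 FX0]|F0] := EM (exists X, F X); last first.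
    rewrite (_ : \bigcup_(X in F) X = set0) ?/P ?set0U //.
    by apply/seteqP; split=> // x [X FX _]; apply: F0; exists X.
  split; last by move=> [[X FX X1]|//]; apply: (proj2 (FP _ FX)); left.
  split=> [|x y|a x].
  - by right; case: iI.
  - have lift X z : F X -> (X `|` I) z -> (\bigcup_(X in F) X `|` I) z.
      by move=> FX [Xz|Iz]; [left; exists X|right].
    have inX z : (\bigcup_(X in F) X `|` I) z -> exists2 X, F X & (X `|` I) z.
      by move=> [[X FX Xz]|Iz]; [exists X => //; left|exists X0 => //; right].
    move=> /inX [X FX Xx] /inX [Y FY Yy].
    have [XY|YX] := Ftot _ _ FX FY.
      apply: (lift Y) => //; case: (FP _ FY) => -[_ YD _] _; apply: YD => //.
      by case: Xx => [/XY|]; [left|right].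
    apply: (lift X) => //; case: (FP _ FX) => -[_ XD _] _; apply: XD => //.
    by case: Yy => [/YX|]; [left|right].
  - move=> [[X FX Xx]|Ix]; last by right; case: iI => _ _; apply.
    case: (FP _ FX) => -[_ _ XM] _; case: (XM a x); [by left| |by right].
    by move=> Xax; left; exists X.
exists (A `|` I); last by move=> x; right.
split=> //; first by move=> E; apply: nA1; rewrite E.
move=> J iJ AJ; have [J1|nJ1] := EM (J 1).
  right; apply/seteqP; split=> // x _; rewrite -[x]mulr1.
  by case: iJ => _ _; apply.
left; have JI : J `|` I = J.
  by apply/seteqP; split=> [x [//|Ix]|x]; [apply: AJ; right|left].
have PJ : P J by rewrite /P JI.
have AJ' : A `<=` J by move=> x Ax; apply: AJ; left.
apply/seteqP; split=> //; have [JA|nJA] := EM (J `<=` A).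
  by move=> x /JA; left.
by case: (Amax J) => //; split.
Qed.

Lemma maximal_ideal1 (M : set R) : maximal_ideal M -> ~ M 1.
Proof.
move=> [[_ _ MM] MT _] M1; apply: MT; apply/seteqP; split=> // x _.
by rewrite -[x]mulr1; exact: MM.
Qed.

Lemma maximal_ideal_prime (M : set R) x y : maximal_ideal M ->
  ~ M x -> ~ M y -> ~ M (x * y).
Proof.
move=> mM nx ny Mxy; have [[M0 MD MM] _ max] := mM.
pose J : set R := [set z | exists m r, M m /\ z = m + x * r].
have iJ : is_ideal J.
  split=> [|a b [m [r [Mm ->]]] [n [s [Mn ->]]]|a b [m [r [Mm ->]]]].
  - by exists 0, 0; rewrite mulr0 addr0.
  - by exists (m + n), (r + s); split; [exact: MD|ring].
  - by exists (a * m), (a * r); split; [exact: MM|ring].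
have MJ : M `<=` J by move=> m Mm; exists m, 0; rewrite mulr0 addr0.
have Jx : J x by exists 0, 1; rewrite mulr1 add0r.
have [E|E] := max J iJ MJ; first by apply: nx; rewrite -E.
have [m [r [Mm E1]]] : J 1 by rewrite E.
apply: ny; have -> : y = y * m + r * (x * y) by rewrite -[y in LHS]mulr1 E1; ring.
by apply: MD; exact: MM.
Qed.

End MaximalIdeals.

Section Global.
Local Open Scope ring_scope.
Variables (R : comPzRingType) (gR : degree_one_gaussian R).
Variables (F2 F1 F0 : lmodType R) (f2 : {linear F2 -> F1}) (f1 : {linear F1 -> F0}).
Local Notation K2 := (fun x : F2 => f2 x = 0).
Local Notation K1 := (fun x : F1 => f1 x = 0).
Hypotheses (flat2 : eqflat (fun _ : F2 => True)) (flat1 : eqflat (fun _ : F1 => True))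
  (flat0 : eqflat (fun _ : F0 => True)) (flatK : eqflat K2).
Hypothesis exact1 : forall y, f1 y = 0 <-> exists x, f2 x = y.

(** For a relation sum a_i c_i = 0 in ker f1, the elements s such that s c has a
    trivialisation form an ideal.  By the local case, clearing denominators, it is
    contained in no maximal ideal. *)
Theorem eqflat_ker : eqflat K1.
Proof.
apply: eqflatI => I a c Kc ac.
pose A s := exists (J : finType) (v : I -> J -> R) (w : J -> F1),
  [/\ forall j, K1 (w j), forall i, s *: c i = \sum_j v i j *: w j &
      forall j, \sum_i a i * v i j = 0].
suff : A 1.
  move=> [J [v [w [Kw cE av]]]]; exists J, v, w; split=> // i.
  by rewrite -cE scale1r.
have iA : is_ideal A.
  split=> [|x y [J [v [w [Kw cE av]]]] [L [u [z [Kz cE' au]]]]|x y [J [v [w [Kw cE av]]]]].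
  - exists void, (fun _ _ => 0), (fun _ => 0); split; [by case| |by case].
    by move=> i; rewrite big_pred0 ?scale0r //; case.
  - exists (J + L)%type, (fun i => sum_fun (v i) (u i)), (sum_fun w z); split.
    + by case.
    + by move=> i; rewrite big_sumType /= scalerDl cE cE'.
    + by case.
  - exists J, (fun i j => x * v i j), w; split=> // [i|j].
      by rewrite -scalerA cE scaler_sumr; apply: eq_bigr => j _; rewrite scalerA.
    transitivity (x * \sum_i a i * v i j); last by rewrite av mulr0.
    by rewrite mulr_sumr; apply: eq_bigr => i _; ring.
apply: contrapT => nA1.
have [M mM AM] := exists_maximal_ideal iA nA1.
have M1 := maximal_ideal1 mM.
pose S := MulSet (mulset_pred := fun r => ~ M r) M1
  (fun x y => maximal_ideal_prime mM (x := x) (y := y)).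
have [[M0 MD MM] _ _] := mM.
have S0 : ~ S 0 by apply.
have SM x y : S (x * y) -> S x by move=> nM Mx; apply: nM; rewrite mulrC; exact: MM.
have SD x y : S (x + y) -> S x \/ S y.
  by move=> nM; apply: contrapT => /not_orP [/contrapT Mx /contrapT My]; apply: nM; exact: MD.
have gS := loc_gaussian (S := S) gR; have lS := loc_is_local S0 SM SD.
have S1 := mulset1 S.
have flatK1 : eqflat (fun z => loc_map S f1 z = 0).
  exact: (@eqflat_ker_local _ gS lS _ _ _ (loc_map S f2) (loc_map S f1)
    (eqflatT_loc flat2) (eqflatT_loc flat1) (eqflatT_loc flat0)
    (eqflat_loc_ker (S := S) flatK) (loc_exact exact1 (S := S))).
have [i||J [alpha [omega [Komega cE av]]]] := eqflat_trivialise
    (a := fun i => rfrac S (a i) 1) (x := fun i => frac S (c i) 1) flatK1.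
- by rewrite /= loc_mapE // Kc frac0.
- under eq_bigr do rewrite frac_den1 //.
  by rewrite frac_sum // ac frac0.
have [j|t [w [St Kw wE]]] := @loc_pred_common _ S _ K1 J omega (submod_ker f1).
  by apply/loc_map_ker.
have [s [v' [Ss vE]]] := rfrac_common (fun p : I * J => alpha p.1 p.2).
pose v i j := v' (i, j).
have {}vE i j : alpha i j = rfrac S (v i j) s by exact: (vE (i, j)).
have Sst : S (s * t) by exact: mulsetM.
have /choice [u uP] : forall i, exists u,
    S u /\ (u * (s * t)) *: c i = u *: \sum_j v i j *: w j.
  move=> i; have := cE i; under eq_bigr do rewrite vE wE fracZ //.
  rewrite frac_sum // => /frac_eq -/(_ S1 Sst) [u Su E].
  by exists u; rewrite E mulr1.
have /choice [u' u'P] : forall j, exists u, S u /\ u * \sum_i a i * v i j = 0.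
  move=> j; have := av j; under eq_bigr do rewrite vE rfracM // mul1r.
  by rewrite rfrac_sum // => /(rfrac_eq0 _ Ss) [u0 Su E]; exists u0.
pose U := (\prod_i u i) * \prod_j u' j.
have SU : S U by apply: mulsetM; apply: mulset_prod => k; [case: (uP k)|case: (u'P k)].
apply: (mulsetM SU Sst); apply: AM.
exists J, (fun i j => U * v i j), w; split=> // [i|j].
  have [_ E] := uP i; rewrite /U (bigD1 i) //=.
  set p := \prod_(k | _) _; set q := \prod_j _.
  transitivity ((p * q) *: ((u i * (s * t)) *: c i)).
    by rewrite scalerA; congr (_ *: _); ring.
  rewrite E scalerA scaler_sumr; apply: eq_bigr => j _.
  by rewrite scalerA; congr (_ *: _); ring.
have [_ E] := u'P j.
have -> : U = (\prod_i u i) * (\prod_(k | k != j) u' k) * u' j.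
  by rewrite /U [X in _ * X](bigD1 j) //= [u' j * _]mulrC mulrA.
move: (_ * \prod_(k | _) _) => p.
transitivity (p * (u' j * \sum_i a i * v i j)); last by rewrite E mulr0.
by rewrite mulrA mulr_sumr; apply: eq_bigr => i _; ring.
Qed.

End Global.

(** * Flatness by tensor products and by equations *)

Section Submodules.
Local Open Scope ring_scope.
Variables (R : comPzRingType) (M : lmodType R).

Record submodule := Submodule {
  submodule_pred :> M -> Prop;
  submoduleP : is_submod submodule_pred }.

Variable K : submodule.

Definition in_submodule : {pred M} := fun x => `[< K x >].

Fact in_submodule_closed : submod_closed in_submodule.
Proof.
have [K0 KD KZ] := submoduleP K; split; first exact/asboolP.
by move=> a x y /asboolP Kx /asboolP Ky; apply/asboolP; apply: KD => //; exact: KZ.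
Qed.

HB.instance Definition _ := GRing.isSubmodClosed.Build R M in_submodule in_submodule_closed.

Definition submod : Type := {x | in_submodule x}.
HB.instance Definition _ := SubType.on submod.
HB.instance Definition _ := Choice.on submod.
HB.instance Definition _ := [SubChoice_isSubLmodule of submod by <:].

Definition submod_incl (x : submod) : M := val x.
Fact submod_incl_linear : linear submod_incl.
Proof. by []. Qed.
HB.instance Definition _ := GRing.isLinear.Build R submod M *:%R submod_incl submod_incl_linear.

Lemma submod_inclP (x : submod) : K (submod_incl x).
Proof. exact: (elimT (asboolP _) (valP x)). Qed.

Lemma submod_incl_inj : injective submod_incl.
Proof. exact: val_inj. Qed.

Definition submod_mk x (Kx : K x) : submod := exist _ x (introT (asboolP _) Kx).
Lemma submod_mkK x (Kx : K x) : submod_incl (submod_mk Kx) = x.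
Proof. by []. Qed.

Lemma eqflat_submod : eqflat (fun _ : submod => True) <-> eqflat K.
Proof.
split=> fK; apply: eqflatI => I a x Kx ax.
  have [//||J [v [w [_ xE av]]]] := eqflat_trivialise (a := a)
      (x := fun i => submod_mk (Kx i)) fK.
    apply: submod_incl_inj; rewrite linear0 linear_sum -[RHS]ax.
    by apply: eq_bigr => i _; rewrite linearZ.
  exists J, v, (fun j => submod_incl (w j)); split=> // [j|i]; first exact: submod_inclP.
  by rewrite -[LHS](submod_mkK (Kx i)) xE linear_sum; apply: eq_bigr => j _; rewrite linearZ.
have [i||J [v [w [Kw xE av]]]] := eqflat_trivialise (a := a)
    (x := fun i => submod_incl (x i)) fK.
- exact: submod_inclP.
- rewrite -[RHS](linear0 submod_incl) -[in RHS]ax linear_sum.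
  by apply: eq_bigr => i _; rewrite linearZ.
exists J, v, (fun j => submod_mk (Kw j)); split=> // i.
apply: submod_incl_inj; rewrite xE linear_sum.
by apply: eq_bigr => j _; rewrite linearZ.
Qed.

End Submodules.

Section TensorCriterion.
Local Open Scope ring_scope.
Variables (R : comPzRingType) (M : lmodType R).
Local Notation all_of := (fun _ : M => True).

Lemma tens_mk0l (N : lmodType R) (n : N) : tens_mk (0 : M) n = 0.
Proof. by rewrite -(scale0r (0 : M)) tens_mkZl scale0r. Qed.

Lemma tens_mk0r (N : lmodType R) (m : M) : tens_mk m (0 : N) = 0.
Proof. by rewrite -(scale0r (0 : N)) tens_mkZr scale0r. Qed.

Lemma tens_mk_suml (N : lmodType R) (T : finType) (m : T -> M) (n : N) :
  tens_mk (\sum_t m t) n = \sum_t tens_mk (m t) n.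
Proof.
apply: (big_morph (fun m => tens_mk m n)); last exact: tens_mk0l.
by move=> x y; exact: tens_mkDl.
Qed.

(** The element sum x_i (x) a_i of M (x) A, with A the ideal generated by the a_i,
    maps to zero in M, hence is zero.  The list of steps showing this is turned
    into a trivialisation: choosing coordinates rho(n) in R^I of every n in A, a
    formal sum of pairs (m, n) is sent to the family sum rho(n)_i m, and each
    step changes this family by one that is trivial in the sense of [syz]. *)
Lemma flat_eqflat : flat M -> eqflat all_of.
Proof.
move=> fM; apply: eqflatI => I a x _ ax.
pose A (y : R^o) := exists r : I -> R, y = \sum_i r i * a i :> R.
have sA : is_submod A.
  split=> [|_ _ [r ->] [s ->]|b _ [r ->]].
  - by exists (fun _ => 0); rewrite big1 // => i _; rewrite mul0r.
  - exists (fun i => r i + s i); rewrite -big_split.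
    by apply: eq_bigr => i _; rewrite mulrDl.
  - exists (fun i => b * r i); rewrite /GRing.scale /= mulr_sumr.
    by apply: eq_bigr => i _; rewrite mulrA.
pose N := submod (Submodule sA).
have Aa i : A (a i).
  exists (fun k => (k == i)%:R); rewrite (bigD1 i) //= eqxx mul1r big1 ?addr0 //.
  by move=> k /negPf->; rewrite mul0r.
pose alpha i : N := @submod_mk R R^o (Submodule sA) (a i) (Aa i).
pose s := [seq (x i, alpha i) | i <- enum I].
have /choice [rho rhoP] : forall n : N, exists r : I -> R,
    (submod_incl n : R) = \sum_i r i * a i.
  by move=> n; exact: (@submod_inclP R R^o (Submodule sA) n).
have s0 : tens_eq s [::].
  apply/tens_classP; apply: (fM N R^o (@submod_incl R R^o (Submodule sA))).
    exact: submod_incl_inj.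
  rewrite [RHS](_ : _ = 0); last exact: linear0.
  rewrite tens_classE linear_sum big_map big_enum /=.
  transitivity (tens_mk (\sum_i a i *: x i) (1 : R^o)); last by rewrite ax tens_mk0l.
  rewrite tens_mk_suml; apply: eq_bigr => i _.
  rewrite tensor_map_mk tens_mkZl -tens_mkZr; congr tens_mk.
  by rewrite /GRing.scale /= mulr1.
pose syz (y : I -> M) := exists (J : finType) (v : I -> J -> R) (w : J -> M),
  (forall i, y i = \sum_j v i j *: w j) /\ forall j, \sum_i a i * v i j = 0.
have syzD y z : syz y -> syz z -> syz (fun i => y i + z i).
  move=> [J [v [w [yE av]]]] [L [u [w' [zE au]]]].
  exists (J + L)%type, (fun i => sum_fun (v i) (u i)), (sum_fun w w'); split.
    by move=> i; rewrite big_sumType /= yE zE.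
  by case.
have syzN y : syz y -> syz (fun i => - y i).
  move=> [J [v [w [yE av]]]]; exists J, (fun i j => - v i j), w; split=> [i|j].
    by rewrite yE -sumrN; apply: eq_bigr => j _; rewrite scaleNr.
  by under eq_bigr do rewrite mulrN; rewrite sumrN av oppr0.
have syz_eq y z : syz y -> y =1 z -> syz z by move=> + /funext<-.
have syz1 (r : I -> R) m : \sum_i a i * r i = 0 -> syz (fun i => r i *: m).
  move=> ar; exists unit, (fun i _ => r i), (fun _ => m); split=> // i.
  by rewrite sum_unit.
have syz0 : syz (fun _ => 0).
  apply: (syz_eq _ _ (syz1 (fun _ => 0) 0 _)) => [|i]; last by rewrite scale0r.
  by rewrite big1 // => i _; rewrite mulr0.
have rhoD n n' : \sum_i a i * (rho n i + rho n' i - rho (n + n') i) = 0.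
  transitivity ((submod_incl n : R) + submod_incl n' - submod_incl (n + n')).
    by rewrite !rhoP -big_split -sumrB; apply: eq_bigr => k _ /=; ring.
  by apply/eqP; rewrite subr_eq0; apply/eqP.
have rhoZ b n : \sum_i a i * (rho n i * b - rho (b *: n) i) = 0.
  transitivity (b * (submod_incl n : R) - submod_incl (b *: n)).
    by rewrite !rhoP mulr_sumr -sumrB; apply: eq_bigr => k _ /=; ring.
  by apply/eqP; rewrite subr_eq0; apply/eqP.
pose e (t : seq (M * N)) i := \sum_(p <- t) rho p.2 i *: p.1.
have eP t u : tens_eq t u -> syz (fun i => e t i - e u i).
  elim=> {t u} [t|t u _ H|t u v _ H1 _ H2|t t' u u' _ H1 _ H2|t u|n|m m' n|m n n'|b m n].
  - by apply: syz_eq syz0 _ => i; rewrite subrr.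
  - by apply: syz_eq (syzN _ H) _ => i; rewrite opprB.
  - by apply: syz_eq (syzD _ _ H1 H2) _ => i; rewrite addrA subrK.
  - apply: syz_eq (syzD _ _ H1 H2) _ => i.
    by rewrite /e !big_cat /= opprD addrACA.
  - by apply: syz_eq syz0 _ => i; rewrite /e !big_cat /= addrC subrr.
  - by apply: syz_eq syz0 _ => i; rewrite /e big_seq1 big_nil /= scaler0 subrr.
  - apply: syz_eq syz0 _ => i.
    by rewrite /e !big_cons !big_nil /= scalerDr !addr0 subrr.
  - apply: syz_eq (syzN _ (syz1 _ m (rhoD n n'))) _ => i.
    rewrite /e !big_cons !big_nil /= !addr0 scalerBl scalerDl opprB.
    by rewrite opprD.
  - apply: syz_eq (syz1 _ m (rhoZ b n)) _ => i.
    by rewrite /e !big_cons !big_nil /= !addr0 scalerBl scalerA.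
have : syz (fun i => x i - e s i).
  exists I, (fun i i' => (i == i')%:R - rho (alpha i') i), x; split=> [i|i'].
    under eq_bigr do rewrite scalerBl; rewrite sumrB; congr (_ - _).
      by rewrite sum_delta.
    by rewrite /e /s big_map big_enum.
  under eq_bigr do rewrite mulrBr; rewrite sumrB (bigD1 i') //= eqxx mulr1.
  rewrite big1 ?addr0 => [|k /negPf->]; last by rewrite mulr0.
  rewrite [X in _ - X](eq_bigr (fun i => rho (alpha i') i * a i)) => [|k _].
    by rewrite -rhoP subrr.
  by rewrite mulrC.
move=> /syzD -/(_ _ (eP _ _ s0)) [J [v [w [xE av]]]].
exists J, v, w; split=> // i; rewrite -xE.
by rewrite /e big_nil subr0 subrK.
Qed.

Section Converse.
Variable N : lmodType R.

Definition combine (J : finType) (w : J -> M) (p : (J -> R) * N) : M * N :=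
  (\sum_j p.1 j *: w j, p.2).
Definition weight (J : finType) (ts : seq ((J -> R) * N)) (j : J) : N :=
  \sum_(p <- ts) p.1 j *: p.2.
Definition refine (J L : finType) (u : J -> L -> R) (p : (J -> R) * N) : (L -> R) * N :=
  ((fun l => \sum_j p.1 j * u j l), p.2).

Lemma combine_refine (J L : finType) (u : J -> L -> R) (w : J -> M) (z : L -> M) ts :
  (forall j, w j = \sum_l u j l *: z l) ->
  [seq combine w p | p <- ts] = [seq combine z p | p <- [seq refine u p | p <- ts]].
Proof.
move=> wE; rewrite -map_comp; apply: eq_map => p; rewrite /combine /=; congr pair.
by rewrite -sum_scale_exchange; apply: eq_bigr => j _; rewrite wE.
Qed.

Lemma weight_refine (J L : finType) (u : J -> L -> R) ts l :
  weight [seq refine u p | p <- ts] l = \sum_j u j l *: weight ts j.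
Proof.
rewrite /weight big_map /=; under [RHS]eq_bigr do rewrite scaler_sumr.
rewrite exchange_big /=; apply: eq_bigr => p _; rewrite scaler_suml.
by apply: eq_bigr => j _; rewrite scalerA mulrC.
Qed.

(** When M is flat this describes equality in M (x) N: the left-hand sides of two
    formal sums are written in common elements w_j, and the right-hand sides
    collected at each w_j agree.  Equality in this form is reflected by injective
    maps on N. *)
Definition evidently_equal (s t : seq (M * N)) : Prop :=
  exists (J : finType) (w : J -> M) (ts tt : seq ((J -> R) * N)),
    [/\ s = [seq combine w p | p <- ts], t = [seq combine w p | p <- tt] &
        forall j, weight ts j = weight tt j].

Lemma expressible (s : seq (M * N)) : exists (J : finType) (w : J -> M) ts,
  s = [seq combine w p | p <- ts].
Proof.
elim: s => [|[m n] s [J [w [ts ->]]]].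
  by exists void, (fun _ => 0), [::].
exists (J + unit)%type, (sum_fun w (fun _ => m)),
  ((sum_fun (fun _ => 0) (fun _ => 1), n) ::
   [seq refine (fun j => sum_fun (fun j' => (j == j')%:R) (fun _ => 0)) p | p <- ts]).
rewrite [RHS]/=; congr (_ :: _).
  rewrite /combine /= big_sumType /= sum_unit scale1r big1 ?add0r // => j _.
  by rewrite scale0r.
apply: combine_refine => j; rewrite big_sumType /= sum_unit scale0r addr0.
by rewrite sum_delta.
Qed.

Lemma evidently_equal_refl s : evidently_equal s s.
Proof. by have [J [w [ts ->]]] := expressible s; exists J, w, ts, ts. Qed.

Lemma evidently_equal_sym s t : evidently_equal s t -> evidently_equal t s.
Proof. by move=> [J [w [ts [tt [-> -> E]]]]]; exists J, w, tt, ts; split. Qed.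

Lemma evidently_equal_cat s s' t t' :
  evidently_equal s s' -> evidently_equal t t' -> evidently_equal (s ++ t) (s' ++ t').
Proof.
move=> [J [w [ts [ts' [-> -> E]]]]] [L [z [tt [tt' [-> -> E']]]]].
pose l j : J + L -> R := sum_fun (fun k => (j == k)%:R) (fun _ => 0).
pose r j : J + L -> R := sum_fun (fun _ => 0) (fun k => (j == k)%:R).
pose y : J + L -> M := sum_fun w z.
have wE j : w j = \sum_k l j k *: y k.
  rewrite big_sumType /= sum_delta [X in _ + X]big1 ?addr0 // => k _.
  by rewrite scale0r.
have zE j : z j = \sum_k r j k *: y k.
  rewrite big_sumType /= sum_delta [X in X + _]big1 ?add0r // => k _.
  by rewrite scale0r.
exists (J + L)%type, y, ([seq refine l p | p <- ts] ++ [seq refine r p | p <- tt]),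
  ([seq refine l p | p <- ts'] ++ [seq refine r p | p <- tt']).
split; [by rewrite map_cat -!(combine_refine _ wE) -!(combine_refine _ zE)..|].
move=> k; rewrite /weight !big_cat -/(weight _ k) -/(weight _ k).
rewrite -!/(weight _ k) !weight_refine.
by congr (_ + _); apply: eq_bigr => j _; rewrite ?E ?E'.
Qed.

(** Transitivity is the step that uses flatness: the two expressions of the middle
    sum, in the w_j and in the w'_j, differ by relations in M, and trivialising
    all of them at once refines both to the same expression. *)
Lemma evidently_equal_trans s t u : eqflat all_of ->
  evidently_equal s t -> evidently_equal t u -> evidently_equal s u.
Proof.
move=> fM [J [w [ts [tt [-> tE E]]]]] [J' [w' [ts' [tt' [tE' -> E']]]]].
have sz : size tt = size ts'.
  by have := congr1 size tE'; rewrite tE !size_map.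
pose p0 := ((fun _ => 0, 0) : (J -> R) * N); pose p0' := ((fun _ => 0, 0) : (J' -> R) * N).
have nthE k : (k < size tt)%N -> combine w (nth p0 tt k) = combine w' (nth p0' ts' k).
  move=> kt; have := congr1 (fun s => nth (0, 0) s k) tE'.
  by rewrite tE !(nth_map p0) // (nth_map p0') // -sz.
pose y : J + J' -> M := sum_fun w w'.
have [||k|L [v [z [_ yE va]]]] := @eqflat_mod_finite_system R M (fun r => r = 0) all_of
    'I_(size tt) (J + J')%type
    (fun k => sum_fun (fun j => (nth p0 tt k).1 j) (fun j => - (nth p0' ts' k).1 j)) y _ fM.
- exact: ideal_zero.
- by [].
- rewrite (_ : \sum_i _ = 0); first exact: span0.
  rewrite big_sumType /=; have [-> _] := nthE k (ltn_ord k).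
  by rewrite -big_split big1 // => j _; rewrite /= scaleNr subrr.
exists L, z, [seq refine (fun j => v (inl j)) p | p <- ts],
  [seq refine (fun j => v (inr j)) p | p <- tt'].
have wE j : w j = \sum_l v (inl j) l *: z l by exact: (yE (inl j)).
have w'E j : w' j = \sum_l v (inr j) l *: z l by exact: (yE (inr j)).
split; [exact: combine_refine|exact: combine_refine|move=> l].
have ttE : [seq refine (fun j => v (inl j)) p | p <- tt] =
    [seq refine (fun j => v (inr j)) p | p <- ts'].
  pose q0 := ((fun _ => 0, 0) : (L -> R) * N).
  apply: (@eq_from_nth _ q0) => [|k]; rewrite !size_map // => kt.
  rewrite (nth_map p0) // (nth_map p0') -?sz // /refine.
  have [_ ->] := nthE k kt; congr pair; apply/funext => l'.
  apply/eqP; rewrite -subr_eq0 -sumrN; apply/eqP.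
  have := va (Ordinal kt) l'; rewrite big_sumType /= => E0; rewrite -[RHS]E0.
  by congr (_ + _); apply: eq_bigr => j _; rewrite mulNr.
rewrite weight_refine; under eq_bigr do rewrite E.
rewrite -(weight_refine (fun j => v (inl j))) ttE !weight_refine.
by apply: eq_bigr => j _; rewrite E'.
Qed.

Lemma tens_eq_evidently s t : eqflat all_of -> tens_eq s t -> evidently_equal s t.
Proof.
move=> fM; elim=> {s t} [s|s t _|s t u _ H1 _|s s' t t' _ H1 _ H2|s t|n|m m' n|m n n'|b m n].
- exact: evidently_equal_refl.
- exact: evidently_equal_sym.
- exact: evidently_equal_trans.
- exact: evidently_equal_cat.
- have [J [w [ts E1]]] := expressible (s ++ t).
  exists J, w, ts, (drop (size s) ts ++ take (size s) ts); split=> // [|j].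
    rewrite map_cat map_drop map_take -E1.
    by rewrite drop_size_cat // take_size_cat.
  by rewrite /weight -[in LHS](cat_take_drop (size s) ts) !big_cat /= addrC.
- exists void, (fun _ => 0), [:: (fun _ => 0, n)], [::]; split=> //.
  by rewrite /= /combine /= big_pred0 //; case.
- exists bool, (fun b => if b then m else m'), [:: (fun _ => 1, n)],
    [:: (fun b : bool => b%:R, n); (fun b : bool => (~~ b)%:R, n)].
  split=> [||b].
  + by rewrite /= /combine big_bool /= !scale1r.
  + by rewrite /= /combine !big_bool /= !scale1r !scale0r addr0 add0r.
  + by rewrite /weight !big_cons !big_nil /= !addr0; case: b; rewrite /= !scale1r !scale0r ?addr0 ?add0r.
- exists unit, (fun _ => m), [:: (fun _ => 1, n + n')],
    [:: (fun _ => 1, n); (fun _ => 1, n')]; split=> [||j].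
  + by rewrite /= /combine /= sum_unit scale1r.
  + by rewrite /= /combine /= sum_unit scale1r.
  + by rewrite /weight !big_cons !big_nil /= !addr0 !scale1r.
- exists unit, (fun _ => m), [:: (fun _ => b, n)], [:: (fun _ => 1, b *: n)]; split=> [||j].
  + by rewrite /= /combine /= sum_unit.
  + by rewrite /= /combine /= sum_unit scale1r.
  + by rewrite /weight !big_seq1 /= scale1r.
Qed.

End Converse.

(** An element killed by the injection f becomes evidently equal to the empty sum:
    the right-hand sides collected at each w_j have image zero under f, hence are
    zero already. *)
Lemma eqflat_flat : eqflat all_of -> flat M.
Proof.
move=> fM N N' f finj x y xy; apply/eqP; rewrite -subr_eq0; apply/eqP.
have {xy} : tensor_map f (x - y) = 0 by rewrite linearB /= xy subrr.
rewrite -(tens_classK (x - y)); move: (repr (x - y)) => s.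
have -> : tensor_map f (tens_class s) = tens_class [seq (p.1, f p.2) | p <- s].
  rewrite !tens_classE linear_sum big_map /=.
  by apply: eq_bigr => p _; rewrite tensor_map_mk.
move=> /tens_classP /(tens_eq_evidently fM) [J [w [ts [tt [E1 E2 E]]]]].
have {}E2 : tt = [::] by case: tt E2 {E}.
have [us [sE tsE]] : exists us : seq ((J -> R) * N), s = [seq combine w p | p <- us] /\
    ts = [seq (p.1, f p.2) | p <- us].
  elim: s ts E1 {E} => [|[m n] s IH] [|[v n'] ts] //=.
    by exists [::].
  move=> [mE nE /IH [us [-> ->]]].
  by exists ((v, n) :: us); rewrite /combine /= mE nE.
have us0 j : weight us j = 0.
  apply: finj; rewrite linear0 /weight linear_sum; have := E j.
  rewrite E2 tsE /weight big_nil big_map => {2}<-.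
  by apply: eq_bigr => p _; rewrite linearZ.
rewrite sE tens_classE big_map /=.
transitivity (\sum_j tens_mk (w j) (weight us j)); last first.
  by apply: big1 => j _; rewrite us0 tens_mk0r.
rewrite /weight.
under [LHS]eq_bigr do rewrite tens_mk_suml.
rewrite exchange_big /=; apply: eq_bigr => j _.
rewrite (big_morph (fun n => tens_mk (w j) n) (@tens_mkDr _ _ _ (w j)) (tens_mk0r _ (w j))).
by apply: eq_bigr => p _; rewrite tens_mkZl tens_mkZr.
Qed.

End TensorCriterion.

(** * Flat dimension over Gaussian rings *)

Section GaussianPairs.
Local Open Scope ring_scope.
Local Open Scope classical_set_scope.

Lemma ideal_gen_ideal (R : comPzRingType) (S : set R) : is_ideal (ideal_gen S).
Proof.
split=> [I [I0 _ _] _ //|x y Sx Sy I iI SI|a x Sx I iI SI]; have [_ ID IM] := iI.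
  by apply: ID; [exact: Sx|exact: Sy].
by apply: IM; exact: Sx.
Qed.

Lemma ideal_gen_sub (R : comPzRingType) (S I : set R) :
  is_ideal I -> S `<=` I -> ideal_gen S `<=` I.
Proof. by move=> iI SI x; apply. Qed.

Lemma ideal_gen_in (R : comPzRingType) (S : set R) x : S x -> ideal_gen S x.
Proof. by move=> Sx I _; apply. Qed.

Lemma content_coef (A : comNzRingType) (f : {poly A}) i : content f f`_i.
Proof.
case: (ltnP i (size f)) => [fi|fi]; first by apply: ideal_gen_in; exact: mem_nth.
by rewrite nth_default //; case: (@ideal_gen_ideal A [set a | a \in polyseq f]).
Qed.

Lemma polynomials_gaussian_pairs (A : comNzRingType) :
  (forall f g : {poly A}, content (f * g) = ideal_mul (content f) (content g)) ->
  degree_one_gaussian A.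
Proof.
move=> gA x y z w.
pose f : {poly A} := x%:P + y%:P * 'X; pose g : {poly A} := z%:P + w%:P * 'X.
have fx : content f x.
  by have := @content_coef A f 0; rewrite !(coefD, coefC, coefCM, coefX) mulr0 addr0.
have gw : content g w.
  by have := @content_coef A g 1; rewrite !(coefD, coefC, coefCM, coefX) mulr1 add0r.
have : content (f * g) (x * w) by rewrite gA; apply: ideal_gen_in; exists x, w.
apply: (@ideal_gen_sub A _
  [set v | exists a b c, v = a * (x * z) + b * (x * w + y * z) + c * (y * w)]).
  split=> [|u v [a [b [c ->]]] [a' [b' [c' ->]]]|d v [a [b [c ->]]]].
  - by exists 0, 0, 0; rewrite !mul0r !addr0.
  - by exists (a + a'), (b + b'), (c + c'); ring.
  - by exists (d * a), (d * b), (d * c); ring.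
have fgE : f * g = (x * z)%:P + (x * w + y * z)%:P * 'X + (y * w)%:P * 'X^2.
  by rewrite /f /g !(polyCD, polyCM); ring.
move=> v /(nthP 0) [i _ <-].
exists (i == 0%N)%:R, (i == 1%N)%:R, (i == 2%N)%:R.
rewrite fgE !(coefD, coefC, coefCM, coefX, coefXn).
by case: i => [|[|[|i]]] /=; ring.
Qed.

(** The zero ring is treated apart, since polynomials need 1 <> 0. *)
Lemma gaussian_pairs (R : comPzRingType) : gaussian R -> degree_one_gaussian R.
Proof.
move=> gR; have [z|nz] := eqVneq (1 : R) 0; last first.
  exact: (@polynomials_gaussian_pairs (nz_ring nz) (gR nz)).
move=> x y z' w; exists 0, 0, 0; have all0 u : u = 0 :> R by rewrite -[u]mul1r z mul0r.
by rewrite [LHS]all0 [RHS]all0.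
Qed.

End GaussianPairs.

Section Resolutions.
Local Open Scope ring_scope.
Variable R : comPzRingType.

Definition kernel (M N : lmodType R) (f : {linear M -> N}) : submodule M :=
  Submodule (submod_ker f).

Lemma flatP (M : lmodType R) : flat M <-> eqflat (fun _ : M => True).
Proof. by split; [exact: flat_eqflat|exact: eqflat_flat]. Qed.

Lemma flat_submodP (M : lmodType R) (K : submodule M) : flat (submod K) <-> eqflat K.
Proof. by rewrite flatP; exact: eqflat_submod. Qed.

Lemma flat_iso (M N : lmodType R) (f : {linear M -> N}) :
  injective f -> (forall y, exists x, f x = y) -> flat M -> flat N.
Proof.
move=> fI fS /flatP fM; apply/flatP/eqflatI => I a y _ ay.
have /choice [x xE] : forall i, exists x, f x = y i by move=> i; exact: fS.
have [//||J [v [w [_ E av]]]] := eqflat_trivialise (a := a) (x := x) fM.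
  apply: fI; rewrite linear0 linear_sum -[RHS]ay.
  by apply: eq_bigr => i _; rewrite linearZ xE.
exists J, v, (fun j => f (w j)); split=> // i.
by rewrite -xE E linear_sum; apply: eq_bigr => j _; rewrite linearZ.
Qed.

(** Resolutions by induction on their length, with syzygies as modules of their
    own; unlike an infinite family of modules and maps, this can be shortened at
    its end. *)
Fixpoint flat_resolved (n : nat) (M : lmodType R) : Prop :=
  if n is n'.+1 then exists (F : lmodType R) (e : {linear F -> M}),
    [/\ flat F, forall y, exists x, e x = y & flat_resolved n' (submod (kernel e))]
  else flat M.

Section Corestriction.
Variables (L M N : lmodType R) (d : {linear L -> M}) (e : {linear M -> N}).
Hypothesis ed0 : forall x, e (d x) = 0.

Definition corestrict (x : L) : submod (kernel e) := submod_mk (K := kernel e) (ed0 x).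
Fact corestrict_linear : linear corestrict.
Proof. by move=> a x y; apply: submod_incl_inj; exact: (linearP d). Qed.
HB.instance Definition _ :=
  GRing.isLinear.Build R L (submod (kernel e)) *:%R corestrict corestrict_linear.
End Corestriction.

Lemma resolution_flat_resolved n (M : lmodType R) :
  has_flat_resolution M n -> flat_resolved n M.
Proof.
elim: n M => [|n IH] M [F [d [e [flF F0 eS ex0 exd]]]].
  apply: (flat_iso _ eS) => // x y xy; apply/eqP; rewrite -subr_eq0; apply/eqP.
  have /ex0 [z zE] : e (x - y) = 0 by rewrite linearB xy subrr.
  by rewrite -zE (F0 1%N isT z) linear0.
exists (F 0%N), e; split=> //; apply: IH.
have ed0 x : e (d 0%N x) = 0 by apply/ex0; exists x.
exists (fun i => F i.+1), (fun i => d i.+1), (corestrict ed0); split.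
- by move=> i; exact: flF.
- by move=> i ni; apply: F0.
- move=> y; have /ex0 [x xE] := submod_inclP y.
  by exists x; apply: submod_incl_inj.
- move=> x; split=> [E|[y <-]].
    by apply/exd; have := congr1 (@submod_incl _ _ _) E; rewrite linear0.
  by apply: submod_incl_inj; rewrite linear0 /=; apply/exd; exists y.
- by move=> i x; exact: exd.
Qed.

Definition zero_module (M : lmodType R) : lmodType R :=
  submod (kernel (idfun : {linear M -> M})).

Lemma zero_moduleE (M : lmodType R) (x : zero_module M) : x = 0.
Proof. by apply: submod_incl_inj; rewrite linear0; exact: (submod_inclP x). Qed.

Lemma flat_zero_module (M : lmodType R) : flat (zero_module M).
Proof.
apply/flatP/eqflatI => I a x _ _.
exists void, (fun _ _ => 0), (fun _ => 0); split=> // i.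
exact: etrans (zero_moduleE _) (esym (zero_moduleE _)).
Qed.

Definition prepend (M : lmodType R) (G : nat -> lmodType R) (i : nat) : lmodType R :=
  if i is j.+1 then G j else M.

Lemma flat_resolved_resolution n (M : lmodType R) :
  flat_resolved n M -> has_flat_resolution M n.
Proof.
elim: n M => [|n IH] M.
  move=> flM; pose Z := zero_module M.
  exists (prepend M (fun _ => Z)).
  exists (fun i => match i return {linear Z -> prepend M (fun _ => Z) i} with
    | 0%N => (\0 : {linear Z -> M}) | _.+1 => (\0 : {linear Z -> Z}) end).
  exists (idfun : {linear M -> M}); split.
  - by case=> [|i]; [exact: flM|exact: flat_zero_module].
  - by case=> // i _; exact: zero_moduleE.
  - by move=> y; exists y.
  - by move=> x; split=> [E|[y <-] //]; exists 0; exact: esym E.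
  - case=> [|i] x; split=> // _; exists 0; exact: etrans (zero_moduleE _) (esym (zero_moduleE _)).
move=> [F [e [flF eS /IH [G [d [e' [flG G0 eS' ex0 exd]]]]]]].
exists (prepend F G).
exists (fun i => match i return {linear G i -> prepend F G i} with
    | 0%N => (@submod_incl _ _ (kernel e) \o e' : {linear G 0%N -> F})
    | j.+1 => d j end).
exists e; split=> //.
- by case.
- by case=> // i; exact: G0.
- move=> x; split=> [ex|[y <-]]; last exact: (submod_inclP (e' y)).
  have [y yE] := eS' (submod_mk (K := kernel e) ex).
  by exists y; rewrite /= yE.
- case=> [|i] x; last exact: exd.
  rewrite -ex0 /=; split=> [E|->]; last exact: linear0.
  by apply: submod_incl_inj; rewrite linear0.
Qed.

Lemma flat_resolvedS n (M : lmodType R) : flat_resolved n M -> flat_resolved n.+1 M.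
Proof.
elim: n M => [|n IH] M.
  move=> flM; exists M, (idfun : {linear M -> M}); split=> //; first by move=> y; exists y.
  exact: flat_zero_module.
by move=> [F [e [flF eS /IH K]]]; exists F, e.
Qed.

(** A resolution of length n > 2 is shortened from its end: by [eqflat_ker] a flat
    third syzygy of some module makes its second syzygy flat. *)
Lemma flat_resolved_two n (M : lmodType R) : degree_one_gaussian R ->
  flat_resolved n M -> flat_resolved 2 M.
Proof.
move=> gR; elim: n M => [|n IH] M; first by move=> H; do 2 apply: flat_resolvedS.
case: n IH => [|n] IH.
  by move=> H; apply: flat_resolvedS.
move=> [F0 [e0 [fl0 e0S /IH [F1 [e1 [fl1 e1S [F2 [e2 [fl2 e2S fl3]]]]]]]]].
exists F0, e0; split=> //; exists F1, e1; split=> //.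
pose f1 : {linear F1 -> F0} := @submod_incl _ _ (kernel e0) \o e1.
pose f2 : {linear F2 -> F1} := @submod_incl _ _ (kernel e1) \o e2.
have kerE1 : (kernel e1 : F1 -> Prop) = (fun x => f1 x = 0).
  apply/funext => x; apply/propext; split=> /= E; first by rewrite E linear0.
  by apply: submod_incl_inj; rewrite linear0.
have kerE2 : (kernel e2 : F2 -> Prop) = (fun x => f2 x = 0).
  apply/funext => x; apply/propext; split=> /= E; first by rewrite E linear0.
  by apply: submod_incl_inj; rewrite linear0.
apply/flat_submodP; rewrite kerE1.
apply: (@eqflat_ker R gR F2 F1 F0 f2 f1); try exact/flatP.
  by rewrite -kerE2; apply/flat_submodP.
move=> y; split=> [fy|[x <-]].
  have Ky : kernel e1 y by rewrite kerE1.
  by have [x xE] := e2S (submod_mk Ky); exists x; rewrite /f2 /= xE.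
have : (kernel e1 : F1 -> Prop) (f2 x) by exact: submod_inclP.
by rewrite kerE1.
Qed.

End Resolutions.

Lemma enat_infP (S : set nat) n : S n ->
  exists2 m, enat_inf S = Some m & S m /\ forall k, S k -> (m <= k)%N.
Proof.
move=> Sn; rewrite /enat_inf; case: pselect => [exS|]; last by case; exists n; exact/asboolP.
case: ex_minnP => m /asboolP Sm min; exists m => //; split=> // k Sk.
by apply: min; exact/asboolP.
Qed.

Lemma enat_inf_Some (S : set nat) m : enat_inf S = Some m ->
  S m /\ forall k, S k -> (m <= k)%N.
Proof.
rewrite /enat_inf; case: pselect => // exS [<-].
case: ex_minnP => k /asboolP Sk min; split=> // j Sj.
by apply: min; exact/asboolP.
Qed.

Lemma gaussian_fd_le2 (R : comPzRingType) (M : lmodType R) :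
  gaussian R -> fd M <> None -> exists2 m, fd M = Some m & (m <= 2)%N.
Proof.
move=> /gaussian_pairs gR; case E : (fd M) => [m|] // _.
have [Mm min] := enat_inf_Some E; exists m => //; apply: min.
by apply: flat_resolved_resolution; apply: flat_resolved_two => //; exact: resolution_flat_resolved Mm.
Qed.

Lemma gaussian_fd_ub (R : comPzRingType) n : gaussian R ->
  (exists M : lmodType R, fd M = Some n) -> (n <= 2)%N.
Proof.
move=> gR [M Mn]; have [|m] := @gaussian_fd_le2 R M gR; first by rewrite Mn.
by rewrite Mn => -[->].
Qed.

Lemma gaussian_Fwd_le2 (R : comPzRingType) : gaussian R -> enat_le (Fwd R) (Some 2).
Proof.
move=> gR; have ub2 n := @gaussian_fd_ub R n gR.
have [m mE [_ min]] := @enat_infP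
  [set b | forall n, (exists M : lmodType R, fd M = Some n) -> (n <= b)%N]%classic 2 ub2.
by rewrite /Fwd /enat_sup mE; exact: min.
Qed.

(** * Chain rings whose maximal ideal is the flat annihilator of an element *)

Section ChainRing.
Local Open Scope ring_scope.
Local Open Scope classical_set_scope.
Variable A : comNzRingType.
Implicit Types a b c p r x y : A.
Local Notation P := (fun a : A => ~ invertible a).

Hypothesis chain : forall a b, (exists c, b = a * c) \/ (exists c, a = b * c).

Lemma chain_noninvM a b : P a -> P (a * b).
Proof. by move=> na [c abc]; apply: na; exists (b * c); rewrite mulrA. Qed.

Lemma chain_ideal_noninv : is_ideal P.
Proof.
split=> [[b]|a b na nb|a b nb]; last by rewrite mulrC; exact: chain_noninvM.
  by rewrite mul0r => /esym/eqP; rewrite oner_eq0.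
have [[c ->]|[c ->]] := chain a b.
  have -> : a + a * c = a * (1 + c) by ring.
  exact: chain_noninvM.
have -> : b * c + b = b * (1 + c) by ring.
exact: chain_noninvM.
Qed.

Lemma chain_local : local_ring A.
Proof.
have iP := chain_ideal_noninv.
have unitT (I : set A) a : is_ideal I -> I a -> invertible a -> I = setT.
  move=> [_ _ IM] Ia [b ab]; apply/seteqP; split=> // x _.
  by rewrite -[x]mulr1 -ab mulrCA; rewrite mulrC; exact: IM.
have PT : (P : set A) <> setT.
  move=> E; have T1 : [set: A] (1 : A) by [].
  by rewrite -E in T1; apply: T1; exists 1; rewrite mulr1.
exists P; split.
  split=> // J iJ PJ; have [[a [Ja ia]]|H] := EM (exists a, J a /\ invertible a).
    by right; exact: unitT Ja ia.
  left; apply/seteqP; split=> // x Jx ix; apply: H; by exists x.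
move=> I [iI IT maxI]; have IP : I `<=` P.
  by move=> a Ia ia; apply: IT; exact: unitT Ia ia.
by case: (maxI P iP IP).
Qed.

Lemma chain_max (T : finType) (r : T -> A) (t : T) :
  exists t0, forall t, exists c, r t = r t0 * c.
Proof.
apply: (total_minimum (le := fun x y => exists c, y = x * c)) t _ _ => // x y z.
by move=> [c ->] [d ->]; exists (c * d); rewrite mulrA.
Qed.

(** Divide f by a coefficient that divides all the others. *)
Lemma chain_primitive (f : {poly A}) : exists a g,
  [/\ f = a *: g, content f a & exists i, invertible g`_i].
Proof.
have [->|f0] := eqVneq f 0.
  exists 0, 1; split; first by rewrite scale0r.
    by have [] := @ideal_gen_ideal A [set a | a \in polyseq (0 : {poly A})].
  by exists 0%N; exists 1; rewrite coef1 mulr1.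
have sf : (0 < size f)%N by rewrite lt0n size_poly_eq0.
have [t0 t0P] := @chain_max 'I_(size f) (fun i => f`_i) (Ordinal sf).
have /choice [c cP] := t0P.
pose g := \poly_(i < size f) (if insub i is Some k then (if k == t0 then 1 else c k) else 0).
exists f`_t0, g; split.
- apply/polyP => i; rewrite coefZ coef_poly; case: ltnP => [fi|fi]; last first.
    by rewrite mulr0 nth_default.
  rewrite insubT /=; case: eqP => [<-|_]; first by rewrite mulr1.
  by rewrite -(cP (Sub i fi)).
- exact: (@content_coef A f).
- exists t0; exists 1; rewrite coef_poly ltn_ord mulr1.
  by rewrite insubT ?ltn_ord //= => H; rewrite (_ : Sub _ _ = t0) ?eqxx //; exact: val_inj.
Qed.

(** Gauss's lemma, with the least indices at which f and g have unit
    coefficients. *)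
Lemma invertible_coefM (f g : {poly A}) :
  (exists i, invertible f`_i) -> (exists j, invertible g`_j) ->
  exists k, invertible (f * g)`_k.
Proof.
have [P0 PD PM] := chain_ideal_noninv.
have least (h : {poly A}) : (exists i, invertible h`_i) ->
    exists i, invertible h`_i /\ forall j, (j < i)%N -> P h`_j.
  move=> [i hi]; have [|n /asboolP hn min] := @ex_minnP (fun i => `[< invertible h`_i >]).
    by exists i; apply/asboolP.
  by exists n; split=> // j jn /asboolP /min; rewrite leqNgt jn.
move=> /least [i [fi fP]] /least [j [gj gP]]; exists (i + j)%N.
apply: contrapT => nk.
have ij : (i < (i + j).+1)%N by rewrite ltnS leq_addr.
have : P (f`_i * g`_j).
  have -> : f`_i * g`_j = (f * g)`_(i + j) +
      (-1) * \sum_(k < (i + j).+1 | k != Ordinal ij) f`_k * g`_(i + j - k).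
    by rewrite coefM (bigD1 (Ordinal ij)) //= addKn mulN1r addrK.
  apply: (PD) => //; apply: (PM); elim/big_ind: _; [exact: P0|exact: PD|move=> k ki].
  have [lt|gt|E] := ltngtP k i.
  - by rewrite mulrC; apply: (PM); exact: fP.
  - by apply: (PM); apply: gP; rewrite ltn_subLR ?ltn_add2r // -ltnS.
  - by case/eqP: ki; exact: val_inj.
apply; case: fi => u fu; case: gj => v gv; exists (u * v).
by rewrite mulrACA fu gv mulr1.
Qed.

Lemma chain_gaussian : gaussian A.
Proof.
apply/gaussian_nzE => f g; apply/seteqP; split.
  apply: ideal_gen_sub; first exact: ideal_gen_ideal.
  move=> _ /(nthP 0) [k _ <-]; rewrite coefM.
  have [I0 ID _] := @ideal_gen_ideal A
    [set z | exists x y, [/\ content f x, content g y & z = x * y]].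
  elim/big_ind: _; [exact: I0|exact: ID|move=> i _; apply: ideal_gen_in].
  by exists f`_i, g`_(k - i); split=> //; exact: (@content_coef A).
have [a [f' [fE _ uf]]] := chain_primitive f.
have [b [g' [gE _ ug]]] := chain_primitive g.
have [k [u uk]] := invertible_coefM uf ug.
have dvd (h h' : {poly A}) c : h = c *: h' -> content h `<=` [set x | exists y, x = c * y].
  move=> hE; apply: ideal_gen_sub.
    split=> [|x y [x' ->] [y' ->]|x y [y' ->]].
    - by exists 0; rewrite mulr0.
    - by exists (x' + y'); rewrite mulrDr.
    - by exists (x * y'); rewrite mulrCA.
  by move=> _ /(nthP 0) [i _ <-]; exists h'`_i; rewrite hE coefZ.
have iC := @ideal_gen_ideal A [set a | a \in polyseq (f * g)].
have Cab : content (f * g) (a * b).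
  have -> : a * b = u * (f * g)`_k.
    by rewrite fE gE -scalerAl -scalerAr scalerA coefZ mulrCA [u * _]mulrC uk mulr1.
  have [_ _ IM] := iC; apply: IM; exact: (@content_coef A).
apply: ideal_gen_sub => // _ [x [y [/(dvd _ _ _ fE) [x' ->] /(dvd _ _ _ gE) [y' ->] ->]]].
have -> : a * x' * (b * y') = (x' * y') * (a * b) by ring.
by have [_ _ IM] := iC; exact: IM.
Qed.

Variable s : A.
Hypothesis s0 : s <> 0.
Hypothesis ss : s * s = 0.
Hypothesis annih_s : forall p, s * p = 0 <-> P p.
(** This is flatness of the maximal ideal for a relation with one term; it
    suffices because finitely many elements of P are multiples of one of them. *)
Hypothesis dense : forall b y, P y -> b * y = 0 ->
  exists c y', [/\ P y', y = c * y' & b * c = 0].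

Lemma chain_total : total_ring_of_quotients A.
Proof.
move=> a rega; apply: contrapT => na; apply: s0; apply: rega.
by rewrite mulr0 mulrC; apply/annih_s.
Qed.

Lemma eqflat_regular : eqflat (fun _ : A^o => True).
Proof.
apply: eqflatI => I a x _ ax.
exists unit, (fun i _ => x i), (fun _ => 1); split=> // i.
by rewrite sum_unit /GRing.scale /= mulr1.
Qed.

Lemma eqflat_maximal : eqflat (fun a : A^o => P a).
Proof.
apply: eqflatI => I a x Px ax.
have [i|I0] := pickP (fun _ : I => true); last first.
  exists void, (fun _ _ => 0), (fun _ => 0); split; [by case|by move=> i; have := I0 i|by case].
have [i0 i0P] := chain_max x i; have /choice [c cE] := i0P.
have [|d [y' [Py' yE bd]]] := @dense (\sum_i a i * c i) (x i0) (Px i0).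
  rewrite mulr_suml -[RHS]ax; apply: eq_bigr => k _.
  by rewrite -mulrA [c k * _]mulrC -cE.
exists unit, (fun i _ => c i * d), (fun _ => y'); split=> // [k|_].
  by rewrite sum_unit /GRing.scale /= cE yE mulrC mulrA.
by under eq_bigr do rewrite mulrA; rewrite -mulr_suml.
Qed.

(** If s = a c with a outside s A, then c is in P, so a kills c and s = 0. *)
Lemma annih_maximal a : (forall p, P p -> a * p = 0) -> exists c, a = s * c.
Proof.
move=> aP; have [//|[c sE]] := chain s a.
have [[d cd]|nc] := EM (invertible c).
  by exists d; rewrite sE -mulrA cd mulr1.
by case: s0; rewrite sE; exact: aP.
Qed.

(** A / s A is realised as the cyclic module generated by the inclusion of P in A,
    since the annihilator of this function is that of P, which is s A. *)
Definition maximal_incl : {a : A | P a} -> A^o := fun q => sval q.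

Definition socle_quotient_pred (h : {a : A | P a} -> A^o) : Prop :=
  exists a : A, h = a *: maximal_incl.

Fact socle_quotient_submod : is_submod socle_quotient_pred.
Proof.
split=> [|_ _ [a ->] [b ->]|a _ [b ->]].
- by exists 0; rewrite scale0r.
- by exists (a + b); rewrite scalerDl.
- by exists (a * b); rewrite scalerA.
Qed.

Definition socle_quotient : lmodType A := submod (Submodule socle_quotient_submod).

Fact generator_in a : socle_quotient_pred (a *: maximal_incl).
Proof. by exists a. Qed.

Definition quotient_map (a : A^o) : socle_quotient :=
  submod_mk (K := Submodule socle_quotient_submod) (generator_in a).
Fact quotient_map_linear : linear quotient_map.
Proof.
by move=> a x y; apply: submod_incl_inj; apply: etrans (scalerDl _ _ _) _; rewrite -scalerA.
Qed.
HB.instance Definition _ :=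
  GRing.isLinear.Build A A^o socle_quotient *:%R quotient_map quotient_map_linear.

Lemma quotient_map0 a : quotient_map a = 0 <-> forall p, P p -> a * p = 0.
Proof.
split=> [E p Pp|aP].
  have : a *: maximal_incl = 0 by have := congr1 (@submod_incl _ _ _) E; rewrite linear0.
  by move=> /(congr1 (fun h => h (exist _ p Pp))).
by apply: submod_incl_inj; rewrite linear0; apply/funext => -[p Pp]; exact: aP.
Qed.

Lemma quotient_map_surj (y : socle_quotient) : exists a, quotient_map a = y.
Proof.
have [a aE] := submod_inclP y; exists a; apply: submod_incl_inj.
by rewrite aE.
Qed.

(** The resolution 0 -> P -> A -> A -> A / s A -> 0 whose middle map is
    multiplication by s, with kernel P. *)
Lemma quotient_resolved : flat_resolved 2 socle_quotient.
Proof.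
exists A^o, quotient_map; split; first by apply/flatP; exact: eqflat_regular.
  exact: quotient_map_surj.
have Ks a : kernel quotient_map (a * s : A^o).
  apply/quotient_map0 => p Pp; rewrite -mulrA; have /annih_s -> := Pp.
  by rewrite mulr0.
pose e (a : A^o) : submod (kernel quotient_map) := submod_mk (K := kernel quotient_map) (Ks a).
have e_lin : linear e.
  move=> a x y; apply: submod_incl_inj.
  change (((a : A) * x + y) * s = a * (x * s) + y * s :> A); ring.
pose eL := GRing.isLinear.Build A A^o (submod (kernel quotient_map)) *:%R e e_lin.
pose E : {linear A^o -> submod (kernel quotient_map)} := HB.pack e eL.
exists A^o, E; split; first by apply/flatP; exact: eqflat_regular.
  move=> y; have /quotient_map0 /annih_maximal [c cE] := submod_inclP y.
  exists c; apply: submod_incl_inj; rewrite [RHS]cE; exact: mulrC.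
apply/flat_submodP; rewrite (_ : (kernel E : A^o -> Prop) = P); first exact: eqflat_maximal.
apply/funext => a; apply/propext; split=> [Ea|Pa].
  apply/annih_s; rewrite mulrC.
  by have := congr1 (@submod_incl _ _ _) Ea; rewrite linear0.
apply: submod_incl_inj; rewrite linear0; apply: etrans (mulrC _ _) _; exact/annih_s.
Qed.

(** In a chain ring every element of I K is a single product. *)
Lemma span_common_factor (M : lmodType A) (I : A -> Prop) (K : M -> Prop) (x : M) :
  is_ideal I -> is_submod K -> span I K x -> exists r (k : M), [/\ I r, K k & x = r *: k].
Proof.
move=> [I0 _ IM] [K0 KD KZ]; elim=> [|r w z Ir Kw _ [r' [k [Ir' Kk ->]]]].
  by exists 0, 0; rewrite scaler0.
have [[c ->]|[c ->]] := chain r r'.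
  exists r, (w + c *: k); split=> //; first by apply: KD => //; exact: KZ.
  by rewrite scalerDr scalerA.
exists r', (c *: w + k); split=> //; first by apply: KD => //; exact: KZ.
by rewrite scalerDr scalerA.
Qed.

(** Suppose F is a flat cover of A / s A with flat kernel K, and f in F lifts the
    generator.  Then s f is in K and s (s f) = 0, so s f = r k with k in K and
    r s = 0.  If s = r y, flatness of F puts y f - k into (0 : r) F, so y is in
    (0 : r) + s A and s = r y = 0.  If r = s c, it puts f - c k into (0 : s) F, so
    the generator of A / s A is in P (A / s A), which is impossible. *)
Lemma quotient_not_resolved : ~ flat_resolved 1 socle_quotient.
Proof.
move=> [F [e [/flatP flF eS /flat_submodP flK]]].
have Ps : P s by apply/annih_s.
have annI r : is_ideal (fun x => r * x = 0).
  split=> [|x y rx ry|a x rx]; first by rewrite mulr0.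
    by rewrite mulrDr rx ry addr0.
  by rewrite mulrCA rx mulr0.
have [f fE] := eS (quotient_map (1 : A)).
have mapZ a b : a *: quotient_map b = quotient_map (a * b).
  by rewrite -[a * b]/(a *: (b : A^o)) linearZ.
have Ksf : kernel e (s *: f).
  rewrite /= linearZ /= fE mapZ mulr1; apply/quotient_map0 => p Pp; exact/annih_s.
have /(eqflat_annih flK Ksf) : s *: (s *: f) = 0 by rewrite scalerA ss scale0r.
move=> /(span_common_factor (annI s) (submoduleP _)) [r [k [sr Kk sfE]]].
have imF t (x : F) : exists b, e (t *: x) = quotient_map (t * b).
  have [b bE] := quotient_map_surj (e x); exists b.
  by rewrite linearZ /= -bE mapZ.
have [[y sE]|[c rE]] := chain r s.
  have : r *: (y *: f - k) = 0 by rewrite scalerBr scalerA -sE sfE subrr.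
  move=> /(eqflat_annih flF I) /(span_common_factor (annI r) (@submodT _ _)).
  move=> [t [x [rt _ E]]].
  have [b bE] := imF t x.
  have : quotient_map (y - t * b) = 0.
    have -> : quotient_map (y - t * b) = quotient_map y - quotient_map (t * b).
      exact: (linearB quotient_map).
    rewrite -bE -E linearB linearZ /= fE Kk subr0 mapZ mulr1 subrr //.
  move=> /quotient_map0 /annih_maximal [d dE]; apply: s0; rewrite sE.
  have -> : y = t * b + s * d by rewrite -dE addrC subrK.
  by rewrite mulrDr !mulrA rt [r * s]mulrC sr !mul0r addr0.
have : s *: (f - c *: k) = 0 by rewrite scalerBr sfE rE scalerA subrr.
move=> /(eqflat_annih flF I) /(span_common_factor (annI s) (@submodT _ _)).
move=> [t [x [st _ E]]]; have [b bE] := imF t x.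
have : quotient_map (1 - t * b) = 0.
  have -> : quotient_map (1 - t * b) = quotient_map (1 : A) - quotient_map (t * b).
    exact: (linearB quotient_map).
  by rewrite -bE -E linearB linearZ /= fE Kk scaler0 subr0 subrr.
have Ptb : P (t * b) by apply: chain_noninvM; exact/annih_s.
have [_ PD _] := chain_ideal_noninv.
have [[u u1]|n1] := EM (invertible (1 - t * b)); last first.
  have := PD _ _ n1 Ptb; rewrite subrK => P1.
  by case: P1; exists 1; rewrite mulr1.
move=> /quotient_map0 /(_ s Ps) H; apply: s0.
by rewrite -[s]mul1r -u1 mulrAC H mul0r.
Qed.

Lemma fd_socle_quotient : fd socle_quotient = Some 2%N.
Proof.
have [m mE [Mm min]] := enat_infP (flat_resolved_resolution quotient_resolved).
rewrite /fd mE; congr Some; have := min 2%N (flat_resolved_resolution quotient_resolved).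
have {}Mm := resolution_flat_resolved Mm.
case: m {mE min} Mm => [|[|[|m]]] // H _; case: quotient_not_resolved => //.
exact: flat_resolvedS.
Qed.

Lemma chain_Fwd : Fwd A = Some 2%N.
Proof.
have ub2 n := @gaussian_fd_ub A n chain_gaussian.
have [m mE [mub min]] := @enat_infP
  [set b | forall n, (exists M : lmodType A, fd M = Some n) -> (n <= b)%N] 2%N ub2.
rewrite /Fwd /enat_sup mE; congr Some; apply/eqP; rewrite eqn_leq min //=.
by apply: mub; exists socle_quotient; exact: fd_socle_quotient.
Qed.

End ChainRing.

(** * Dyadic powers of a variable, truncated above exponent one *)

Section DyadicTruncation.
Local Open Scope ring_scope.
Variable k : fieldType.
Implicit Types (p q r : {poly k}) (m n l : nat).

(** Substituting X^(2^m) for X passes from powers of t^(1/2^n) to powers of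
    t^(1/2^(m+n)). *)
Definition stretch m p : {poly k} := p \Po 'X^(2 ^ m).

Lemma stretch_stretch m n p : stretch m (stretch n p) = stretch (m + n) p.
Proof. by rewrite /stretch -comp_polyA comp_Xn_poly -exprM -expnD. Qed.
Lemma stretchD m p q : stretch m (p + q) = stretch m p + stretch m q.
Proof. exact: comp_polyD. Qed.
Lemma stretchB m p q : stretch m (p - q) = stretch m p - stretch m q.
Proof. exact: comp_polyB. Qed.
Lemma stretchM m p q : stretch m (p * q) = stretch m p * stretch m q.
Proof. exact: comp_polyM. Qed.

Lemma coef_stretch m p i :
  (stretch m p)`_i = if (2 ^ m %| i)%N then p`_(i %/ 2 ^ m) else 0.
Proof. by rewrite coef_comp_poly_Xn // expn_gt0. Qed.

(** The condition that r(t^(1/2^n)) has only exponents greater than 1. *)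
Definition vanishing n r : Prop := forall i, (i <= 2 ^ n)%N -> r`_i = 0.

Lemma vanishing_stretch m n r : vanishing (m + n) (stretch m r) <-> vanishing n r.
Proof.
have m0 : (0 < 2 ^ m)%N by rewrite expn_gt0.
split=> H i iN.
  have := H (2 ^ m * i)%N; rewrite coef_stretch dvdn_mulr // mulKn //; apply.
  by rewrite expnD leq_mul2l iN orbT.
rewrite coef_stretch; case: ifP => // di; apply: H.
by rewrite leq_divLR // mulnC -expnD.
Qed.

Lemma vanishing0 n : vanishing n 0. Proof. by move=> i _; rewrite coef0. Qed.
Lemma vanishingD n p q : vanishing n p -> vanishing n q -> vanishing n (p + q).
Proof. by move=> Hp Hq i iN; rewrite coefD Hp // Hq // addr0. Qed.
Lemma vanishingN n p : vanishing n p -> vanishing n (- p).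
Proof. by move=> Hp i iN; rewrite coefN Hp // oppr0. Qed.
Lemma vanishingM n p q : vanishing n p -> vanishing n (p * q).
Proof.
move=> Hp i iN; rewrite coefM big1 // => j _.
by rewrite Hp ?mul0r //; apply: leq_trans iN; rewrite -ltnS.
Qed.

Lemma vanishing_stretchl m n l r : (l = m + n)%N -> vanishing n r -> vanishing l (stretch m r).
Proof. by move=> ->; move/vanishing_stretch. Qed.

(** The ring generated by all the t^(1/2^n) over k, modulo the powers of t with
    exponent greater than 1; a pair (n, p) represents p(t^(1/2^n)). *)
Definition dyadic_rel : rel (nat * {poly k}) := fun x y =>
  `[< vanishing (x.1 + y.1) (stretch y.1 x.2 - stretch x.1 y.2) >].

Fact dyadic_rel_refl : reflexive dyadic_rel.
Proof. by move=> x; apply/asboolP; rewrite subrr; exact: vanishing0. Qed.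

Fact dyadic_rel_sym : symmetric dyadic_rel.
Proof.
by move=> x y; apply/asboolP/asboolP => H; rewrite addnC -opprB; exact: vanishingN.
Qed.

Fact dyadic_rel_trans : transitive dyadic_rel.
Proof.
move=> [m q] [n p] [l r] /asboolP /= H1 /asboolP /= H2; apply/asboolP => /=.
apply/(vanishing_stretch m); rewrite stretchB !stretch_stretch.
have E1 := vanishing_stretchl (erefl (l + (n + m))%N) H1.
have E2 := vanishing_stretchl (erefl (n + (m + l))%N) H2.
have := vanishingD E1; rewrite [(n + (m + l))%N](_ : _ = l + (n + m))%N in E2; last by rewrite addnA addnC.
move=> /(_ _ E2); rewrite !stretchB !stretch_stretch.
rewrite [(n + l)%N]addnC addrA subrK [(m + (l + n))%N](_ : _ = l + (n + m))%N; last by rewrite addnC addnA.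
by rewrite [(n + m)%N]addnC [(l + m)%N]addnC.
Qed.

Canonical dyadic_equiv := EquivRel dyadic_rel
  dyadic_rel_refl dyadic_rel_sym dyadic_rel_trans.

Definition dyadic := {eq_quot dyadic_equiv}%qT.
HB.instance Definition _ := Choice.on dyadic.
HB.instance Definition _ := EqQuotient.on dyadic.

Definition mk n p : dyadic := (\pi_dyadic (n, p))%qT.

Lemma mk_eq n p m q : mk n p = mk m q <-> vanishing (n + m) (stretch m p - stretch n q).
Proof. by split=> [/eqmodP/asboolP|H]; last exact/eqmodP/asboolP. Qed.

Lemma mk_eq_level n p q : mk n p = mk n q <-> vanishing n (p - q).
Proof. by rewrite mk_eq -stretchB vanishing_stretch. Qed.

Lemma mk_stretch m n p : mk n p = mk (m + n) (stretch m p).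
Proof. by apply/mk_eq; rewrite stretch_stretch [(n + m)%N]addnC subrr; exact: vanishing0. Qed.

Lemma mkP z : exists n p, z = mk n p.
Proof. by exists (repr z).1, (repr z).2; rewrite /mk -surjective_pairing reprK. Qed.

Lemma mk2P z w : exists n p q, z = mk n p /\ w = mk n q.
Proof.
have [n [p ->]] := mkP z; have [m [q ->]] := mkP w.
exists (n + m)%N, (stretch m p), (stretch n q).
by rewrite -mk_stretch addnC -mk_stretch.
Qed.

Lemma mk3P z w y : exists n p q r, [/\ z = mk n p, w = mk n q & y = mk n r].
Proof.
have [n [p [q [-> ->]]]] := mk2P z w; have [m [r ->]] := mkP y.
exists (m + n)%N, (stretch m p), (stretch m q), (stretch n r).
by split; rewrite -?mk_stretch // addnC -mk_stretch.
Qed.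

Definition dyadic_op (op : {poly k} -> {poly k} -> {poly k}) (z w : dyadic) : dyadic :=
  mk ((repr z).1 + (repr w).1)
     (op (stretch (repr w).1 (repr z).2) (stretch (repr z).1 (repr w).2)).
Fact dyadic_key : unit. Proof. exact: tt. Qed.
Definition dyadic_add := locked_with dyadic_key (dyadic_op +%R).
Definition dyadic_mul := locked_with dyadic_key (dyadic_op *%R).
Definition dyadic_opp (z : dyadic) : dyadic := dyadic_mul (mk 0 (-1)) z.

Lemma mk_repr n p : vanishing ((repr (mk n p)).1 + n)
  (stretch n (repr (mk n p)).2 - stretch (repr (mk n p)).1 p).
Proof. by apply/mk_eq; rewrite /mk -surjective_pairing reprK. Qed.

Lemma dyadic_addE n p q : dyadic_add (mk n p) (mk n q) = mk n (p + q).
Proof.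
rewrite /dyadic_add unlock /dyadic_op.
have := @mk_repr n p; have := @mk_repr n q.
move: (repr (mk n p)) (repr (mk n q)) => [n' p'] [m' q'] /= Hq Hp.
apply/mk_eq; rewrite !stretchD !stretch_stretch opprD addrACA.
have -> : stretch (n + m') p' - stretch (n' + m') p = stretch m' (stretch n p' - stretch n' p).
  by rewrite stretchB !stretch_stretch ![(m' + _)%N]addnC.
have -> : stretch (n + n') q' - stretch (n' + m') q = stretch n' (stretch n q' - stretch m' q).
  by rewrite stretchB !stretch_stretch ![(n' + _)%N]addnC.
apply: vanishingD; first by apply: vanishing_stretchl Hp; rewrite -addnA addnCA.
by apply: vanishing_stretchl Hq; rewrite -addnA.
Qed.

Lemma dyadic_mulE n p q : dyadic_mul (mk n p) (mk n q) = mk n (p * q).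
Proof.
rewrite /dyadic_mul unlock /dyadic_op.
have := @mk_repr n p; have := @mk_repr n q.
move: (repr (mk n p)) (repr (mk n q)) => [n' p'] [m' q'] /= Hq Hp.
apply/mk_eq; rewrite !stretchM !stretch_stretch.
have -> : stretch (n + m') p' * stretch (n + n') q' - stretch (n' + m') p * stretch (n' + m') q
  = stretch m' (stretch n p' - stretch n' p) * stretch (n + n') q'
    + stretch n' (stretch n q' - stretch m' q) * stretch (n' + m') p.
  rewrite !stretchB !stretch_stretch ![(m' + _)%N]addnC ![(n' + n)%N]addnC; ring.
apply: vanishingD; apply: vanishingM.
  by apply: vanishing_stretchl Hp; rewrite -addnA addnCA.
by apply: vanishing_stretchl Hq; rewrite -addnA.
Qed.

Lemma mk_const n (c : k) : mk 0 c%:P = mk n c%:P.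
Proof. by rewrite (mk_stretch n 0) addn0 /stretch comp_polyC. Qed.

Lemma dyadic_oppE n p : dyadic_opp (mk n p) = mk n (- p).
Proof.
rewrite /dyadic_opp -[-1]/(- 1%:P) -polyCN (mk_const n) dyadic_mulE.
by rewrite polyCN mulN1r.
Qed.

Fact dyadic_addA : associative dyadic_add.
Proof.
by move=> x y z; have [n [p [q [r [-> -> ->]]]]] := mk3P x y z; rewrite !dyadic_addE addrA.
Qed.
Fact dyadic_addC : commutative dyadic_add.
Proof. by move=> x y; have [n [p [q [-> ->]]]] := mk2P x y; rewrite !dyadic_addE addrC. Qed.
Fact dyadic_add0 : left_id (mk 0 0%:P) dyadic_add.
Proof.
by move=> x; have [n [p ->]] := mkP x; rewrite (mk_const n) dyadic_addE add0r.
Qed.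
Fact dyadic_addN : left_inverse (mk 0 0%:P) dyadic_opp dyadic_add.
Proof.
move=> x; have [n [p ->]] := mkP x.
by rewrite (mk_const n) dyadic_oppE dyadic_addE addNr.
Qed.
Fact dyadic_mulA : associative dyadic_mul.
Proof.
by move=> x y z; have [n [p [q [r [-> -> ->]]]]] := mk3P x y z; rewrite !dyadic_mulE mulrA.
Qed.
Fact dyadic_mulC : commutative dyadic_mul.
Proof. by move=> x y; have [n [p [q [-> ->]]]] := mk2P x y; rewrite !dyadic_mulE mulrC. Qed.
Fact dyadic_mul1 : left_id (mk 0 1%:P) dyadic_mul.
Proof.
by move=> x; have [n [p ->]] := mkP x; rewrite (mk_const n) dyadic_mulE mul1r.
Qed.
Fact dyadic_mulDl : left_distributive dyadic_mul dyadic_add.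
Proof.
move=> x y z; have [n [p [q [r [-> -> ->]]]]] := mk3P x y z.
by rewrite !(dyadic_addE, dyadic_mulE) mulrDl.
Qed.

HB.instance Definition _ := GRing.isZmodule.Build dyadic
  dyadic_addA dyadic_addC dyadic_add0 dyadic_addN.

Fact dyadic_1neq0 : mk 0 1%:P != 0 :> dyadic.
Proof.
apply/eqP => /mk_eq_level /(_ 0%N isT); rewrite subr0 coefC eqxx => /eqP.
by rewrite oner_eq0.
Qed.

HB.instance Definition _ := GRing.Zmodule_isComNzRing.Build dyadic
  dyadic_mulA dyadic_mulC dyadic_mul1 dyadic_mulDl dyadic_1neq0.

Lemma mkM n p q : mk n p * mk n q = mk n (p * q).
Proof. exact: dyadic_mulE. Qed.

Lemma mk_eq0 n p : mk n p = 0 <-> vanishing n p.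
Proof.
have -> : (0 : dyadic) = mk n 0%:P := mk_const n 0.
by rewrite mk_eq_level subr0.
Qed.

Lemma mk1 n : mk n 1 = 1.
Proof. exact: esym (mk_const n 1). Qed.

(** A Bezout relation between p and X^(2^n + 1) provides the inverse. *)
Lemma mk_invertible n p : invertible (mk n p) <-> p`_0 != 0.
Proof.
split=> [[z]|p0].
  have [m [q ->]] := mkP z; rewrite (mk_stretch m n) (mk_stretch n m) addnC mkM.
  rewrite -(mk1 (n + m)) => /mk_eq_level /(_ 0%N isT).
  rewrite coefB coef1 coefM big_ord_recl big_ord0 addr0 /= !coef_stretch dvdn0 div0n.
  by case: eqP => // ->; rewrite mul0r sub0r => /eqP; rewrite oppr_eq0 oner_eq0.
have : coprimep p ('X ^+ (2 ^ n).+1).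
  by apply: coprimep_expr; rewrite coprimepX /root horner_coef0.
move=> /Bezout_eq1_coprimepP [[u v] /= E]; exists (mk n u).
rewrite mkM -(mk1 n); apply/mk_eq_level => i iN.
have -> : p * u - 1 = - (v * 'X^((2 ^ n).+1)) by rewrite -E; ring.
by rewrite coefN coefMXn ltnS iN oppr0.
Qed.

(** Every nonzero element is a power of t times a unit. *)
Lemma mk_order n p : mk n p = 0 \/ exists i u, [/\ (i <= 2 ^ n)%N,
  invertible u & mk n p = mk n 'X^i * u].
Proof.
have [H|H] := EM (exists i, (i <= 2 ^ n)%N && (p`_i != 0)); last first.
  left; apply/mk_eq0 => i iN; apply: contrapT => /eqP pi; apply: H.
  by exists i; rewrite iN.
right; have [i /andP [iN pi] min] := ex_minnP H.
exists i, (mk n (drop_poly i p)); split=> //.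
  by apply/mk_invertible; rewrite coef_drop_poly add0n.
rewrite mkM; congr mk; apply/polyP => j; rewrite coefXnM coef_drop_poly.
case: ltnP => [ji|ij]; last by rewrite subnK.
apply: contrapT => /eqP pj; have := min j; rewrite pj andbT => /(_ (leq_trans (ltnW ji) iN)).
by rewrite leqNgt ji.
Qed.

Lemma dyadic_chain (a b : dyadic) : (exists c, b = a * c) \/ (exists c, a = b * c).
Proof.
have divides (i j n : nat) u v : (i <= j)%N -> invertible u ->
    exists c, mk n 'X^j * v = (mk n 'X^i * u) * c.
  move=> ij [u' uu']; exists (u' * (mk n 'X^(j - i) * v)).
  rewrite mulrA -[_ * u * u']mulrA uu' mulr1 mulrA mkM -exprD subnKC //.
have [n [p [q [-> ->]]]] := mk2P a b.
have [->|[i [u [iN iu ->]]]] := mk_order n p; first by right; exists 0; rewrite mulr0.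
have [->|[j [v [jN iv ->]]]] := mk_order n q; first by left; exists 0; rewrite mulr0.
by case: (leqP i j) => [|/ltnW] ij; [left|right]; exact: divides.
Qed.

(** This is t itself, the highest power that is not zero. *)
Definition dyadic_socle : dyadic := mk 0 'X.

Lemma dyadic_socleE n : dyadic_socle = mk n 'X^(2 ^ n).
Proof.
by rewrite /dyadic_socle (mk_stretch n 0) addn0 /stretch comp_polyX.
Qed.

Lemma dyadic_socle_neq0 : dyadic_socle <> 0.
Proof.
by move=> /mk_eq0 /(_ 1%N isT); rewrite coefX => /eqP; rewrite oner_eq0.
Qed.

Lemma dyadic_socle_sq : dyadic_socle * dyadic_socle = 0.
Proof.
rewrite mkM; apply/mk_eq0 => i; rewrite expn0 -expr2 coefXn => i1.
by case: i i1 => [|[|]].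
Qed.

Lemma dyadic_annih_socle (p : dyadic) : dyadic_socle * p = 0 <-> ~ invertible p.
Proof.
have [n [q ->]] := mkP p; rewrite (dyadic_socleE n) mkM mk_invertible mk_eq0.
split=> [H|/negP]; last rewrite negbK => /eqP q0 i iN.
  by have := H _ (leqnn _); rewrite coefXnM ltnn subnn => ->; rewrite eqxx.
rewrite coefXnM; case: ltnP => // Ni.
by have -> : i = (2 ^ n)%N; [apply/eqP; rewrite eqn_leq iN|rewrite subnn].
Qed.

(** A non-unit y = q(t^(1/2^n)) is divisible by t^(1/2^n), and it suffices to
    split off its square root t^(1/2^(n+1)): exponents in b y are multiples of
    1/2^n, so those greater than 1 remain so when half a step is removed. *)
Lemma dyadic_dense (b y : dyadic) : ~ invertible y -> b * y = 0 ->
  exists c y', [/\ ~ invertible y', y = c * y' & b * c = 0].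
Proof.
have [n [p [q [-> ->]]]] := mk2P b y; rewrite mk_invertible mkM => /negP; rewrite negbK => /eqP q0.
move=> /mk_eq0 pq0; pose r := drop_poly 1 q.
have qE : q = r * 'X.
  apply/polyP => i; rewrite coefMX coef_drop_poly; case: i => [|i] //=.
  by rewrite addn1.
exists (mk (1 + n) (stretch 1 r * 'X)), (mk (1 + n) 'X); split.
- by rewrite mk_invertible coefX eqxx.
- rewrite mkM (mk_stretch 1 n) qE stretchM -mulrA; congr (mk _ (_ * _)).
  by rewrite /stretch comp_polyX expn1 expr2.
- rewrite (mk_stretch 1 n p) mkM mulrA -stretchM; apply/mk_eq0 => i iN.
  rewrite coefMX; case: i iN => [|i] //= iN; rewrite coef_stretch expn1.
  case: ifP => // /dvdnP [j ij]; rewrite ij mulnK //.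
  have := pq0 j.+1; rewrite qE mulrA coefMX /=; apply.
  by move: iN; rewrite ij expnD expn1 [(2 * _)%N]mulnC ltn_mul2r.
Qed.

End DyadicTruncation.

(** * The bound two and its sharpness *)

Theorem theorem1p1 :
  (forall R : comPzRingType, gaussian R ->
     (forall M : lmodType R, fd M <> None -> enat_le (fd M) (Some 2)) /\
     enat_le (Fwd R) (Some 2)) /\
  (exists A : comPzRingType,
     [/\ local_ring A, gaussian A, total_ring_of_quotients A &
         Fwd A = Some 2]).
Proof.
split=> [R gR|].
  split=> [M fdM|]; last exact: gaussian_Fwd_le2.
  by have [m -> m2] := gaussian_fd_le2 gR fdM.
pose k : fieldType := 'F_2.
have chain := @dyadic_chain k; exists (dyadic k); split.
- exact: chain_local chain.
- exact: chain_gaussian chain.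
- exact: chain_total (@dyadic_socle_neq0 k) (@dyadic_annih_socle k).
- exact: (chain_Fwd chain (@dyadic_socle_neq0 k) (@dyadic_socle_sq k)
    (@dyadic_annih_socle k) (@dyadic_dense k)).
Qed.
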